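(* Let $V$ be an $N_W=N$ or $N_K=N$ SUSY vertex algebra over $\mathbb C$ which is $\frac1{r_0}\mathbb N$-graded for some $r_0\in\mathbb Z_{>0}$ and finitely strongly generated. Then $V$ is $C_2$-cofinite if and only if $V$ is lisse.
   Context: Setting. The base field is $\mathbb C$, $N$ is a positive integer, $[N]=\{1<\dots<N\}$; subsets $J\subset[N]$ are ordered increasingly; $\mathbb N=\mathbb Z_{\ge0}$. A linear superspace is a $\mathbb Z/2$-graded vector space, $p(v)$ is the parity of a homogeneous $v$, the Koszul sign rule is used throughout, and $[x,y]=xy-(-1)^{p(x)p(y)}yx$. A $1|N$-supervariable $Z=(z,\zeta^1,\dots,\zeta^N)$ consists of an even $z$ and odd $\zeta^i$, all supercommuting; $Z^{j|J}=z^j\zeta^{j_1}\cdots\zeta^{j_r}$ for $J=\{j_1<\dots<j_r\}$. An $\mathrm{End}(V)$-valued superfield is $a(Z)=\sum_{j\in\mathbb Z,J\subset[N]}Z^{-1-j|[N]\setminus J}a_{(j|J)}$ with, for each $v\in V$, $a_{(j|J)}v=0$ for $j\gg0$. Write $a_{(j|N)}=a_{(j|[N])}$. An $N_W=N$ SUSY vertex algebra is $(V,|0\rangle,T,S^i,Y)$: a linear superspace $V$, an even $|0\rangle\in V$, an even operator $T$, odd operators $S^i$ ($i\in[N]$), and an even linear map $Y(\cdot,Z)$ from $V$ to $\mathrm{End}(V)$-valued superfields, $Y(a,Z)=\sum Z^{-1-j|[N]\setminus J}a_{(j|J)}$, such that $Y(a,Z)|0\rangle\in V[[Z]]$ has value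 $a$ at $Z=0$, $T|0\rangle=S^i|0\rangle=0$; $[T,Y(a,Z)]=\partial_zY(a,Z)$, $[S^i,Y(a,Z)]=\partial_{\zeta^i}Y(a,Z)$; and for all $a,b$ there is $n\in\mathbb N$ with $(z-w)^n[Y(a,Z),Y(b,W)]=0$. An $N_K=N$ SUSY vertex algebra is $(V,|0\rangle,S_K^i,Y)$ with $V,|0\rangle,Y$ as before and odd operators $S_K^i$ ($i\in[N]$) satisfying the same vacuum axiom (with $S_K^i|0\rangle=0$), the same locality axiom, and $[S_K^i,Y(a,Z)]=(\partial_{\zeta^i}-\zeta^i\partial_z)Y(a,Z)$. Graded: $V$ is $I$-graded ($I\subset\mathbb C$) if it is equipped with an even semisimple operator $H$ with eigenvalues in $I$ such that $[H,a_{(j|J)}]=-(j+1)a_{(j|J)}+(Ha)_{(j|J)}$ for all $a\in V$, $j\in\mathbb Z$, $J\subset[N]$. Finitely strongly generated: there is a finite $G\subset V$ such that $V$ is spanned by the elements $a^1_{(-p_1|P_1)}\cdots a^r_{(-p_r|P_r)}|0\rangle$ with $r\in\mathbb N$, $a^i\in G$, $p_i\in\mathbb Z_{>0}$, $P_i\subset[N]$. $C_2$-cofinite: $\dim_{\mathbb C}V/C_2(V)<\infty$, where $C_2(V)=\mathrm{span}\{a_{(-j|J)}b\mid a,b\in V,\ j\ge2,\ J\subset[N]\}$. Li filtration: $E_n=E_n(V)=\mathrm{span}\{a^1_{(-1-k_1|K_1)}\cdots a^r_{(-1-k_r|K_r)}b\mid r\in\mathbb Z_{>0},\ a^i,b\in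 V,\ k_i\in\mathbb N,\ K_i\subset[N],\ k_1+\dots+k_r\ge n\}$. One has $E_0=V$ and $E_1=C_2(V)$. The space $\mathrm{gr}_EV=\bigoplus_{n\ge0}E_n/E_{n+1}$ is a commutative superalgebra with product $(a+E_{r+1})(b+E_{s+1})=a_{(-1|N)}b+E_{r+s+1}$ for $a\in E_r$, $b\in E_s$, and unit $|0\rangle+E_1$; its degree zero part is the commutative superalgebra $R_V=V/C_2(V)=E_0/E_1$. Superjet algebra: for a commutative $\mathbb C$-superalgebra $A$, let $A_\infty$ be the commutative $A$-superalgebra generated by symbols $x^{(i)}$ ($x\in A$ homogeneous, $i\ge1$, parity that of $x$; $x^{(0)}=x$) modulo $c^{(i)}=0$ for $c\in\mathbb C$, $(x+y)^{(i)}=x^{(i)}+y^{(i)}$, $(xy)^{(i)}=\sum_{j+l=i}x^{(j)}y^{(l)}$. For a commutative superalgebra $B$ let $\mathcal S(B)=\mathrm{Sym}_B(\Pi\Omega^1_{B/\mathbb C})$ be its de Rham superalgebra ($\Omega^1_{B/\mathbb C}$ the supermodule of Kähler differentials for even derivations, $\Pi$ parity change). Put $A^O=\mathcal S^N(A_\infty)$ ($N$-fold application of $\mathcal S$). Singular support: the inclusion $R_V\hookrightarrow\mathrm{gr}_EV$ extends to a surjective morphism of commutative superalgebras $\Phi:(R_V)^O\to\mathrm{gr}_EV$, through which $\mathrm{gr}_EV$ is an $(R_V)^O$-module. The singular support of $V$ is $SS(V)=\mathrm{Supp}_{(R_V)^O}(\mathrm{gr}_EV)=\{\mathfrak p\in\mathrm{Spec}(R_V)^O\mid\mathfrak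 p\supset\mathrm{Ann}_{(R_V)^O}(\mathrm{gr}_EV)\}$. For a superscheme $X=(\underline X,\mathcal O)$ its reduced part is the scheme $X_{\mathrm{red}}=(\underline X,\mathcal O_{\bar0}/\sqrt{\mathcal O_{\bar0}})$. Lisse: $V$ is lisse if it is finitely strongly generated as a module over itself (that is, $V/C_2(V)$ is a finitely generated $R_V$-module) and $SS(V)_{\mathrm{red}}$ is $0$-dimensional. *)

(* Defs.v *)
From HB Require Import structures.
From mathcomp Require Import all_boot all_order all_algebra.
From mathcomp Require Import boolp classical_sets reals complex.

Set Implicit Arguments.
Unset Strict Implicit.
Unset Printing Implicit Defensive.

Import Order.TTheory GRing.Theory Num.Theory.
Local Open Scope classical_set_scope.
Local Open Scope quotient_scope.
Local Open Scope ring_scope.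

(* Parities are booleans: false is even, true is odd, (+) is addition mod 2. *)
Definition ksign (K : fieldType) (b : bool) : K := (-1) ^+ b.

(* Definite description, with a default value. *)
Definition the (T : Type) (d : T) (P : T -> Prop) : T :=
  match pselect (exists x, P x) with
  | left h => projT1 (cid h)
  | right _ => d
  end.

(* A Z/2-grading V = V_0 (+) V_1 is given by the projections par b onto V_b. *)
Record superspace (K : fieldType) := Superspace {
  carrier :> lmodType K;
  par : bool -> carrier -> carrier;
  par_linear : forall b, linear (par b);
  par_par : forall b c v, par b (par c v) = if b == c then par c v else 0;
  par_sum : forall v, v = par false v + par true v }.

Definition homog (K : fieldType) (V : superspace K) (b : bool) (v : V) : Prop :=
  par b v = v.

Definition span (K : fieldType) (V : lmodType K) (A : set V) : set V :=
  [set v | exists2 s : seq (K * V),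
     (forall p, p \in s -> A p.2) & v = \sum_(p <- s) p.1 *: p.2].

Definition finite_dim (K : fieldType) (V : lmodType K) : Prop :=
  exists s : seq V, span [set x | x \in s] = setT.

(* Superspaces as quotients of a type with operations by a congruence modulo  *)
(* which the axioms of a superspace hold. *)
Record sops (K : fieldType) (T : Type) := SOps {
  o0 : T;
  oadd : T -> T -> T;
  oopp : T -> T;
  oscale : K -> T -> T;
  opar : bool -> T -> T }.

Record scong (K : fieldType) (T : Type) (o : sops K T) (E : T -> T -> Prop) :
  Prop := SCong {
  sc_refl : forall s, E s s;
  sc_sym : forall s t, E s t -> E t s;
  sc_trans : forall s t u, E s t -> E t u -> E s u;
  sc_add : forall s s' t t', E s s' -> E t t' -> E (oadd o s t) (oadd o s' t');
  sc_opp : forall s s', E s s' -> E (oopp o s) (oopp o s');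
  sc_scale : forall c s s', E s s' -> E (oscale o c s) (oscale o c s');
  sc_par : forall b s s', E s s' -> E (opar o b s) (opar o b s');
  sc_addA : forall s t u, E (oadd o s (oadd o t u)) (oadd o (oadd o s t) u);
  sc_addC : forall s t, E (oadd o s t) (oadd o t s);
  sc_add0 : forall s, E (oadd o (o0 o) s) s;
  sc_addN : forall s, E (oadd o (oopp o s) s) (o0 o);
  sc_scaleA : forall c d s, E (oscale o c (oscale o d s)) (oscale o (c * d) s);
  sc_scale1 : forall s, E (oscale o 1 s) s;
  sc_scaleDr : forall c s t,
    E (oscale o c (oadd o s t)) (oadd o (oscale o c s) (oscale o c t));
  sc_scaleDl : forall c d s,
    E (oscale o (c + d) s) (oadd o (oscale o c s) (oscale o d s));
  sc_parD : forall b s t, E (opar o b (oadd o s t)) (oadd o (opar o b s) (opar o b t));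
  sc_parZ : forall b c s, E (opar o b (oscale o c s)) (oscale o c (opar o b s));
  sc_parpar : forall b c s,
    E (opar o b (opar o c s)) (if b == c then opar o c s else o0 o);
  sc_parsum : forall s, E s (oadd o (opar o false s) (opar o true s)) }.

(* The laws of a commutative superalgebra, modulo E. *)
Record calg_laws (K : fieldType) (T : Type) (o : sops K T) (one : T)
    (mul : T -> T -> T) (E : T -> T -> Prop) : Prop := CAlgLaws {
  ca_mul : forall s s' t t', E s s' -> E t t' -> E (mul s t) (mul s' t');
  ca_mulA : forall s t u, E (mul s (mul t u)) (mul (mul s t) u);
  ca_mul1 : forall s, E (mul one s) s;
  ca_mulDl : forall s t u, E (mul (oadd o s t) u) (oadd o (mul s u) (mul t u));
  ca_mulDr : forall s t u, E (mul s (oadd o t u)) (oadd o (mul s t) (mul s u));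
  ca_mulZl : forall c s t, E (mul (oscale o c s) t) (oscale o c (mul s t));
  ca_mulZr : forall c s t, E (mul s (oscale o c t)) (oscale o c (mul s t));
  ca_par1 : E (opar o false one) one;
  ca_parM : forall b c s t,
    E (opar o (b (+) c) (mul (opar o b s) (opar o c t))) (mul (opar o b s) (opar o c t));
  ca_mulC : forall b c s t,
    E (mul (opar o b s) (opar o c t))
      (oscale o (ksign K (b && c)) (mul (opar o c t) (opar o b s))) }.

(* The smallest relation having a property P stable under intersections. *)
Definition smallest_rel (T : Type) (P : (T -> T -> Prop) -> Prop) : T -> T -> Prop :=
  fun s t => forall E, P E -> E s t.

Section Quotient.
Variables (K : fieldType) (T : Type) (o : sops K T) (E : T -> T -> Prop).
Hypothesis hE : scong o E.

Definition qrel : rel {classic T} := fun s t => `[<E s t>].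

Lemma qrel_equiv : equiv_class_of qrel.
Proof.
split.
- by move=> s; apply/asboolP; exact: (sc_refl hE).
- by move=> s t; apply/asboolP/asboolP; exact: (sc_sym hE).
- move=> t s u /asboolP st /asboolP tu; apply/asboolP.
  exact: (sc_trans hE) st tu.
Qed.

Canonical qequiv := EquivRelPack qrel_equiv.

Definition qtype := {eq_quot qequiv}.
HB.instance Definition _ := Choice.on qtype.

Definition qcl (t : T) : qtype := \pi_(qtype) (t : {classic T}).
Definition qrep (q : qtype) : T := repr q.

Lemma qrepK q : qcl (qrep q) = q.
Proof. exact: reprK. Qed.

Lemma qclP s t : qcl s = qcl t <-> E s t.
Proof.
split=> [/eqmodP /asboolP //|st].
by apply/eqmodP/asboolP.
Qed.

Lemma qrep_cl t : E (qrep (qcl t)) t.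
Proof. by apply/qclP; rewrite qrepK. Qed.

Definition qadd (p q : qtype) := qcl (oadd o (qrep p) (qrep q)).
Definition qopp (p : qtype) := qcl (oopp o (qrep p)).
Definition qscale c (p : qtype) := qcl (oscale o c (qrep p)).
Definition qpar b (p : qtype) := qcl (opar o b (qrep p)).

Lemma qaddE s t : qadd (qcl s) (qcl t) = qcl (oadd o s t).
Proof. by apply/qclP; apply: (sc_add hE); exact: qrep_cl. Qed.
Lemma qoppE s : qopp (qcl s) = qcl (oopp o s).
Proof. by apply/qclP; apply: (sc_opp hE); exact: qrep_cl. Qed.
Lemma qscaleE c s : qscale c (qcl s) = qcl (oscale o c s).
Proof. by apply/qclP; apply: (sc_scale hE); exact: qrep_cl. Qed.
Lemma qparE b s : qpar b (qcl s) = qcl (opar o b s).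
Proof. by apply/qclP; apply: (sc_par hE); exact: qrep_cl. Qed.

Lemma qaddA : associative qadd.
Proof.
move=> p q r; rewrite -(qrepK p) -(qrepK q) -(qrepK r) !qaddE.
by apply/qclP; exact: (sc_addA hE).
Qed.
Lemma qaddC : commutative qadd.
Proof.
move=> p q; rewrite -(qrepK p) -(qrepK q) !qaddE.
by apply/qclP; exact: (sc_addC hE).
Qed.
Lemma qadd0 : left_id (qcl (o0 o)) qadd.
Proof.
by move=> p; rewrite -(qrepK p) qaddE; apply/qclP; exact: (sc_add0 hE).
Qed.
Lemma qaddN : left_inverse (qcl (o0 o)) qopp qadd.
Proof.
by move=> p; rewrite -(qrepK p) qoppE qaddE; apply/qclP; exact: (sc_addN hE).
Qed.

HB.instance Definition _ := GRing.isZmodule.Build qtype qaddA qaddC qadd0 qaddN.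

Lemma qscaleA c d p : qscale c (qscale d p) = qscale (c * d) p.
Proof.
by rewrite -(qrepK p) !qscaleE; apply/qclP; exact: (sc_scaleA hE).
Qed.
Lemma qscale1 : left_id 1 qscale.
Proof. by move=> p; rewrite -(qrepK p) qscaleE; apply/qclP; exact: (sc_scale1 hE). Qed.
Lemma qscaleDr : right_distributive qscale qadd.
Proof.
move=> c p q; rewrite -(qrepK p) -(qrepK q) qaddE !qscaleE qaddE.
by apply/qclP; exact: (sc_scaleDr hE).
Qed.
Lemma qscaleDl p : {morph qscale^~ p : c d / c + d >-> c + d}.
Proof.
move=> c d; rewrite -(qrepK p) !qscaleE [RHS]qaddE.
by apply/qclP; exact: (sc_scaleDl hE).
Qed.

HB.instance Definition _ := GRing.Zmodule_isLmodule.Build K qtype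
  qscaleA qscale1 qscaleDr qscaleDl.

Lemma qpar_linear b : linear (qpar b).
Proof.
move=> c p q; rewrite -(qrepK p) -(qrepK q).
rewrite [c *: _]qscaleE [_ + _]qaddE !qparE [c *: _]qscaleE [RHS]qaddE.
apply/qclP; apply: (sc_trans hE); first exact: (sc_parD hE).
by apply: (sc_add hE); [exact: (sc_parZ hE)|exact: (sc_refl hE)].
Qed.
Lemma qpar_par b c p : qpar b (qpar c p) = if b == c then qpar c p else 0.
Proof.
rewrite -(qrepK p) !qparE; have /qclP := sc_parpar hE b c (qrep p).
by move=> ->; case: ifP.
Qed.
Lemma qpar_sum p : p = qpar false p + qpar true p.
Proof.
rewrite -{1}(qrepK p) -{2 3}(qrepK p) !qparE [RHS]qaddE.
by apply/qclP; exact: (sc_parsum hE).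
Qed.

Definition squot : superspace K := Superspace qpar_linear qpar_par qpar_sum.
End Quotient.

Definition ops_of (K : fieldType) (V : superspace K) : sops K V :=
  SOps 0 +%R -%R *:%R (@par K V).

(* The operations of a superalgebra; is_comsalg states the laws of a          *)
(* commutative superalgebra.  Jet and de Rham superalgebras are given by      *)
(* generators and relations, for which the operations suffice. *)
Record salg (K : fieldType) := SAlg {
  salg_space :> superspace K;
  sone : salg_space;
  smul : salg_space -> salg_space -> salg_space }.

Definition is_comsalg (K : fieldType) (A : salg K) : Prop :=
  calg_laws (ops_of A) (sone A) (@smul K A) eq.

Record salg_morph (K : fieldType) (A B : salg K) (f : A -> B) : Prop := SAlgMorph {
  sm_linear : linear f;
  sm_par : forall b x, f (par b x) = par b (f x);
  sm_one : f (sone A) = sone B;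
  sm_mul : forall x y, f (smul x y) = smul (f x) (f y) }.

(* Commutative superalgebras by generators (indexed by X) and relations. *)
Inductive aterm (K : fieldType) (X : Type) : Type :=
| AGen of X
| AZero
| AAdd of aterm K X & aterm K X
| AOpp of aterm K X
| AScale of K & aterm K X
| APar of bool & aterm K X
| AOne
| AMul of aterm K X & aterm K X.
Arguments AGen {K X}.
Arguments AZero {K X}.
Arguments AOne {K X}.

Definition aops (K : fieldType) (X : Type) : sops K (aterm K X) :=
  SOps AZero (@AAdd K X) (@AOpp K X) (@AScale K X) (@APar K X).

Section Presentation.
Variables (K : fieldType) (X : Type) (r : aterm K X -> aterm K X -> Prop).

Definition aeqv : aterm K X -> aterm K X -> Prop :=
  smallest_rel (fun E => [/\ scong (aops K X) E,
    calg_laws (aops K X) AOne (@AMul K X) E & forall s t, r s t -> E s t]).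

Lemma aeqv_scong : scong (aops K X) aeqv.
Proof.
split.
- by move=> s E [h _ _]; apply: (sc_refl h).
- by move=> s t st E hE; case: (hE) => h _ _; apply: (sc_sym h); apply: st.
- move=> s t u st tu E hE; case: (hE) => h _ _.
  by apply: (sc_trans h) (st _ hE) (tu _ hE).
- move=> s s' t t' ss tt E hE; case: (hE) => h _ _.
  by apply: (sc_add h); [apply: ss|apply: tt].
- by move=> s s' ss E hE; case: (hE) => h _ _; apply: (sc_opp h); apply: ss.
- by move=> c s s' ss E hE; case: (hE) => h _ _; apply: (sc_scale h); apply: ss.
- by move=> b s s' ss E hE; case: (hE) => h _ _; apply: (sc_par h); apply: ss.
- by move=> s t u E [h _ _]; apply: (sc_addA h).
- by move=> s t E [h _ _]; apply: (sc_addC h).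
- by move=> s E [h _ _]; apply: (sc_add0 h).
- by move=> s E [h _ _]; apply: (sc_addN h).
- by move=> c d s E [h _ _]; apply: (sc_scaleA h).
- by move=> s E [h _ _]; apply: (sc_scale1 h).
- by move=> c s t E [h _ _]; apply: (sc_scaleDr h).
- by move=> c d s E [h _ _]; apply: (sc_scaleDl h).
- by move=> b s t E [h _ _]; apply: (sc_parD h).
- by move=> b c s E [h _ _]; apply: (sc_parZ h).
- by move=> b c s E [h _ _]; apply: (sc_parpar h).
- by move=> s E [h _ _]; apply: (sc_parsum h).
Qed.

Lemma aeqv_laws : calg_laws (aops K X) AOne (@AMul K X) aeqv.
Proof.
split.
- move=> s s' t t' ss tt E hE; case: (hE) => _ h _.
  by apply: (ca_mul h); [apply: ss|apply: tt].
- by move=> s t u E [_ h _]; apply: (ca_mulA h).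
- by move=> s E [_ h _]; apply: (ca_mul1 h).
- by move=> s t u E [_ h _]; apply: (ca_mulDl h).
- by move=> s t u E [_ h _]; apply: (ca_mulDr h).
- by move=> c s t E [_ h _]; apply: (ca_mulZl h).
- by move=> c s t E [_ h _]; apply: (ca_mulZr h).
- by move=> E [_ h _]; apply: (ca_par1 h).
- by move=> b c s t E [_ h _]; apply: (ca_parM h).
- by move=> b c s t E [_ h _]; apply: (ca_mulC h).
Qed.

Definition pres : salg K :=
  @SAlg K (squot aeqv_scong) (qcl aeqv_scong AOne)
    (fun p q => qcl aeqv_scong (AMul (qrep p) (qrep q))).

Definition acl (t : aterm K X) : pres := qcl aeqv_scong t.

Lemma acl_mul s t : smul (acl s) (acl t) = acl (AMul s t).
Proof. by apply/qclP; exact: (ca_mul aeqv_laws (qrep_cl aeqv_scong s) (qrep_cl aeqv_scong t)). Qed.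

Lemma pres_comsalg : is_comsalg pres.
Proof.
have rK (p : pres) : p = acl (qrep p) by rewrite /acl qrepK.
have addE s t : acl s + acl t = acl (AAdd s t) by exact: qaddE.
have scE c s : c *: acl s = acl (AScale c s) by exact: qscaleE.
have parE b s : par b (acl s) = acl (APar b s) by exact: qparE.
split; cbn [oadd oscale opar ops_of].
- by move=> s s' t t' -> ->.
- move=> s t u; rewrite (rK s) (rK t) (rK u) !acl_mul.
  by apply/qclP; exact: (ca_mulA aeqv_laws).
- move=> s; rewrite (rK s) -[sone pres]/(acl AOne) acl_mul.
  by apply/qclP; exact: (ca_mul1 aeqv_laws).
- move=> s t u; rewrite (rK s) (rK t) (rK u) addE !acl_mul addE.
  by apply/qclP; exact: (ca_mulDl aeqv_laws).
- move=> s t u; rewrite (rK s) (rK t) (rK u) addE !acl_mul addE.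
  by apply/qclP; exact: (ca_mulDr aeqv_laws).
- move=> c s t; rewrite (rK s) (rK t) scE !acl_mul scE.
  by apply/qclP; exact: (ca_mulZl aeqv_laws).
- move=> c s t; rewrite (rK s) (rK t) scE !acl_mul scE.
  by apply/qclP; exact: (ca_mulZr aeqv_laws).
- rewrite -[sone pres]/(acl AOne) parE.
  by apply/qclP; exact: (ca_par1 aeqv_laws).
- move=> b c s t; rewrite (rK s) (rK t) (parE b) (parE c) acl_mul parE.
  by apply/qclP; exact: (ca_parM aeqv_laws).
- move=> b c s t; rewrite (rK s) (rK t) (parE b) (parE c) !acl_mul scE.
  by apply/qclP; exact: (ca_mulC aeqv_laws).
Qed.
End Presentation.

(* The generator AGen (x, i) is the symbol x^(i).  For x not homogeneous,     *)
(* jet_add and jet_par make x^(i) the sum of the symbols of its components.   *)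
(* jet_one, jet_scale and the case i = 0 of jet_add, jet_mul and jet_par make *)
(* x |-> x^(0) a morphism of superalgebras. *)
Inductive jet_rel (K : fieldType) (A : salg K) :
    aterm K (A * nat) -> aterm K (A * nat) -> Prop :=
| jet_one : jet_rel (AGen (sone A, 0%N)) AOne
| jet_scale c x : jet_rel (AGen (c *: x, 0%N)) (AScale c (AGen (x, 0%N)))
| jet_const c i : (0 < i)%N -> jet_rel (AGen (c *: sone A, i)) AZero
| jet_add x y i : jet_rel (AGen (x + y, i)) (AAdd (AGen (x, i)) (AGen (y, i)))
| jet_mul x y i : jet_rel (AGen (smul x y, i))
    (\big[@AAdd K _/AZero]_(j < i.+1) AMul (AGen (x, nat_of_ord j)) (AGen (y, (i - j)%N)))
| jet_par b x i : jet_rel (AGen (par b x, i)) (APar b (AGen (x, i))).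

Definition jets (K : fieldType) (A : salg K) : salg K := pres (@jet_rel K A).
Definition jet (K : fieldType) (A : salg K) (x : A) (i : nat) : jets A :=
  acl (@jet_rel K A) (AGen (x, i)).

(* Left supermodules over B (operations and their laws). *)
Record smod (K : fieldType) (B : salg K) := SMod {
  smod_space :> superspace K;
  sact : B -> smod_space -> smod_space }.

Record smod_laws (K : fieldType) (B : salg K) (T : Type) (o : sops K T)
    (act : B -> T -> T) (E : T -> T -> Prop) : Prop := SModLaws {
  sl_act : forall x s s', E s s' -> E (act x s) (act x s');
  sl_actDr : forall x s t, E (act x (oadd o s t)) (oadd o (act x s) (act x t));
  sl_actDl : forall x y s, E (act (x + y) s) (oadd o (act x s) (act y s));
  sl_actZr : forall x c s, E (act x (oscale o c s)) (oscale o c (act x s));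
  sl_actZl : forall x c s, E (act (c *: x) s) (oscale o c (act x s));
  sl_act1 : forall s, E (act (sone B) s) s;
  sl_actA : forall x y s, E (act (smul x y) s) (act x (act y s));
  sl_actpar : forall b c x s,
    E (opar o (b (+) c) (act (par b x) (opar o c s))) (act (par b x) (opar o c s)) }.

(* Kaehler differentials: the supermodule generated by dx (x in B) subject to *)
(* the relations making d an even derivation. *)
Inductive mterm (K : fieldType) (B : salg K) : Type :=
| MD of B
| MZero
| MAdd of mterm B & mterm B
| MOpp of mterm B
| MScale of K & mterm B
| MPar of bool & mterm B
| MAct of B & mterm B.
Arguments MZero {K B}.

Definition mops (K : fieldType) (B : salg K) : sops K (mterm B) :=
  SOps MZero (@MAdd K B) (@MOpp K B) (@MScale K B) (@MPar K B).

Inductive kahler_rel (K : fieldType) (B : salg K) : mterm B -> mterm B -> Prop :=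
| kahler_lin c x y :
    kahler_rel (MD (c *: x + y)) (MAdd (MScale c (MD x)) (MD y))
| kahler_par b x : kahler_rel (MD (par b x)) (MPar b (MD x))
| kahler_mul b c x y : homog b x -> homog c y ->
    kahler_rel (MD (smul x y))
      (MAdd (MAct x (MD y)) (MScale (ksign K (b && c)) (MAct y (MD x)))).

Section Kahler.
Variables (K : fieldType) (B : salg K).

Definition keqv : mterm B -> mterm B -> Prop :=
  smallest_rel (fun E => [/\ scong (mops B) E, smod_laws (mops B) (@MAct K B) E
    & forall s t, kahler_rel s t -> E s t]).

Lemma keqv_scong : scong (mops B) keqv.
Proof.
split.
- by move=> s E [h _ _]; apply: (sc_refl h).
- by move=> s t st E hE; case: (hE) => h _ _; apply: (sc_sym h); apply: st.
- move=> s t u st tu E hE; case: (hE) => h _ _.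
  by apply: (sc_trans h) (st _ hE) (tu _ hE).
- move=> s s' t t' ss tt E hE; case: (hE) => h _ _.
  by apply: (sc_add h); [apply: ss|apply: tt].
- by move=> s s' ss E hE; case: (hE) => h _ _; apply: (sc_opp h); apply: ss.
- by move=> c s s' ss E hE; case: (hE) => h _ _; apply: (sc_scale h); apply: ss.
- by move=> b s s' ss E hE; case: (hE) => h _ _; apply: (sc_par h); apply: ss.
- by move=> s t u E [h _ _]; apply: (sc_addA h).
- by move=> s t E [h _ _]; apply: (sc_addC h).
- by move=> s E [h _ _]; apply: (sc_add0 h).
- by move=> s E [h _ _]; apply: (sc_addN h).
- by move=> c d s E [h _ _]; apply: (sc_scaleA h).
- by move=> s E [h _ _]; apply: (sc_scale1 h).
- by move=> c s t E [h _ _]; apply: (sc_scaleDr h).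
- by move=> c d s E [h _ _]; apply: (sc_scaleDl h).
- by move=> b s t E [h _ _]; apply: (sc_parD h).
- by move=> b c s E [h _ _]; apply: (sc_parZ h).
- by move=> b c s E [h _ _]; apply: (sc_parpar h).
- by move=> s E [h _ _]; apply: (sc_parsum h).
Qed.

Definition kahler : smod B :=
  @SMod K B (squot keqv_scong) (fun x m => qcl keqv_scong (MAct x (qrep m))).
Definition kd (x : B) : kahler := qcl keqv_scong (MD x).
End Kahler.

(* Pi M is M with the opposite parity, and x . (Pi m) = (-1)^p(x) Pi (x . m). *)
Section ParityChange.
Variables (K : fieldType) (B : salg K) (M : smod B).

Lemma Pi_linear b : linear (@par K M (~~ b)).
Proof. exact: par_linear. Qed.
Lemma Pi_par b c (v : M) :
  par (~~ b) (par (~~ c) v) = if b == c then par (~~ c) v else 0.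
Proof. by rewrite par_par (inj_eq negb_inj). Qed.
Lemma Pi_sum (v : M) : v = par (~~ false) v + par (~~ true) v.
Proof. by rewrite addrC; exact: par_sum. Qed.

Definition Pi : smod B :=
  @SMod K B (Superspace Pi_linear Pi_par Pi_sum)
    (fun x m => sact (par false x) (m : M) - sact (par true x) (m : M)).
End ParityChange.

Inductive sym_rel (K : fieldType) (B : salg K) (M : smod B) :
    aterm K (B + M) -> aterm K (B + M) -> Prop :=
| sym_baselin c x y : sym_rel (AGen (inl (c *: x + y)))
    (AAdd (AScale c (AGen (inl x))) (AGen (inl y)))
| sym_basepar b x : sym_rel (AGen (inl (par b x))) (APar b (AGen (inl x)))
| sym_baseone : sym_rel (AGen (inl (sone B))) AOne
| sym_basemul x y :
    sym_rel (AGen (inl (smul x y))) (AMul (AGen (inl x)) (AGen (inl y)))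
| sym_add m n : sym_rel (AGen (inr (m + n))) (AAdd (AGen (inr m)) (AGen (inr n)))
| sym_par b m : sym_rel (AGen (inr (par b m))) (APar b (AGen (inr m)))
| sym_act x m : sym_rel (AGen (inr (sact x m))) (AMul (AGen (inl x)) (AGen (inr m))).

Definition Sym (K : fieldType) (B : salg K) (M : smod B) : salg K :=
  pres (@sym_rel K B M).

Definition deRham (K : fieldType) (B : salg K) : salg K := Sym (Pi (kahler B)).
Definition deRham_in (K : fieldType) (B : salg K) (x : B) : deRham B :=
  acl (@sym_rel K B (Pi (kahler B))) (AGen (inl x)).
(* The odd derivation Pi o d : B -> Pi Omega_B. *)
Definition deRham_d (K : fieldType) (B : salg K) (x : B) : deRham B :=
  acl (@sym_rel K B (Pi (kahler B))) (AGen (inr (kd x))).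

Fixpoint deRham_iter (K : fieldType) (n : nat) (B : salg K) : salg K :=
  if n is n'.+1 then deRham (deRham_iter n' B) else B.

Definition superjet (K : fieldType) (N : nat) (A : salg K) : salg K :=
  deRham_iter N (jets A).

(* Points of Spec B are the prime ideals.  These contain the odd elements     *)
(* (whose squares vanish), so they are automatically Z/2-graded. *)
Record ideal (K : fieldType) (B : salg K) (I : set B) : Prop := Ideal {
  ideal0 : I 0;
  idealD : forall x y, I x -> I y -> I (x + y);
  idealMl : forall x y, I y -> I (smul x y);
  idealMr : forall x y, I x -> I (smul x y) }.

Definition Spec (K : fieldType) (B : salg K) : set (set B) :=
  [set p | [/\ ideal p, ~ p (sone B)
             & forall x y, p (smul x y) -> p x \/ p y]].

(* Krull dimension of subspaces X of Spec B with the Zariski topology. *)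
Definition zariski_closed (B : Type) (X Z : set (set B)) : Prop :=
  exists I : set B, Z = [set p | X p /\ I `<=` p].

Definition irreducible_closed (B : Type) (X Z : set (set B)) : Prop :=
  [/\ zariski_closed X Z, Z !=set0 &
      forall Z1 Z2, zariski_closed X Z1 -> zariski_closed X Z2 ->
        Z `<=` Z1 `|` Z2 -> Z `<=` Z1 \/ Z `<=` Z2].

(* Dimension at most 0: no chain of length 1 of irreducible closed subsets.   *)
(* The empty space is allowed. *)
Definition zero_dimensional (B : Type) (X : set (set B)) : Prop :=
  forall Z0 Z1, irreducible_closed X Z0 -> irreducible_closed X Z1 ->
    Z0 `<=` Z1 -> Z0 = Z1.

(* modes a j J v is a_(j|J) v; subsets of [N] are sets of ordinals, [N] = setT. *)
Record susy_data (K : fieldType) (N : nat) (V : superspace K) := SusyData {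
  vac : V;
  susyS : 'I_N -> V -> V;
  modes : V -> int -> {set 'I_N} -> V -> V;
  vac_even : homog false vac;
  susyS_linear : forall i, linear (susyS i);
  susyS_odd : forall i b v, homog b v -> homog (~~ b) (susyS i v);
  modes_linearl : forall j J v, linear (fun a => modes a j J v);
  modes_linearr : forall a j J, linear (modes a j J);
  modes_even : forall a j J v p q, homog p a -> homog q v ->
    homog (p (+) odd #|~: J| (+) q) (modes a j J v);
  modes_field : forall a v, exists n : int, forall j J, n <= j -> modes a j J v = 0 }.

(* f : series V N stands for the sum of the Z^(j|J) f_(j,J). *)
Definition series (K : fieldType) (N : nat) (V : superspace K) :=
  int -> {set 'I_N} -> V -> V.

Section SusyVertexAlgebra.
Variables (K : fieldType) (N : nat) (V : superspace K) (X : susy_data N V).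

Local Notation "|0>" := (vac X).
Local Notation S := (susyS X).
Local Notation Y := (modes X).

Definition field_of (a : V) : series N V := fun j J v => Y a (-1 - j) (~: J) v.

(* The sign of moving zeta^i past the zeta^k with k in J, k < i. *)
Definition zeta_sign (i : 'I_N) (J : {set 'I_N}) : K :=
  (-1) ^+ #|[set k in J | (k < i)%N]%SET|.

Definition der_z (f : series N V) : series N V :=
  fun j J v => (j + 1)%:~R *: f (j + 1) J v.
Definition der_zeta (i : 'I_N) (f : series N V) : series N V :=
  fun j J v => if i \in J then 0 else zeta_sign i J *: f j (i |: J) v.
Definition mul_zeta (i : 'I_N) (f : series N V) : series N V :=
  fun j J v => if i \in J then zeta_sign i J *: f j (J :\ i) v else 0.

Definition comm_even (D : V -> V) (f : series N V) : series N V :=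
  fun j J v => D (f j J v) - f j J (D v).
(* [D, f] for D odd and f of parity p; moving D past Z^(j|J) gives (-1)^|J|. *)
Definition comm_odd (D : V -> V) (p : bool) (f : series N V) : series N V :=
  fun j J v => (-1) ^+ #|J| *: D (f j J v) - ksign K p *: f j J (D v).

(* Series in Z and W, expanded as Z^(j|J) W^(k|L) h_(j,J,k,L). *)
Definition series2 := int -> {set 'I_N} -> int -> {set 'I_N} -> V -> V.

(* [f(Z), g(W)] for f, g of parities p, q: f_(j,J) has parity p + |J| and is  *)
(* moved past W^(k|L) in f(Z) g(W); g_(k,L) W^... is treated likewise in      *)
(* g(W) f(Z), where W^(k|L) Z^(j|J) = (-1)^(|J||L|) Z^(j|J) W^(k|L). *)
Definition comm2 (p q : bool) (f g : series N V) : series2 := fun j J k L v =>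
  ksign K ((p (+) odd #|J|) && odd #|L|) *: f j J (g k L v)
  - ksign K (p && q) *: (ksign K ((q (+) odd #|L|) && odd #|J|) *:
      (ksign K (odd #|J| && odd #|L|) *: g k L (f j J v))).

Definition mul_zw (h : series2) : series2 :=
  fun j J k L v => h (j - 1) J k L v - h j J (k - 1) L v.

Record vacuum_locality : Prop := VacuumLocality {
  vac_regular : forall a j J, j < 0 -> field_of a j J |0> = 0;
  vac_value : forall a, field_of a 0 finset.set0 |0> = a;
  vac_S : forall i, S i |0> = 0;
  locality : forall p q a b, homog p a -> homog q b ->
    exists n : nat, forall j J k L v,
      iter n mul_zw (comm2 p q (field_of a) (field_of b)) j J k L v = 0 }.

Record NW_axioms (T : V -> V) : Prop := NWAxioms {
  NW_T_linear : linear T;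
  NW_T_even : forall b v, homog b v -> homog b (T v);
  NW_vacuum : vacuum_locality;
  NW_T_vac : T |0> = 0;
  NW_T : forall a j J v,
    comm_even T (field_of a) j J v = der_z (field_of a) j J v;
  NW_S : forall i p a, homog p a -> forall j J v,
    comm_odd (S i) p (field_of a) j J v = der_zeta i (field_of a) j J v }.

Record NK_axioms : Prop := NKAxioms {
  NK_vacuum : vacuum_locality;
  NK_S : forall i p a, homog p a -> forall j J v,
    comm_odd (S i) p (field_of a) j J v =
      der_zeta i (field_of a) j J v - mul_zeta i (der_z (field_of a)) j J v }.

(* Semisimplicity of H with eigenvalues in I: V is spanned by eigenvectors. *)
Definition is_graded (I : set K) : Prop := exists H : V -> V,
  [/\ linear H, forall b v, homog b v -> homog b (H v),
      span [set v | exists2 c, I c & H v = c *: v] = setT,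
      forall v c, v != 0 -> H v = c *: v -> I c &
      forall a j J v, H (Y a j J v) - Y a j J (H v) =
        - ((j + 1)%:~R *: Y a j J v) + Y (H a) j J v].

Definition finitely_strongly_generated : Prop := exists G : seq V,
  span [set v | exists2 w : seq (V * nat * {set 'I_N}),
      (forall t, t \in w -> t.1.1 \in G /\ (0 < t.1.2)%N) &
      v = foldr (fun t u => Y t.1.1 (- t.1.2%:Z) t.2 u) |0> w] = setT.

Definition C2 : set V :=
  span [set v | exists a b (j : nat) J, (2 <= j)%N /\ v = Y a (- j%:Z) J b].

Definition word_act (w : seq (V * nat * {set 'I_N})) (b : V) : V :=
  foldr (fun t u => Y t.1.1 (- 1 - t.1.2%:Z) t.2 u) b w.

Definition Li (n : nat) : set V :=
  span [set v | exists w b, [/\ (0 < size w)%N,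
    (n <= \sum_(t <- w) t.1.2)%N & v = word_act w b]].

End SusyVertexAlgebra.

Section SpanTheory.
Variables (K : fieldType) (V : lmodType K) (A : set V).

Lemma span0 : span A 0.
Proof. by exists [::] => //; rewrite big_nil. Qed.
Lemma spanD u v : span A u -> span A v -> span A (u + v).
Proof.
move=> [s sA ->] [t tA ->]; exists (s ++ t); last by rewrite big_cat.
by move=> p; rewrite mem_cat => /orP[/sA|/tA].
Qed.
Lemma spanZ c v : span A v -> span A (c *: v).
Proof.
move=> [s sA ->]; exists [seq (c * p.1, p.2) | p <- s].
  by move=> p /mapP[q /sA ? ->].
by rewrite big_map scaler_sumr; apply: eq_bigr => p _; rewrite scalerA.
Qed.
Lemma spanN v : span A v -> span A (- v).
Proof. by rewrite -scaleN1r; apply: spanZ. Qed.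
Lemma span_in v : A v -> span A v.
Proof.
move=> Av; exists [:: (1, v)]; last by rewrite big_seq1 scale1r.
by move=> p; rewrite inE => /eqP ->.
Qed.
Lemma span_ind (P : set V) : P 0 -> (forall u v, P u -> P v -> P (u + v)) ->
  (forall c v, P v -> P (c *: v)) -> (A `<=` P) -> span A `<=` P.
Proof.
move=> P0 PD PZ AP v [s sA ->]; rewrite big_seq; apply: big_ind => //.
by move=> p /sA /AP; apply: PZ.
Qed.
End SpanTheory.

Section LinearMaps.
Variables (K : fieldType) (U W : lmodType K) (f : U -> W).
Hypothesis lf : linear f.
Lemma lin0 : f 0 = 0.
Proof. by have := lf (-1) 0 0; rewrite scaler0 addr0 scaleN1r addNr. Qed.
Lemma linD u v : f (u + v) = f u + f v.
Proof. by have := lf 1 u v; rewrite !scale1r. Qed.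
Lemma linZ c u : f (c *: u) = c *: f u.
Proof. by have := lf c u 0; rewrite !addr0 lin0 addr0. Qed.
Lemma linN u : f (- u) = - f u.
Proof. by rewrite -scaleN1r linZ scaleN1r. Qed.
Lemma span_map (A : set U) (B : set W) :
  (forall u, A u -> span B (f u)) -> forall u, span A u -> span B (f u).
Proof.
move=> AB; apply: (span_ind (P := fun u => span B (f u))) => //.
- by rewrite lin0; exact: span0.
- by move=> u v fu fv; rewrite linD; exact: spanD.
- by move=> c v fv; rewrite linZ; exact: spanZ.
Qed.
End LinearMaps.

Section Graded.
Variables (K : fieldType) (N : nat) (V : superspace K) (X : susy_data N V).
Local Notation Y := (modes X).

Lemma homog_par b (v : V) : homog b (par b v).
Proof. by rewrite /homog par_par eqxx. Qed.

Lemma par_homog b c (v : V) : homog c v -> par b v = if b == c then v else 0.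
Proof. by move=> hv; rewrite -[in LHS]hv par_par hv. Qed.

Lemma par_modes c a j J v :
  par c (Y a j J v) =
    Y (par false a) j J (par (c (+) odd #|~: J|) v)
    + Y (par true a) j J (par (~~ c (+) odd #|~: J|) v).
Proof.
have PL := @par_linear _ V; have YL := modes_linearr X.
have E p q : par c (Y (par p a) j J (par q v)) =
    if q == c (+) p (+) odd #|~: J| then Y (par p a) j J (par q v) else 0.
  rewrite (par_homog _ (modes_even X j J (homog_par p a) (homog_par q v))).
  by case: (odd _) c p q => [] [] [] [].
rewrite {1}(par_sum a) (linD (modes_linearl X j J v)).
rewrite {1 2}(par_sum v) !(linD (YL _ _ _)) !(linD (PL _)) !E.
by clear E; case: (odd _) c => [] [] /=; rewrite ?addr0 ?add0r.
Qed.

Lemma C2_par c v : C2 X v -> C2 X (par c v).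
Proof.
apply: span_map; first exact: par_linear.
move=> _ [a [b [j [J [j2 ->]]]]]; rewrite par_modes; apply: spanD;
  by apply: span_in; do 4! eexists; split; first exact: j2.
Qed.

Lemma word_act_par c w b :
  span [set v | exists w' b', [/\ size w' = size w,
    (\sum_(t <- w') t.1.2 = \sum_(t <- w) t.1.2)%N & v = word_act X w' b']]
    (par c (word_act X w b)).
Proof.
elim: w c => [|[[a k] J] w IH] c /=.
  by apply: span_in; exists [::], (par c b).
rewrite par_modes; apply: spanD.
- apply: span_map (IH _); first exact: modes_linearr.
  move=> _ [w' [b' [sw' kw' ->]]]; apply: span_in.
  by exists ((par false a, k, J) :: w'), b'; rewrite /= sw' !big_cons kw'.
- apply: span_map (IH _); first exact: modes_linearr.
  move=> _ [w' [b' [sw' kw' ->]]]; apply: span_in.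
  by exists ((par true a, k, J) :: w'), b'; rewrite /= sw' !big_cons kw'.
Qed.

Lemma Li_par n c v : Li X n v -> Li X n (par c v).
Proof.
apply: span_map; first exact: par_linear.
move=> _ [w [b [w0 nw ->]]].
have := word_act_par c w b; apply: (span_map (f := idfun)) => //.
move=> _ [w' [b' [sw' kw' ->]]]; apply: span_in.
by exists w', b'; rewrite sw' kw'.
Qed.

Definition modC2 (u v : V) : Prop := C2 X (u - v).

Lemma modC2_scong : scong (ops_of V) modC2.
Proof.
have eqE u v : u = v -> modC2 u v by move=> ->; rewrite /modC2 subrr; exact: span0.
have PL := @par_linear _ V.
split => /=; rewrite /modC2.
- by move=> s; exact: eqE.
- by move=> s t st; rewrite -opprB; exact: spanN.
- by move=> s t u st tu; have := spanD st tu; rewrite addrA subrK.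
- by move=> s s' t t' ss tt; rewrite opprD addrACA; exact: spanD.
- by move=> s s' ss; rewrite -opprD; exact: spanN.
- by move=> c s s' ss; rewrite -scalerBr; exact: spanZ.
- by move=> b s s' ss; rewrite -(linN (PL b)) -(linD (PL b)); exact: C2_par.
- by move=> s t u; apply: eqE; rewrite addrA.
- by move=> s t; apply: eqE; rewrite addrC.
- by move=> s; apply: eqE; rewrite add0r.
- by move=> s; apply: eqE; rewrite addNr.
- by move=> c d s; apply: eqE; rewrite scalerA.
- by move=> s; apply: eqE; rewrite scale1r.
- by move=> c s t; apply: eqE; rewrite scalerDr.
- by move=> c d s; apply: eqE; rewrite scalerDl.
- by move=> b s t; apply: eqE; rewrite (linD (PL b)).
- by move=> b c s; apply: eqE; rewrite (linZ (PL b)).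
- by move=> b c s; apply: eqE; rewrite par_par.
- by move=> s; apply: eqE; exact: par_sum.
Qed.

Definition RV_space : superspace K := squot modC2_scong.
Definition RV_cl (a : V) : RV_space := qcl modC2_scong a.

(* The product of representatives; its class does not depend on them, C_2(V)  *)
(* being a two-sided ideal for a_(-1|N) b. *)
Definition RV : salg K :=
  @SAlg K RV_space (RV_cl (vac X))
    (fun x y => RV_cl (Y (qrep x) (-1) [set: 'I_N]%SET (qrep y))).

Definition C2_cofinite : Prop := finite_dim RV_space.

(* gr_E V, as finitely supported sequences (f_n in E_n) modulo (E_(n+1))_n. *)
Record grseq := GrSeq {
  gs : nat -> V;
  gs_in : forall n, Li X n (gs n);
  gs_fin : exists m, forall n, (m <= n)%N -> gs n = 0 }.

Definition greqv (f g : grseq) : Prop :=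
  forall n, Li X n.+1 (gs f n - gs g n).

Program Definition gs0 : grseq := @GrSeq (fun _ => 0) _ _.
Next Obligation. exact: span0. Qed.
Next Obligation. by exists 0%N. Qed.
Program Definition gsadd (f g : grseq) : grseq :=
  @GrSeq (fun n => gs f n + gs g n) _ _.
Next Obligation. by apply: spanD; exact: gs_in. Qed.
Next Obligation.
case: (gs_fin f) (gs_fin g) => m hm [m' hm']; exists (maxn m m') => n.
by rewrite geq_max => /andP[/hm -> /hm' ->]; rewrite addr0.
Qed.
Program Definition gsopp (f : grseq) : grseq := @GrSeq (fun n => - gs f n) _ _.
Next Obligation. by apply: spanN; exact: gs_in. Qed.
Next Obligation.
by case: (gs_fin f) => m hm; exists m => n /hm ->; rewrite oppr0.
Qed.
Program Definition gsscale (c : K) (f : grseq) : grseq :=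
  @GrSeq (fun n => c *: gs f n) _ _.
Next Obligation. by apply: spanZ; exact: gs_in. Qed.
Next Obligation.
by case: (gs_fin f) => m hm; exists m => n /hm ->; rewrite scaler0.
Qed.
Program Definition gspar (b : bool) (f : grseq) : grseq :=
  @GrSeq (fun n => par b (gs f n)) _ _.
Next Obligation. by apply: Li_par; exact: gs_in. Qed.
Next Obligation.
case: (gs_fin f) => m hm; exists m => n /hm ->.
by rewrite (lin0 (@par_linear _ V b)).
Qed.

Definition grops : sops K grseq := SOps gs0 gsadd gsopp gsscale gspar.

Lemma greqv_scong : scong grops greqv.
Proof.
have eqE f g : (forall n, gs f n = gs g n) -> greqv f g.
  by move=> fg n; rewrite fg subrr; exact: span0.
have PL := @par_linear _ V.
split => /=.
- by move=> s; exact: eqE.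
- by move=> s t st n; rewrite -opprB; exact: spanN (st n).
- by move=> s t u st tu n; have := spanD (st n) (tu n); rewrite addrA subrK.
- by move=> s s' t t' ss tt n /=; rewrite opprD addrACA; exact: spanD (ss n) (tt n).
- by move=> s s' ss n /=; rewrite -opprD; exact: spanN (ss n).
- by move=> c s s' ss n /=; rewrite -scalerBr; exact: spanZ (ss n).
- by move=> b s s' ss n /=; rewrite -(linN (PL b)) -(linD (PL b)); exact: Li_par (ss n).
- by move=> s t u; apply: eqE => n /=; rewrite addrA.
- by move=> s t; apply: eqE => n /=; rewrite addrC.
- by move=> s; apply: eqE => n /=; rewrite add0r.
- by move=> s; apply: eqE => n /=; rewrite addNr.
- by move=> c d s; apply: eqE => n /=; rewrite scalerA.
- by move=> s; apply: eqE => n /=; rewrite scale1r.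
- by move=> c s t; apply: eqE => n /=; rewrite scalerDr.
- by move=> c d s; apply: eqE => n /=; rewrite scalerDl.
- by move=> b s t; apply: eqE => n /=; rewrite (linD (PL b)).
- by move=> b c s; apply: eqE => n /=; rewrite (linZ (PL b)).
- by move=> b c s; apply: eqE => n /=; rewrite par_par; case: ifP.
- by move=> s; apply: eqE => n /=; exact: par_sum.
Qed.

Definition gr_space : superspace K := squot greqv_scong.

Program Definition gsdelta (n : nat) (a : V) (h : Li X n a) : grseq :=
  @GrSeq (fun m => if m == n then a else 0) _ _.
Next Obligation. by case: eqP => [->|_] //; exact: span0. Qed.
Next Obligation.
by exists n.+1 => m nm; rewrite gtn_eqF.
Qed.

(* a + E_(n+1), for a in E_n (0 if a is not in E_n). *)
Definition gr_cl (n : nat) (a : V) : gr_space :=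
  match pselect (Li X n a) with
  | left h => qcl greqv_scong (gsdelta h)
  | right _ => 0
  end.

Definition gr_mul_spec (m : gr_space -> gr_space -> gr_space) : Prop :=
  [/\ forall y, linear (m^~ y), forall x, linear (m x) &
      forall r s a b, Li X r a -> Li X s b ->
        Li X (r + s) (Y a (-1) [set: 'I_N]%SET b) /\
        m (gr_cl r a) (gr_cl s b) = gr_cl (r + s) (Y a (-1) [set: 'I_N]%SET b)].

Definition gr_mul : gr_space -> gr_space -> gr_space :=
  the (fun _ _ => 0) gr_mul_spec.

Definition gr : salg K := @SAlg K gr_space (gr_cl 0 (vac X)) gr_mul.

(* The operator induced by S^i, which preserves each E_n. *)
Definition gr_S (i : 'I_N) : gr -> gr :=
  the (fun _ => 0) (fun D : gr -> gr => linear D /\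
    forall n a, Li X n a ->
      Li X n (susyS X i a) /\ D (gr_cl n a) = gr_cl n (susyS X i a)).

(* The translation operator a |-> a_(-2|N) |0>: it is T for an N_W = N and    *)
(* (S_K^i)^2 for an N_K = N SUSY vertex algebra.  It maps E_n to E_(n+1). *)
Definition transl (a : V) : V := Y a (-2) [set: 'I_N]%SET (vac X).

(* The superalgebra morphism (R_V)^O -> gr_E V which extends the inclusion    *)
(* R_V -> gr_E V, x |-> x + E_1 (the case i = 0 below) and is compatible with *)
(* the derivations: x^(i) goes to T^i x / i!, and the k-th odd differential   *)
(* corresponds to S^k.  It is determined by these properties. *)
Fixpoint Phi_spec (k : nat) : (deRham_iter k (jets RV) -> gr) -> Prop :=
  match k with
  | 0 => fun phi => salg_morph phi /\
      forall a i, phi (jet (A := RV) (RV_cl a) i) =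
                  gr_cl i ((i`!)%:R^-1 *: iter i transl a)
  | k'.+1 => fun phi => [/\ salg_morph phi,
      Phi_spec (fun x : deRham_iter k' (jets RV) => phi (deRham_in x)) &
      forall i : 'I_N, i = k' :> nat -> forall x : deRham_iter k' (jets RV),
        phi (deRham_d x) = gr_S i (phi (deRham_in x))]
  end.

Definition Phi : superjet N RV -> gr :=
  the (fun _ => 0) (fun phi => Phi_spec phi /\ forall y, exists x, phi x = y).

Definition Ann_gr : set (superjet N RV) :=
  [set f | forall m : gr, smul (Phi f) m = 0].

Definition SS : set (set (superjet N RV)) :=
  [set p | Spec p /\ Ann_gr `<=` p].

Definition fg_RV_module : Prop :=
  exists s : seq RV, forall x : RV, exists c : RV -> RV,
    x = \sum_(y <- s) smul (c y) y.

(* The scheme SS(V)_red has the same underlying space as SS(V). *)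
Definition lisse : Prop := fg_RV_module /\ zero_dimensional SS.

End Graded.

(* Main.v *)
From Pilot Require Import Defs.
From HB Require Import structures.
From mathcomp Require Import all_boot all_order all_algebra.
From mathcomp Require Import boolp classical_sets functions reals complex.
From mathcomp Require Import zify ring lra.
Import Pilot.Defs.

(** Put gr for the graded algebra of the Li filtration E_n, and Phi for the map from the superjet
    algebra of R_V to gr.

    The SUSY vertex algebra enters through two facts.  By Goddard's uniqueness theorem (goddard)
    each mode a_(n|J) is a mode a'_(n|N) (modes_reduce), so that V is handled as a vertex
    superalgebra with odd derivations S^i, in the same way for N_W and N_K.  By Dong's lemma (dong) and
    uniqueness again, the commutator of a_(m) and b_(k) is a combination of the modes
    (a_(j) b)_(m+k-j) with j >= 0 (commutator).  Applied to the vacuum, this also gives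
    skew-symmetry.  Hence E_r (n) E_s lies in E_(r+s-n) for n >= 0 and in E_(r+s-n-1) for n < 0
    (Li_mul), gr is a commutative superalgebra with odd derivations induced by the S^i
    (gr_comsalg, gr_S_derivation), and T^i / i! obeys Leibniz' rule (Tdiv_mul).  By the universal
    properties of jets and of de Rham algebras the map Phi exists; it is surjective, already on
    jets, because the symbol of a_(-1-k) b is the product of those of T^k a / k! and b
    (Phi_correct, Phi_spec_surj).  As gr has a unit, the annihilator of gr is the kernel of Phi, and
    R_V is a quotient of gr.

    Suppose that R_V is finite-dimensional, and let P be a point of the singular support.  The
    elements of R_V all of whose jets are in P form a set Q which is prime with respect to products
    (jet_core_prime).  Odd elements of R_V square to zero, and even ones are roots of polynomials
    over an algebraically closed field; hence every element of R_V is a scalar modulo Q.  Therefore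
    every jet, and as Phi is onto on jets every element of the superjet algebra, is a scalar modulo
    P.  A space of such primes has no irreducible closed subsets but points
    (scalar_zero_dimensional).

    Conversely, pulling primes of R_V back to the singular support shows that, if the latter has
    dimension 0, no prime of R_V strictly contains another one.  Since V is finitely strongly
    generated, R_V is a finitely generated superalgebra (RV_generated), and it is
    finite-dimensional by a form of Zariski's lemma (zero_dim_finite_dim), for which it is
    convenient that the complex numbers are uncountable.  That R_V is a finitely generated module
    over itself holds because it has a unit. *)

Set Implicit Arguments.
Unset Strict Implicit.
Unset Printing Implicit Defensive.

Import Order.TTheory GRing.Theory Num.Theory.
Local Open Scope classical_set_scope.
Local Open Scope ring_scope.

(** * Linear identities by reflection *)

Inductive lexp (K : Type) : Type :=
| LVar of nat
| LZero
| LAdd of lexp K & lexp K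
| LOpp of lexp K
| LScale of K & lexp K.
Arguments LVar {K}.
Arguments LZero {K}.

Section LinearReflection.
Variables (K : pzRingType) (V : lmodType K).

Fixpoint leval (env : seq V) (e : lexp K) : V :=
  match e with
  | LVar n => env`_n
  | LZero => 0
  | LAdd e1 e2 => leval env e1 + leval env e2
  | LOpp e1 => - leval env e1
  | LScale c e1 => c *: leval env e1
  end.

Fixpoint lcoef (i : nat) (e : lexp K) : K :=
  match e with
  | LVar n => if eqn n i then 1 else 0
  | LZero => 0
  | LAdd e1 e2 => lcoef i e1 + lcoef i e2
  | LOpp e1 => - lcoef i e1
  | LScale c e1 => c * lcoef i e1
  end.

Lemma lcoefP env e : leval env e = \sum_(i < size env) lcoef i e *: env`_i.
Proof.
elim: e => [n||e1 IH1 e2 IH2|e1 IH1|c e1 IH1] /=.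
- have [ltn|gen] := ltnP n (size env).
    rewrite (bigD1 (Ordinal ltn)) //= eqnE eqxx scale1r big1 ?addr0 // => i ni.
    by rewrite ifN ?scale0r //; apply: contraNneq ni => ni; apply/eqP/val_inj.
  rewrite nth_default // big1 // => i _; rewrite eqnE ifN ?scale0r //.
  by apply: contraTneq gen => ->; rewrite -ltnNge.
- by rewrite big1 // => i _; rewrite scale0r.
- by rewrite IH1 IH2 -big_split; apply: eq_bigr => i _; rewrite scalerDl.
- by rewrite IH1 -sumrN; apply: eq_bigr => i _; rewrite scaleNr.
- by rewrite IH1 scaler_sumr; apply: eq_bigr => i _; rewrite scalerA.
Qed.

Fixpoint lcoefs_eq (n : nat) (e1 e2 : lexp K) : Prop :=
  if n is n'.+1 then lcoef n' e1 = lcoef n' e2 /\ lcoefs_eq n' e1 e2 else True.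

Lemma lexp_eq env e1 e2 : lcoefs_eq (size env) e1 e2 -> leval env e1 = leval env e2.
Proof.
move=> h; rewrite !lcoefP; apply: eq_bigr => i _; congr (_ *: _).
elim: (size env) i h => [[] //|n IH] [i ltin] /= [h1 h2].
move: ltin; rewrite ltnS leq_eqVlt => /orP[/eqP -> //|ltin].
exact: (IH (Ordinal ltin)).
Qed.

End LinearReflection.

Ltac lmod_mem x env :=
  lazymatch env with
  | nil => constr:(false)
  | x :: _ => constr:(true)
  | _ :: ?env' => lmod_mem x env'
  end.
Ltac lmod_index x env :=
  lazymatch env with
  | x :: _ => constr:(O)
  | _ :: ?env' => let n := lmod_index x env' in constr:(S n)
  end.
Ltac lmod_atoms env t :=
  lazymatch t with
  | GRing.add ?u ?v => let env1 := lmod_atoms env u in lmod_atoms env1 v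
  | GRing.opp ?u => lmod_atoms env u
  | GRing.scale _ ?u => lmod_atoms env u
  | GRing.zero => env
  | _ => lazymatch lmod_mem t env with true => env | false => constr:(t :: env) end
  end.
Ltac lmod_quote K env t :=
  lazymatch t with
  | GRing.add ?u ?v =>
      let a := lmod_quote K env u in let b := lmod_quote K env v in constr:(@LAdd K a b)
  | GRing.opp ?u => let a := lmod_quote K env u in constr:(@LOpp K a)
  | GRing.scale ?c ?u => let a := lmod_quote K env u in constr:(@LScale K c a)
  | GRing.zero => constr:(@LZero K)
  | _ => let n := lmod_index t env in constr:(@LVar K n)
  end.
(** Both sides are quoted over their common atoms, and the coefficients of each atom are left to
    [ring] in K. *)
Ltac lmod K :=
  lazymatch goal with
  | |- @eq ?T ?u ?v =>
      let env0 := lmod_atoms (@nil T) u in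
      let env := lmod_atoms env0 v in
      let a := lmod_quote K env u in
      let b := lmod_quote K env v in
      apply: (@lexp_eq K _ env a b);
      cbn [lcoefs_eq size lcoef eqn]; repeat split; ring
  end.

(** * Commutative superalgebras *)

Section Superspace.
Variables (K : fieldType) (V : superspace K).

Lemma homogZ b c (x : V) : homog b x -> homog b (c *: x).
Proof. by rewrite /homog (linZ (@par_linear _ V b)) => ->. Qed.
Lemma homogD b (x y : V) : homog b x -> homog b y -> homog b (x + y).
Proof. by rewrite /homog (linD (@par_linear _ V b)) => -> ->. Qed.

Lemma lin_eq (W : lmodType K) (f g : V -> W) : linear f -> linear g ->
  (forall p a, homog p a -> f a = g a) -> f =1 g.
Proof.
move=> lf lg fg a; rewrite (par_sum a) (linD lf) (linD lg).
by rewrite !(fg _ _ (homog_par _ _)).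
Qed.

Lemma ksign_cases p : ksign K p = if p then -1 else 1.
Proof. by case: p; rewrite /ksign ?expr1 ?expr0. Qed.
End Superspace.

Section SuperAlgebra.
Variables (K : numFieldType) (A : salg K).
Hypothesis cA : is_comsalg A.
Local Notation "x ** y" := (smul x y) (at level 40, left associativity).
Local Notation one := (sone A).

Lemma salgMA (x y z : A) : x ** (y ** z) = x ** y ** z. Proof. exact: (ca_mulA cA). Qed.
Lemma salg1M (x : A) : one ** x = x. Proof. exact: (ca_mul1 cA). Qed.
Lemma salgDl (x y z : A) : (x + y) ** z = x ** z + y ** z.
Proof. exact: (ca_mulDl cA). Qed.
Lemma salgDr (x y z : A) : x ** (y + z) = x ** y + x ** z.
Proof. exact: (ca_mulDr cA). Qed.
Lemma salgZl c (x y : A) : (c *: x) ** y = c *: (x ** y).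
Proof. exact: (ca_mulZl cA). Qed.
Lemma salgZr c (x y : A) : x ** (c *: y) = c *: (x ** y).
Proof. exact: (ca_mulZr cA). Qed.
Lemma salgC b c (x y : A) : homog b x -> homog c y ->
  x ** y = ksign K (b && c) *: (y ** x).
Proof. by move=> hx hy; have := ca_mulC cA b c x y; rewrite /= hx hy. Qed.
Lemma salgM_homog b c (x y : A) : homog b x -> homog c y -> homog (b (+) c) (x ** y).
Proof. by move=> hx hy; have := ca_parM cA b c x y; rewrite /= hx hy. Qed.
Lemma salg1_homog : homog false one. Proof. exact: (ca_par1 cA). Qed.

Lemma salg_linl (y : A) : linear (fun x : A => x ** y).
Proof. by move=> c u v; rewrite salgDl salgZl. Qed.
Lemma salg_linr (x : A) : linear (@smul K A x).
Proof. by move=> c u v; rewrite salgDr salgZr. Qed.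
Lemma salg0l (x : A) : 0 ** x = 0. Proof. exact: (lin0 (salg_linl x)). Qed.
Lemma salg0r (x : A) : x ** 0 = 0. Proof. exact: (lin0 (salg_linr x)). Qed.
Lemma salgNl (x y : A) : (- x) ** y = - (x ** y). Proof. exact: (linN (salg_linl y)). Qed.
Lemma salgNr (x y : A) : x ** (- y) = - (x ** y). Proof. exact: (linN (salg_linr x)). Qed.

Lemma salgM_even (x y : A) : homog false x -> x ** y = y ** x.
Proof.
move=> hx; rewrite (par_sum y) salgDl salgDr.
rewrite (salgC hx (homog_par false y)) (salgC hx (homog_par true y)).
by rewrite /ksign /= expr0 !scale1r.
Qed.
Lemma salgM1 (x : A) : x ** one = x.
Proof. by rewrite -(salgM_even _ salg1_homog) salg1M. Qed.

Lemma salg_odd_sq (x : A) : homog true x -> x ** x = 0.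
Proof.
move=> hx; have := salgC hx hx; rewrite /ksign /= expr1 scaleN1r => h.
have : x ** x + x ** x = 0 by rewrite {1}h addNr.
rewrite -mulr2n -scaler_nat => /eqP; rewrite scaler_eq0 pnatr_eq0 /=.
by move/eqP.
Qed.


Definition spow (x : A) n : A := iter n (@smul K A x) one.

Definition seval (x : A) (f : {poly K}) : A := \sum_(i < size f) f`_i *: spow x i.

Lemma seval_wide x (f : {poly K}) n : (size f <= n)%N ->
  seval x f = \sum_(i < n) f`_i *: spow x i.
Proof.
move=> fn; rewrite /seval (big_ord_widen n (fun i => f`_i *: spow x i) fn).
rewrite [RHS](bigID (fun i : 'I_n => (i < size f)%N)) /= [X in _ + X]big1 ?addr0 //.
by move=> i; rewrite -leqNgt => h; rewrite nth_default ?scale0r.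
Qed.

Lemma seval_linear x : linear (seval x : {poly K} -> A).
Proof.
move=> c f g; set n := maxn (size (c *: f + g)) (maxn (size f) (size g)).
rewrite !(@seval_wide x _ n) ?leq_max ?leqnn ?orbT //.
rewrite scaler_sumr -big_split /=; apply: eq_bigr => i _.
by rewrite coefD coefZ scalerDl scalerA.
Qed.

Lemma sevalC x c : seval x c%:P = c *: one.
Proof.
by rewrite (@seval_wide x _ 1) ?size_polyC_leq1 // big_ord1 coefC eqxx.
Qed.

Lemma sevalMX x f : seval x (f * 'X) = x ** seval x f.
Proof.
rewrite (@seval_wide x _ (size f).+1); last first.
  by rewrite (leq_trans (size_polyMleq _ _)) // size_polyX addn2.
rewrite big_ord_recl coefMX /= scale0r add0r /seval.
elim/big_rec2: _ => [|i y1 y2 _ ->]; first by rewrite salg0r.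
by rewrite salgDr salgZr coefMX.
Qed.

Lemma seval_even x f : homog false x -> homog false (seval x f).
Proof.
move=> hx; elim/poly_ind: f => [|f c IH].
  rewrite (lin0 (seval_linear x)) /homog; exact: (lin0 (@par_linear _ A false)).
rewrite (linD (seval_linear x)) sevalMX sevalC; apply: homogD.
  exact: salgM_homog hx IH.
by apply: homogZ; exact: salg1_homog.
Qed.

Lemma sevalM x f g : homog false x -> seval x (f * g) = seval x f ** seval x g.
Proof.
move=> hx; elim/poly_ind: f => [|f c IH].
  by rewrite mul0r (lin0 (seval_linear x)) salg0l.
rewrite mulrDl mulrAC (linD (seval_linear x)) (linD (seval_linear x)).
rewrite !sevalMX IH salgDl salgMA; congr (_ + _).
by rewrite mul_polyC (linZ (seval_linear x)) sevalC salgZl salg1M.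
Qed.

Lemma sevalXC x c : seval x ('X - c%:P) = x - c *: one.
Proof.
rewrite (linD (seval_linear x)) (linN (seval_linear x)) sevalC.
by rewrite -['X]mul1r sevalMX -[1]/(1%:P) sevalC scale1r salgM1.
Qed.

Lemma prime_odd (p : set A) x : Spec p -> homog true x -> p x.
Proof.
move=> [ip _ pp] hx; have := @pp x x; rewrite salg_odd_sq //.
by case/(_ (ideal0 ip)).
Qed.

Lemma idealZ (p : set A) c x : ideal p -> p x -> p (c *: x).
Proof. by move=> ip px; rewrite -[x]salg1M -salgZl; exact: (idealMl ip). Qed.
Lemma idealB (p : set A) x y : ideal p -> p x -> p y -> p (x - y).
Proof.
by move=> ip px py; apply: (idealD ip) => //; rewrite -scaleN1r; exact: idealZ.
Qed.

Lemma ideal_par_sum (I : set A) u : ideal I -> (forall v, homog true v -> I v) ->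
  I u <-> I (par false u).
Proof.
move=> iI odd; split => h.
  rewrite -(addrK (par true u) (par false u)) -par_sum; apply: idealB => //.
  exact/odd/homog_par.
rewrite (par_sum u); apply: (idealD iI) => //; exact/odd/homog_par.
Qed.

Definition ideal_adjoin (I : set A) (t : A) : set A :=
  [set x | exists a, I (x - a ** t)].

(** A homogeneous t commutes with every element up to a sign on the odd component, so that the
    left multiples of t form a two-sided ideal. *)
Lemma ideal_adjoinP (I : set A) b t : ideal I -> homog b t -> ideal (ideal_adjoin I t).
Proof.
move=> iI ht; split.
- by exists 0; rewrite salg0l subr0; exact: ideal0.
- move=> x y [a ha] [c hc]; exists (a + c).
  by rewrite salgDl opprD addrACA; exact: idealD.
- move=> x y [a ha]; exists (x ** a).
  by rewrite -salgMA -salgNr -salgDr; exact: idealMl.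
- move=> x y [a ha].
  exists (a ** (par false y + ksign K b *: par true y)).
  suff -> : a ** (par false y + ksign K b *: par true y) ** t = a ** t ** y.
    by rewrite -salgNl -salgDl; exact: idealMr.
  rewrite -!salgMA; congr (_ ** _).
  rewrite {3}(par_sum y) salgDl salgDr salgZl.
  rewrite (salgC ht (homog_par false y)) (salgC ht (homog_par true y)).
  by rewrite andbT andbF {2}/ksign expr0 scale1r.
Qed.

Lemma ideal_adjoin_sub (I : set A) t : I `<=` ideal_adjoin I t.
Proof. by move=> x Ix; exists 0; rewrite salg0l subr0. Qed.
Lemma ideal_adjoin_in (I : set A) t : ideal I -> ideal_adjoin I t t.
Proof. by move=> iI; exists one; rewrite salg1M subrr; exact: ideal0. Qed.

(** An ideal maximal among those avoiding a multiplicative set M is prime.  It contains the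
    odd elements first: if it meets M after an odd t is adjoined, in m = i + a t, then
    m m lies in the ideal, as (a t)(a t) = 0.  Modulo the odd elements the superalgebra is
    commutative, and the classical argument applies. *)
Lemma prime_avoiding (M I0 : set A) :
  ideal I0 -> M one -> (forall x y, M x -> M y -> M (x ** y)) ->
  (forall x, M x -> ~ I0 x) ->
  exists p, [/\ Spec p, I0 `<=` p & forall x, M x -> ~ p x].
Proof.
move=> iI0 M1 MM dI0.
pose good (I : set A) := ideal I /\ forall x, M x -> ~ I x.
have [F Ftot|X [[iX dX] maxX]] :=
    @Zorn_bigcup A (fun X => good (I0 `|` X)).
  move=> totF.
  have [F0|/eqP/set0P[X0 FX0]] := pselect (F = set0).
    by rewrite F0 bigcup_set0 setU0.
  have sub X : F X -> I0 `|` X `<=` I0 `|` \bigcup_(Y in F) Y.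
    by move=> FX x [|Xx]; [left|right; exists X].
  have ex x : (I0 `|` \bigcup_(Y in F) Y) x -> exists2 X, F X & (I0 `|` X) x.
    by case=> [Ix|[X FX Xx]]; [exists X0 => //; left|exists X => //; right].
  split; first split.
  - by left; exact: ideal0.
  - move=> x y /ex[X FX Xx] /ex[Y FY Yy].
    have [XY|YX] := totF _ _ FX FY.
      by apply: (sub _ FY); apply: (idealD (Ftot _ FY).1) => //; apply: setUS Xx.
    by apply: (sub _ FX); apply: (idealD (Ftot _ FX).1) => //; apply: setUS Yy.
  - move=> x y /ex[X FX Xy]; apply: (sub _ FX).
    exact: (idealMl (Ftot _ FX).1).
  - move=> x y /ex[X FX Xy]; apply: (sub _ FX).
    exact: (idealMr (Ftot _ FX).1).
  - by move=> x Mx /ex[X FX Xx]; exact: (Ftot _ FX).2 Mx Xx.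
set p := I0 `|` X in iX dX.
have meets b t : homog b t -> ~ p t -> exists2 m, M m & ideal_adjoin p t m.
  move=> ht pt; apply: contrapT => nm.
  apply: (maxX (ideal_adjoin p t)); last first.
    have -> : I0 `|` ideal_adjoin p t = ideal_adjoin p t.
      by apply: setUidr => x Ix; apply: ideal_adjoin_sub; left.
    split; first exact: ideal_adjoinP ht.
    by move=> m Mm am; apply: nm; exists m.
  split; first by move=> x Xx; apply: ideal_adjoin_sub; right.
  by move=> /(_ t (ideal_adjoin_in _ iX)) Xt; apply: pt; right.
have podd t : homog true t -> p t.
  move=> ht; apply: contrapT => pt; have [m Mm [a am]] := meets _ _ ht pt.
  apply: (dX _ (MM _ _ Mm Mm)).
  have -> : m ** m = (m - a ** t) ** m + (a ** t) ** (m - a ** t).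
    rewrite salgDl salgDr salgNl salgNr.
    suff -> : (a ** t) ** (a ** t) = 0 by rewrite subr0 subrK.
    have ta (c : A) b : homog b c -> t ** (c ** t) = 0.
      by move=> hc; rewrite salgMA (salgC ht hc) salgZl -salgMA salg_odd_sq // salg0r scaler0.
    by rewrite -salgMA {2}(par_sum a) salgDl salgDr !(ta _ _ (homog_par _ _)) addr0 salg0r.
  by apply: (idealD iX); [exact: idealMr|exact: idealMl].
exists p; split => //; last by move=> x; left.
split=> // [|x y pxy]; first by move=> p1; exact: (dX _ M1).
have pe u := ideal_par_sum u iX podd.
rewrite pe (pe y); apply: contrapT => /not_orP[px py].
have [m Mm [a am]] := meets _ _ (homog_par _ _) px.
have [n Mn [b bn]] := meets _ _ (homog_par _ _) py.
apply: (dX _ (MM _ _ Mm Mn)).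
have -> : m ** n = (m - a ** par false x) ** n + (a ** par false x) ** (n - b ** par false y)
    + (a ** b) ** (par false x ** par false y).
  rewrite salgDl salgDr salgNl salgNr !addrA subrK.
  suff -> : a ** b ** (par false x ** par false y) = a ** par false x ** (b ** par false y).
    by rewrite subrK.
  by rewrite -!salgMA; congr (_ ** _); rewrite !salgMA (salgM_even b (homog_par false x)).
apply: (idealD iX).
  by apply: (idealD iX); [exact: idealMr|exact: idealMl].
apply: (idealMl iX); have : p (x ** y - (par false x ** par true y + par true x ** y)).
  apply: idealB => //; apply: (idealD iX).
    by apply: (idealMl iX); exact/podd/homog_par.
  by apply: (idealMr iX); exact/podd/homog_par.
have -> // : x ** y - (par false x ** par true y + par true x ** y)
   = par false x ** par false y.
rewrite {1}(par_sum x) salgDl opprD addrACA addrN addr0 {1}(par_sum y) salgDr.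
by rewrite addrK.
Qed.

End SuperAlgebra.

(** * Finitely generated superalgebras without chains of primes *)

Section LinearDependence.
Variables (K : fieldType) (V : lmodType K).

Lemma span_seqP (s : seq V) v : span [set x | x \in s] v <->
  exists m : 'I_(size s) -> K, v = \sum_(j < size s) m j *: s`_j.
Proof.
split; last first.
  move=> [m ->]; elim/big_ind: _ => [|u w|j _]; [exact: span0|exact: spanD|].
  by apply: spanZ; apply: span_in; exact: mem_nth.
apply: (span_ind (P := fun v => exists m : 'I_(size s) -> K,
    v = \sum_(j < size s) m j *: s`_j)).
- by exists (fun=> 0); rewrite big1 // => j _; rewrite scale0r.
- move=> u w [m ->] [n ->]; exists (fun j => m j + n j).
  by rewrite -big_split; apply: eq_bigr => j _; rewrite scalerDl.
- move=> c u [m ->]; exists (fun j => c * m j).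
  by rewrite scaler_sumr; apply: eq_bigr => j _; rewrite scalerA.
- move=> x /= xs; have lt_x : (index x s < size s)%N by rewrite index_mem.
  exists (fun j => (j == Ordinal lt_x)%:R).
  rewrite (bigD1 (Ordinal lt_x)) //= eqxx scale1r nth_index // big1 ?addr0 //.
  by move=> j /negbTE ->; rewrite scale0r.
Qed.

Lemma span_dependent (s : seq V) n (y : 'I_n -> V) : (size s < n)%N ->
  (forall i, span [set x | x \in s] (y i)) ->
  exists2 c : 'I_n -> K, (exists i, c i != 0) & \sum_(i < n) c i *: y i = 0.
Proof.
move=> sn /(_ _)/span_seqP ys; have [m ym] := choice ys.
pose M := \matrix_(i < n, j < size s) m i j.
have : (kermx M != 0).
  rewrite -mxrank_eq0 mxrank_ker -lt0n subn_gt0.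
  exact: leq_ltn_trans (rank_leq_col M) sn.
case/rowV0Pn => v /sub_kermxP vM v0; exists (fun i => v 0 i).
  have /eqP := v0; apply: contra_notP => /forallNP h.
  by apply/rowP => i; rewrite mxE; apply: contrapT => /eqP; exact: h.
under eq_bigr => i _ do rewrite ym scaler_sumr.
rewrite exchange_big big1 // => j _ /=.
under eq_bigr => i _ do rewrite scalerA.
rewrite -scaler_suml; have /rowP/(_ j) := vM; rewrite !mxE => h.
suff -> : \sum_(i < n) v 0 i * m i j = 0 by rewrite scale0r.
by rewrite -[RHS]h; apply: eq_bigr => i _; rewrite mxE.
Qed.

End LinearDependence.

Definition uncountable (T : eqType) : Prop :=
  forall P : nat -> seq T, exists x, forall n, x \notin P n.

Section Uncountable.
Variable R : realType.

(** The first and the last third of an interval cannot both contain the same point. *)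
Lemma subinterval_avoiding (s : seq R) (a b : R) : a < b ->
  exists c, [/\ a <= c.1, c.1 < c.2, c.2 <= b &
    forall x, x \in s -> ~ (c.1 <= x <= c.2)].
Proof.
elim: s a b => [|x s IH] a b ab; first by exists (a, b).
pose d := (b - a) / 3%:R; have d0 : 0 < d by rewrite divr_gt0 // subr_gt0.
have bE : b = a + 3%:R * d by rewrite /d; field.
have [xd|xd] := leP x (a + d).
  have [|c [c1 c2 c3 c4]] := IH (a + 2%:R * d) b; first by lra.
  exists c; split => //; first by lra.
  by move=> y; rewrite inE => /orP[/eqP ->|/c4 //]; lra.
have [|c [c1 c2 c3 c4]] := IH a (a + d); first by lra.
exists c; split => //; first by lra.
by move=> y; rewrite inE => /orP[/eqP ->|/c4 //]; lra.
Qed.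

(** Nested intervals: the supremum of the left ends of a decreasing sequence of intervals, the
    n-th one avoiding P n, avoids every P n. *)
Lemma real_uncountable : uncountable R.
Proof.
move=> P.
have /choice[next nextP] : forall p : nat * (R * R), exists c : R * R, p.2.1 < p.2.2 ->
    [/\ p.2.1 <= c.1, c.1 < c.2, c.2 <= p.2.2 &
      forall x, x \in P p.1 -> ~ (c.1 <= x <= c.2)].
  move=> [n [a b]] /=; have [ab|ab] := pselect (a < b); last by exists (0, 0).
  by have [c h] := subinterval_avoiding (P n) ab; exists c.
pose I := fix I n := if n is n'.+1 then next (n', I n') else (0, 1) : R * R.
have I2 n : (I n).1 < (I n).2.
  by elim: n => [|n IH] /=; [rewrite ltr01|have [] := nextP (n, I n) IH].
have Istep n : [/\ (I n).1 <= (I n.+1).1, (I n.+1).2 <= (I n).2 &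
    forall x, x \in P n -> ~ ((I n.+1).1 <= x <= (I n.+1).2)].
  by have [] := nextP (n, I n) (I2 n).
have Imono n m : (n <= m)%N -> (I n).1 <= (I m).1 /\ (I m).2 <= (I n).2.
  elim: m => [|m IH]; first by rewrite leqn0 => /eqP ->.
  rewrite leq_eqVlt => /orP[/eqP -> //|/IH[h1 h2]].
  have [k1 k2 _] := Istep m.
  by split; [exact: le_trans k1|exact: le_trans h2].
have Iub n m : (I n).1 <= (I m).2.
  have [nm|/ltnW mn] := leqP n m.
    exact: le_trans (Imono _ _ nm).1 (ltW (I2 m)).
  exact: le_trans (ltW (I2 n)) (Imono _ _ mn).2.
pose L := [set (I n).1 | n in setT] : set R.
have supL : has_sup L.
  split; first by exists (I 0).1; exists 0%N.
  by exists (I 0).2 => _ [n _ <-].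
exists (sup L) => n; apply/negP => xP.
have [_ _ /(_ _ xP)] := Istep n; apply; apply/andP; split.
  by apply: sup_upper_bound => //; exists n.+1.
by apply: ge_sup => [|_ [m _ <-]]; [exact: supL.1|exact: Iub].
Qed.

Lemma complex_uncountable : uncountable R[i].
Proof.
move=> P; have [x xP] := real_uncountable (fun n => [seq complex.Re z | z <- P n]).
exists (x +i* 0)%C => n; apply/negP => h; have /negP := xP n; apply.
by apply/mapP; exists (x +i* 0)%C.
Qed.
End Uncountable.

Section ZeroDimensional.
Variables (K : numFieldType) (A : salg K).
Hypothesis cA : is_comsalg A.
Local Notation "x ** y" := (smul x y) (at level 40, left associativity).
Local Notation one := (sone A).

Definition no_prime_chains : Prop :=
  forall p q : set A, Spec p -> Spec q -> p `<=` q -> q `<=` p.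

Definition words_in (L : seq A) : set A :=
  [set v | exists2 w : seq A, (forall x, x \in w -> x \in L) & v = foldr (@smul K A) one w].

Fixpoint short_words (L : seq A) (d : nat) : seq A :=
  if d is d'.+1 then
    one :: [seq x ** w | x <- L, w <- short_words L d']
  else [:: one].

Lemma short_words_span (L : seq A) x : span (words_in L) x ->
  exists d, span [set y | y \in short_words L d] x.
Proof.
have mono d e : (d <= e)%N -> {subset short_words L d <= short_words L e}.
  elim: d e => [|d IH] [|e] //= de y; [by []|by rewrite !inE => ->|].
  rewrite !inE; case/orP=> [->|/allpairsP[[g w] [/= gL wL ->]]]; first by [].
  apply/orP; right; apply/allpairsP; exists (g, w); split => //; exact: IH wL.
have smono d e v : (d <= e)%N -> span [set y | y \in short_words L d] v ->
    span [set y | y \in short_words L e] v.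
  move=> de [s sA ->]; exists s => // p /sA /=; exact: mono.
move: x; apply: (span_ind (P := fun x => exists d, span [set y | y \in short_words L d] x)).
- by exists 0%N; exact: span0.
- move=> u v [d du] [e ev]; exists (maxn d e); apply: spanD.
    exact: smono (leq_maxl _ _) du.
  exact: smono (leq_maxr _ _) ev.
- by move=> c v [d dv]; exists d; exact: spanZ.
- move=> _ [w wL ->]; exists (size w); apply: span_in => /=.
  elim: w wL => [|g w IH] wL /=; first by rewrite inE.
  rewrite inE; apply/orP; right; apply/allpairsP; exists (g, foldr (@smul K A) one w).
  split => //=; first by apply: wL; rewrite inE eqxx.
  by apply: IH => y yw; apply: wL; rewrite inE yw orbT.
Qed.

(** Zariski's lemma in the uncountable case.  If x is transcendental, some prime p avoids the
    nonzero polynomials in x.  Every x - l is invertible modulo p, as a prime containing p and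
    x - l would strictly contain p.  Since there are uncountably many l while A is a
    countable union of finite-dimensional subspaces, some of the inverses are linearly
    dependent; clearing denominators gives a nonzero polynomial in x which lies in p. *)
Lemma zero_dim_algebraic (L : seq A) (x : A) : uncountable K -> no_prime_chains ->
  span (words_in L) = setT -> homog false x ->
  exists2 f : {poly K}, f != 0 & seval x f = 0.
Proof.
move=> unc npc gen hx; apply: contrapT => tr.
pose M := [set y | exists2 f : {poly K}, f != 0 & y = seval x f].
have sub_one : ideal [set (0 : A)].
  split => //= [u v -> ->|u v ->|u v ->]; first by rewrite addr0.
    by rewrite salg0r.
  by rewrite salg0l.
have [||_ [f f0 ->] f00|p [pS _ pM]] := prime_avoiding cA (M := M) sub_one.
- by exists 1; rewrite ?oner_neq0 // -[1]/(1%:P) sevalC scale1r.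
- move=> _ _ [f f0 ->] [g g0 ->]; exists (f * g); first by rewrite mulf_neq0.
  by rewrite sevalM.
- by apply: tr; exists f.
have [ip p1 pp] := pS.
have inv l : exists y : A, p ((x - l *: one) ** y - one).
  apply: contrapT => noinv.
  have ht : homog false (x - l *: one) by rewrite -(sevalXC cA); exact: seval_even.
  have [|u v -> ->|u ->|q [qS sub q1]] :=
      @prime_avoiding K A cA [set one] (ideal_adjoin p (x - l *: one)) (ideal_adjoinP cA ip ht).
  - by [].
  - by rewrite salg1M.
  - move=> [a pa]; apply: noinv; exists a.
    by rewrite (salgM_even cA _ ht) -(opprB one) -[- (_ - _ ** _)]scaleN1r; exact: (idealZ cA).
  have pq : p `<=` q by move=> u pu; apply/sub/ideal_adjoin_sub.
  apply: (pM (x - l *: one)).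
    by exists ('X - l%:P); [by rewrite polyXsubC_eq0|rewrite sevalXC].
  apply: (npc p q pS qS pq); exact/sub/(ideal_adjoin_in cA).
have [y yP] := choice inv.
have /choice[d dP] : forall l, exists d, span [set z | z \in short_words L d] (y l).
  by move=> l; apply: short_words_span; rewrite gen.
(* Otherwise K would be a countable union of finite sets. *)
have [n [t [tu td nt]]] : exists n t, [/\ uniq t, forall l, l \in t -> d l = n &
    (size (short_words L n) < size t)%N].
  apply: contrapT => bounded.
  have cover n : exists s : seq K, forall l, d l = n -> l \in s.
    apply: contrapT => ncov; apply: bounded; exists n.
    have {ncov} ext (s : seq K) : exists2 l, d l = n & l \notin s.
      apply: contrapT => h; apply: ncov; exists s => l dl; apply: contrapT => /negP ls.
      by apply: h; exists l.
    elim: (size _) => [|k [t [tu td kt]]].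
      by have [l dl _] := ext [::]; exists [:: l]; split => // l'; rewrite inE => /eqP ->.
    have [l dl lt] := ext t; exists (l :: t); split => /=; first by rewrite lt.
      by move=> l'; rewrite inE => /orP[/eqP ->|/td].
    by [].
  have [P hP] := choice cover; have [l lP] := unc P.
  by have /negP := lP (d l); apply; exact: hP.
pose lam (i : 'I_(size t)) := t`_i.
have lam_inj : injective lam.
  by move=> i j /eqP; rewrite nth_uniq // => /eqP /val_inj.
have [i|c [i0 ci0] cy] := @span_dependent K A _ _ (fun i => y (lam i)) nt.
  by rewrite -(td (lam i)) ?mem_nth.
(* The relation between the inverses, multiplied by the product of the x - lam j, is f(x) = 0
   modulo p; f is not zero since its value at lam i0 is not. *)
pose g i := \prod_(j < size t | j != i) ('X - (lam j)%:P).
pose f := \sum_(i < size t) c i *: g i.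
apply: (pM (seval x f)).
  exists f => //; apply: contraNneq ci0 => f0.
  have := congr1 (horner^~ (lam i0)) f0; rewrite horner_sum hornerC /=.
  rewrite (bigD1 i0) //= [X in _ + X]big1 => [|i ii0]; last first.
    rewrite hornerZ horner_prod (bigD1 i0) /=; last by rewrite eq_sym.
    by rewrite hornerXsubC subrr mul0r mulr0.
  rewrite addr0 hornerZ => /eqP; rewrite mulf_eq0 => /orP[/eqP -> //|].
  rewrite horner_prod => /prodf_eq0 [j ji0].
  by rewrite hornerXsubC subr_eq0 => /eqP/lam_inj ij; rewrite ij eqxx in ji0.
pose G := \prod_(j < size t) ('X - (lam j)%:P).
have -> : seval x f = - \sum_(i < size t) c i *: (seval x G ** y (lam i) - seval x (g i)).
  under eq_bigr => i _ do rewrite scalerBr.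
  rewrite sumrB; have -> : \sum_(i < size t) c i *: (seval x G ** y (lam i)) = 0.
    under eq_bigr => i _ do rewrite -salgZr //.
    rewrite -[RHS](salg0r cA (seval x G)) -cy.
    by elim/big_rec2: _ => [|i u v _ ->]; rewrite ?salg0r // salgDr.
  rewrite sub0r opprK /f; elim/big_rec2: _ => [|i u v _ <-].
    exact: (lin0 (seval_linear x)).
  by rewrite (linD (seval_linear x)) (linZ (seval_linear x)).
rewrite -scaleN1r; apply: (idealZ cA) => //.
elim/big_ind: _ => [|u v|i _]; [exact: ideal0|exact: idealD|].
apply: (idealZ cA) => //.
have -> : G = g i * ('X - (lam i)%:P) by rewrite mulrC /G (bigD1 i).
rewrite sevalM // sevalXC // -salgMA // -[X in _ - X](salgM1 cA) -salgNr // -salgDr //.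
exact: idealMl.
Qed.

Lemma spow_parity b (g : A) i : homog b g -> homog (b && odd i) (spow g i).
Proof.
move=> hg; elim: i => [|i IH]; first by rewrite andbF; exact: salg1_homog.
have -> : b && odd i.+1 = b (+) (b && odd i) by case: b {hg IH} => //=.
exact: salgM_homog.
Qed.

Lemma algebraic_powers (g : A) (f : {poly K}) : f != 0 -> seval g f = 0 ->
  exists n, forall i, span [set spow g j | j in [set j | (j < n)%N]] (spow g i).
Proof.
move=> f0 gf; pose n := (size f).-1; exists n.
have sf : size f = n.+1 by rewrite prednK // lt0n size_poly_eq0.
have red : span [set spow g j | j in [set j | (j < n)%N]] (spow g n).
  have : lead_coef f *: spow g n = - \sum_(i < n) f`_i *: spow g i.
    apply/eqP; rewrite -subr_eq0 opprK addrC lead_coefE -/n.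
    by apply/eqP; rewrite -[RHS]gf /seval sf big_ord_recr.
  move/(congr1 ( *:%R (lead_coef f)^-1)); rewrite scalerA mulVf ?lead_coef_eq0 // scale1r.
  move=> ->; apply/spanZ/spanN; elim/big_ind: _ => [|u v|i _]; [exact: span0|exact: spanD|].
  by apply/spanZ/span_in; exists (nat_of_ord i) => //=; exact: ltn_ord.
elim=> [|i IH].
  have [n0|n0] := posnP n; first by move: red; rewrite n0.
  by apply: span_in; exists 0%N.
move: IH; apply: (span_map (salg_linr cA g)) => _ [j /= jn <-].
have [jn'|jn'] := eqVneq j.+1 n; first by rewrite -[g ** _]/(spow g j.+1) jn'.
apply: span_in; exists j.+1 => //=.
by rewrite ltn_neqAle jn' jn.
Qed.

(** The spanning family is built by adding one generator g at a time: the products of the powers of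
    g below the degree of its equation with the previous family are stable under g, and under the
    previous generators because these commute with the powers of g up to sign. *)
Lemma algebraic_gens_fd (L : seq A) :
  (forall g, g \in L -> (exists b, homog b g) /\ exists2 f : {poly K}, f != 0 & seval g f = 0) ->
  exists s : seq A, span [set x | x \in s] one /\
    forall g w, g \in L -> span [set x | x \in s] w -> span [set x | x \in s] (g ** w).
Proof.
elim: L => [_|g L IH alg].
  by exists [:: one]; split => //; apply: span_in; rewrite /= inE.
have [|s' [s1 sL]] := IH; first by move=> g' g'L; apply: alg; rewrite inE g'L orbT.
have [[b hb] [f f0 gf]] := alg g (mem_head _ _).
have [n gn] := algebraic_powers f0 gf.
pose s := [seq spow g i ** w | i <- iota 0 n, w <- s'].
have big i w : span [set x | x \in s'] w -> span [set x | x \in s] (spow g i ** w).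
  move=> sw; move: (gn i); apply: (span_map (salg_linl cA w)) => _ [j /= jn <-].
  move: sw; apply: (span_map (salg_linr cA (spow g j))) => v /= vs'.
  apply: span_in => /=; apply/allpairsP; exists (j, v); split => //=.
  by rewrite mem_iota.
exists s; split; first by rewrite -(salg1M cA one); exact: (big 0%N).
move=> g' w; rewrite inE => g'L.
apply: (span_map (salg_linr cA g')) => _ /allpairsP[[i v] /= [_ vs' ->]].
have sv : span [set x | x \in s'] v by exact: span_in.
case/orP: g'L => [/eqP ->|g'L]; first by rewrite salgMA //; exact: (big i.+1).
have [|[b' hb'] _] := alg g'; first by rewrite inE g'L orbT.
rewrite salgMA // (salgC cA hb' (spow_parity i hb)) salgZl // -salgMA //.
by apply/spanZ/big/sL.
Qed.

Lemma words_parity (L : seq A) :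
  span (words_in L) `<=` span (words_in ([seq par false x | x <- L] ++ [seq par true x | x <- L])).
Proof.
set L' := _ ++ _.
have L'M b g v : g \in L -> span (words_in L') v -> span (words_in L') (par b g ** v).
  move=> gL; apply: (span_map (salg_linr cA _)) => _ [w wL ->].
  apply: span_in; exists (par b g :: w) => // y; rewrite inE => /orP[/eqP ->|/wL //].
  by rewrite mem_cat; apply/orP; case: b; [right|left]; apply/mapP; exists g.
move=> v; apply: (span_map (f := idfun)) => // _ [w wL ->].
elim: w wL => [|g w IH] wL /=; first by apply: span_in; exists [::].
have gL : g \in L by apply: wL; rewrite inE eqxx.
have {}IH : span (words_in L') (foldr (@smul K A) one w).
  by apply: IH => y yw; apply: wL; rewrite inE yw orbT.
by rewrite (par_sum g) salgDl //; apply: spanD; exact: L'M.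
Qed.

(** Even generators are algebraic by Zariski's lemma and odd ones square to zero, so that
    finitely many monomials in the generators span. *)
Theorem zero_dim_finite_dim (L : seq A) : uncountable K -> no_prime_chains ->
  span (words_in L) = setT -> finite_dim A.
Proof.
move=> unc npc gen.
set L' := [seq par false x | x <- L] ++ [seq par true x | x <- L].
have gen' : span (words_in L') = setT.
  by apply/seteqP; split => // v _; apply: words_parity; rewrite gen.
have [|s [s1 sL]] := @algebraic_gens_fd L'.
  move=> g; rewrite mem_cat => /orP[] /mapP[x _ ->]; split.
  - by exists false; exact: homog_par.
  - exact: zero_dim_algebraic gen (homog_par _ _).
  - by exists true; exact: homog_par.
  - exists ('X * 'X); first by rewrite mulf_neq0 // polyX_eq0.
    rewrite sevalMX // -['X]mul1r sevalMX // -[1]/(1%:P) sevalC scale1r salgM1 //.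
    by apply: salg_odd_sq => //; exact: homog_par.
exists s; apply/seteqP; split => // v _; have : span (words_in L') v by rewrite gen'.
apply: (span_map (f := idfun)) => // _ [w wL ->].
elim: w wL => [|g w IH] wL //=; apply: sL; first by apply: wL; rewrite inE eqxx.
by apply: IH => y yw; apply: wL; rewrite inE yw orbT.
Qed.

End ZeroDimensional.

(** * Local fields *)

Section LocalFields.
Variables (K : numFieldType) (V : lmodType K).

(** A family of operators (F n) stands for the series of the F n z^(-1-n); multiplication by
    z - w of a series in z and w then becomes the following difference operator. *)
Definition nab (h : int -> int -> V) : int -> int -> V :=
  fun m k => h (m + 1) k - h m (k + 1).

Lemma nabE h m k : nab h m k = h (m + 1) k - h m (k + 1). Proof. by []. Qed.

Lemma iter_nab_ext n (h g : int -> int -> V) : h =2 g -> iter n nab h =2 iter n nab g.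
Proof. by move=> hg; elim: n => //= n IH m k; rewrite /nab !IH. Qed.

Lemma iter_nabB n (h g : int -> int -> V) m k :
  iter n nab (fun m k => h m k - g m k) m k = iter n nab h m k - iter n nab g m k.
Proof.
elim: n m k => //= n IH m k.
by rewrite {1 3 5}/nab !IH; lmod K.
Qed.

Lemma iter_nab_lin n (L : V -> V) (h : int -> int -> V) m k : linear L ->
  iter n nab (fun m k => L (h m k)) m k = L (iter n nab h m k).
Proof.
move=> lL; elim: n m k => //= n IH m k.
by rewrite {1 3}/nab !IH (linD lL) (linN lL).
Qed.

Lemma iter_nabZ n c (h : int -> int -> V) m k :
  iter n nab (fun m k => c *: h m k) m k = c *: iter n nab h m k.
Proof.
by apply: (@iter_nab_lin n ( *:%R c)) => d x y; rewrite scalerDr !scalerA mulrC.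
Qed.

Lemma iter_nab0 n (h : int -> int -> V) m k : (forall m k, h m k = 0) -> iter n nab h m k = 0.
Proof. by move=> h0; elim: n m k => //= n IH m k; rewrite /nab !IH subr0. Qed.

Lemma iter_nab_mono n n' (h : int -> int -> V) : (n <= n')%N ->
  (forall m k, iter n nab h m k = 0) -> forall m k, iter n' nab h m k = 0.
Proof.
by move=> nn' h0 m k; rewrite -(subnK nn') iterD; exact: iter_nab0.
Qed.

Definition bracket (e : K) (F G : int -> V -> V) (v : V) : int -> int -> V :=
  fun m k => F m (G k v) - e *: G k (F m v).

Definition loc (e : K) (F G : int -> V -> V) : Prop :=
  exists n, forall v m k, iter n nab (bracket e F G v) m k = 0.

Lemma locB e F F' G : (forall k, linear (G k)) -> loc e F G -> loc e F' G ->
  loc e (fun m v => F m v - F' m v) G.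
Proof.
move=> lG [n hn] [n' hn']; exists (maxn n n') => v m k.
rewrite (@iter_nab_ext _ _ (fun m k => bracket e F G v m k - bracket e F' G v m k)).
  rewrite iter_nabB (iter_nab_mono (leq_maxl _ _) (hn v)).
  by rewrite (iter_nab_mono (leq_maxr _ _) (hn' v)) subr0.
by move=> m' k'; rewrite /bracket (linD (lG k')) (linN (lG k')); lmod K.
Qed.

Lemma locZ e c F G : (forall k, linear (G k)) -> loc e F G -> loc e (fun m v => c *: F m v) G.
Proof.
move=> lG [n hn]; exists n => v m k.
rewrite (@iter_nab_ext _ _ (fun m k => c *: bracket e F G v m k)).
  by rewrite iter_nabZ hn scaler0.
by move=> m' k'; rewrite /bracket (linZ (lG k')) scalerBr !scalerA mulrC.
Qed.

(** When h has no terms with k >= 0, the difference operator only shifts the line k = -1: the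
    constant term in w of (z - w)^n h is z^n times that of h. *)
Lemma iter_nab_edge n (h : int -> int -> V) (m0 : int) :
  (forall m k, m0 <= m -> 0 <= k -> h m k = 0) ->
  forall m, m0 <= m -> iter n nab h m (-1) = h (m + n%:Z) (-1) /\
    forall k, 0 <= k -> iter n nab h m k = 0.
Proof.
move=> h0; elim: n => [|n IH] m mm /=.
  by rewrite addr0; split => // k; exact: h0.
have mm1 : m0 <= m + 1 by lia.
have [e1 z1] := IH _ mm1; have [e0 z0] := IH _ mm.
split=> [|k k0]; rewrite /nab.
  by rewrite e1 z0 // subr0; congr (h _ _); lia.
by rewrite z1 // z0 ?subr0 //; lia.
Qed.

(** The expansion of a local distribution in derivatives of the delta function; the line m = 0 of
    the j-th difference is the coefficient of the j-th derivative.  Stated with a span rather than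
    with binomial coefficients, it follows by a plain induction on n, since h (m + 1) k and
    h m (k + 1) differ by nab h m k. *)
Lemma nab_expand n (h : int -> int -> V) : (forall m k, iter n nab h m k = 0) ->
  forall m k, span [set u | exists j : nat, u = iter j nab h 0 (m + k - j%:Z)] (h m k).
Proof.
elim: n h => [|n IH] h hn; first by move=> m k; rewrite -[h m k]/(iter 0 nab h m k) hn; exact: span0.
have {}IH m k : span [set u | exists j : nat, u = iter j nab h 0 (m + k + 1 - j%:Z)] (nab h m k).
  have := @IH (nab h); rewrite -iterSr => /(_ hn m k).
  apply: (span_map (f := idfun)) => // _ [j ->].
  apply: span_in; exists j.+1; rewrite -iterSr; congr (iter _ _ _ _ _); lia.
have up m k : span [set u | exists j : nat, u = iter j nab h 0 (m + (k + 1) - j%:Z)] (h m (k + 1)) <->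
    span [set u | exists j : nat, u = iter j nab h 0 (m + 1 + k - j%:Z)] (h (m + 1) k).
  have -> : m + 1 + k = m + k + 1 by lia.
  have -> : m + (k + 1) = m + k + 1 by lia.
  have e1 : h (m + 1) k = nab h m k + h m (k + 1) by rewrite subrK.
  split => hs; first by rewrite e1; exact: spanD.
  have -> : h m (k + 1) = h (m + 1) k - nab h m k by rewrite e1 addrAC subrr add0r.
  by apply: spanD => //; exact: spanN.
have zero k : span [set u | exists j : nat, u = iter j nab h 0 (0 + k - j%:Z)] (h 0 k).
  by apply: span_in; exists 0%N; congr (h _ _); lia.
case=> m; elim: m => [|m IHm] k.
- exact: zero.
- have -> : m.+1%:Z = m%:Z + 1 by lia.
  by apply/up; exact: IHm.
- have -> : k = k - 1 + 1 by lia.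
  apply/up; have -> : Negz 0 + 1 = 0 by lia.
  exact: zero.
- have -> : k = k - 1 + 1 by lia.
  apply/up; have -> : Negz m.+1 + 1 = Negz m by lia.
  exact: IHm.
Qed.

End LocalFields.

(** Since C = (A + C) - A, applying C once replaces x by two vectors, on each of which one of the
    two exponents has dropped. *)
Lemma iter_sub_nilpotent (U : zmodType) (A C : U -> U) :
  (forall x y, A (x + y) = A x + A y) -> (forall x y, C (x + y) = C x + C y) ->
  (forall x, A (C x) = C (A x)) ->
  forall s t x, iter s A x = 0 -> iter t (fun x => A x + C x) x = 0 -> iter (s + t) C x = 0.
Proof.
move=> AD CD cAC.
have z0 (D : U -> U) : (forall x y, D (x + y) = D x + D y) -> D 0 = 0.
  by move=> DD; have := DD 0 0; rewrite addr0 -[X in X = _]addr0 => /addrI <-.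
have C0 n : iter n C 0 = 0 by elim: n => //= n ->; exact: z0.
have CB n x y : iter n C (x - y) = iter n C x - iter n C y.
  elim: n => //= n ->.
  have CN u : C (- u) = - C u.
    by apply/eqP; rewrite -addr_eq0 -CD addNr z0.
  by rewrite CD CN.
elim=> [|s IHs] t x; first by rewrite /= => -> _; exact: C0.
elim: t x => [|t IHt] x sx tx; first by rewrite (tx : x = 0) C0.
have Bs n y : iter n A (A y + C y) = A (iter n A y) + C (iter n A y).
  by elim: n => //= n ->; rewrite AD cAC.
have As n y : iter n (fun x => A x + C x) (A y) = A (iter n (fun x => A x + C x) y).
  by elim: n => //= n ->; rewrite AD cAC.
rewrite addnS iterSr (_ : C x = (A x + C x) - A x); last by rewrite addrAC subrr add0r.
have h1 : iter (s.+1 + t) C (A x + C x) = 0.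
  by apply: IHt; [rewrite Bs sx (z0 A AD) (z0 C CD) addr0|move: tx; rewrite iterSr].
have h2 : iter (s + t.+1) C (A x) = 0.
  by apply: IHs; [rewrite -iterSr|rewrite As tx (z0 A AD)].
by rewrite CB h1 addSnnS h2 subr0.
Qed.

Lemma iter_comm (U : Type) (A C : U -> U) : (forall x, A (C x) = C (A x)) ->
  forall i j x, iter i A (iter j C x) = iter j C (iter i A x).
Proof.
move=> cAC i j x; elim: i => //= i ->; elim: j => //= j <-; exact: cAC.
Qed.

Section Dong.
Variables (K : numFieldType) (V : lmodType K).

(** The product of index j >= 0 of two fields, that is the residue in z of
    (z - w)^j [F(z), G(w)]. *)
Definition nprod (e : K) (j : nat) (F G : int -> V -> V) : int -> V -> V :=
  fun k v => iter j (@nab K V) (bracket e F G v) 0 k.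

Let tri := int -> int -> int -> V.
Let dzw (Q : tri) : tri := fun m k l => Q (m + 1) k l - Q m (k + 1) l.
Let dwx (Q : tri) : tri := fun m k l => Q m (k + 1) l - Q m k (l + 1).
Let dzx (Q : tri) : tri := fun m k l => Q (m + 1) k l - Q m k (l + 1).

(** Dong's lemma.  In the variables z, w, x of F, G, H, the series
    Q = [[F(z), G(w)], H(x)] is killed by (z - w)^s and by (z - x)^t (w - x)^t, hence, as
    w - x = (z - x) - (z - w), by a power of w - x. *)
Lemma dong (eFG eFH eGH : K) (F G H : int -> V -> V) :
  (forall m, linear (F m)) -> (forall m, linear (G m)) -> (forall m, linear (H m)) ->
  loc eFG F G -> loc eFH F H -> loc eGH G H ->
  forall j, loc (eFH * eGH) (nprod eFG j F G) H.
Proof.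
move=> lF lG lH [s hs] [t1 ht1] [t2 ht2] j.
pose t := maxn t1 t2.
have {}ht1 v := iter_nab_mono (leq_maxl t1 t2) (ht1 v).
have {}ht2 v := iter_nab_mono (leq_maxr t1 t2) (ht2 v).
have zw_wx Q : dzw (dwx Q) = dwx (dzw Q).
  apply/funext => m; apply/funext => k; apply/funext => l; rewrite /dzw /dwx.
  by lmod K.
have zx_wx Q : dzx (dwx Q) = dwx (dzx Q).
  apply/funext => m; apply/funext => k; apply/funext => l; rewrite /dzx /dwx.
  by lmod K.
have addE (Q Q' : tri) m k l : (Q + Q') m k l = Q m k l + Q' m k l by [].
have zwD (Q Q' : tri) : dzw (Q + Q') = dzw Q + dzw Q'.
  apply/funext => m; apply/funext => k; apply/funext => l.
  by rewrite addE /dzw !addE opprD addrACA.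
have zxD (Q Q' : tri) : dzx (Q + Q') = dzx Q + dzx Q'.
  apply/funext => m; apply/funext => k; apply/funext => l.
  by rewrite addE /dzx !addE opprD addrACA.
have wxD (Q Q' : tri) : dwx (Q + Q') = dwx Q + dwx Q'.
  apply/funext => m; apply/funext => k; apply/funext => l.
  by rewrite addE /dwx !addE opprD addrACA.
have sumE Q : dzw Q + dwx Q = dzx Q.
  by apply/funext => m; apply/funext => k; apply/funext => l; rewrite addE /dzw addrA subrK.
have zwE n Q m k l : iter n dzw Q m k l = iter n (@nab K V) (fun m k => Q m k l) m k.
  by elim: n m k => //= n IH m k; rewrite /dzw /nab !IH.
have wxE n Q m k l : iter n dwx Q m k l = iter n (@nab K V) (Q m) k l.
  by elim: n k l => //= n IH k l; rewrite /dwx /nab !IH.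
have zxE n Q m k l : iter n dzx Q m k l = iter n (@nab K V) (fun m => Q m k) m l.
  by elim: n m l => //= n IH m l; rewrite /dzx /nab !IH.
have iterD0 (D : tri -> tri) n : (forall x y, D (x + y) = D x + D y) ->
    (forall x y, iter n D (x + y) = iter n D x + iter n D y) /\ iter n D 0 = 0.
  move=> DD; have ID x y : iter n D (x + y) = iter n D x + iter n D y.
    by elim: n => //= n ->; rewrite DD.
  by split => //; apply: (addrI (iter n D 0)); rewrite -ID !addr0.
exists (s + t + t)%N => v m k.
pose Q : tri := fun m k l =>
  bracket eFG F G (H l v) m k - (eFH * eGH) *: H l (bracket eFG F G v m k).
pose U : tri := fun m k l => F m (bracket eGH G H v k l)
  - (eFG * eFH) *: bracket eGH G H (F m v) k l.
pose W : tri := fun m k l => eGH *: bracket eFH F H (G k v) m l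
  - eFG *: G k (bracket eFH F H v m l).
(* U collects the brackets of G and H, and W those of F and H. *)
have QE : Q = U + W.
  apply/funext => m1; apply/funext => k1; apply/funext => l1; rewrite addE /Q /U /W /bracket.
  rewrite !(linD (lF _)) !(linN (lF _)) !(linZ (lF _)).
  rewrite !(linD (lG _)) !(linN (lG _)) !(linZ (lG _)).
  rewrite !(linD (lH _)) !(linN (lH _)) !(linZ (lH _)).
  lmod K.
have Us : iter t dwx U = 0.
  apply/funext => m1; apply/funext => k1; apply/funext => l1; rewrite wxE iter_nabB.
  rewrite (iter_nab_lin _ (bracket eGH G H v) _ _ (lF m1)) ht2 (lin0 (lF m1)).
  by rewrite iter_nabZ ht2 scaler0 subr0.
have Ws : iter t dzx W = 0.
  apply/funext => m1; apply/funext => k1; apply/funext => l1; rewrite zxE iter_nabB.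
  rewrite !iter_nabZ ht1 (iter_nab_lin _ (bracket eFH F H v) _ _ (lG k1)) ht1.
  by rewrite (lin0 (lG k1)) !scaler0 subr0.
have Qs : iter s dzw Q = 0.
  apply/funext => m1; apply/funext => k1; apply/funext => l1; rewrite zwE iter_nabB.
  rewrite hs iter_nabZ (iter_nab_lin _ (bracket eFG F G v) _ _ (lH l1)) hs.
  by rewrite (lin0 (lH l1)) scaler0 subr0.
have [wxID wxI0] := iterD0 dwx t wxD.
have [zxID zxI0] := iterD0 dzx t zxD.
have [_ wxI0'] := iterD0 dwx (s + t)%N wxD.
have [_ zwI0] := iterD0 dzw j zwD.
have nilQ : iter (s + t + t) dwx Q = 0.
  rewrite iterD; apply: (iter_sub_nilpotent zwD wxD zw_wx).
    by rewrite (iter_comm zw_wx) Qs.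
  have -> : (fun x => dzw x + dwx x) = dzx by apply/funext.
  by rewrite QE wxID Us add0r (iter_comm zx_wx) Ws.
have res : bracket (eFH * eGH) (nprod eFG j F G) H v =2 iter j dzw Q 0.
  move=> k1 l1; rewrite zwE iter_nabB iter_nabZ.
  by rewrite (iter_nab_lin _ (bracket eFG F G v) _ _ (lH l1)).
rewrite (iter_nab_ext _ res) -wxE -(iter_comm zw_wx) nilQ.
by rewrite zwI0.
Qed.
End Dong.

(** * The calculus of SUSY vertex algebras *)

Section Calculus.
Variables (K : numFieldType) (N : nat) (V : superspace K) (X : susy_data N V).
Local Notation Y := (modes X).
Local Notation vac := (vac X).
Local Notation S := (susyS X).
Local Notation T := (transl X).

Definition mode (a : V) (n : int) (v : V) : V := Y a n [set: 'I_N]%SET v.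

(** The common features of N_W = N and N_K = N SUSY vertex algebras: the two commutators with
    S^i differ by a multiple of zeta^i, which does not contribute to the coefficients of the
    monomials without zeta^i. *)
Record susy_calculus : Prop := SusyCalculus {
  calc_vac : vacuum_locality X;
  calc_T_vac : T vac = 0;
  calc_T : forall a n v, T (mode a n v) - mode a n (T v) = - (n%:~R *: mode a (n - 1) v);
  calc_TS : forall i v, T (S i v) = S i (T v);
  calc_S : forall i p a, homog p a -> forall j (J : {set 'I_N}) v, i \notin J ->
    (-1) ^+ #|J| *: S i (field_of X a j J v) - ksign K p *: field_of X a j J (S i v) =
      zeta_sign K i J *: field_of X a j (i |: J)%SET v }.

Lemma mode_linl n v : linear (fun a => mode a n v). Proof. exact: modes_linearl. Qed.
Lemma mode_linr a n : linear (mode a n). Proof. exact: modes_linearr. Qed.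
Lemma mode_par p q a n v : homog p a -> homog q v -> homog (p (+) q) (mode a n v).
Proof.
by move=> ha hv; have := modes_even X n [set: 'I_N] ha hv; rewrite finset.setCT cards0 addbF.
Qed.
Lemma transl_linear : linear T. Proof. exact: modes_linearl. Qed.
Lemma transl_par p a : homog p a -> homog p (T a).
Proof. by move=> ha; have := mode_par (-2) ha (vac_even X); rewrite addbF. Qed.

Lemma field_mode a j v : field_of X a j finset.set0 v = mode a (-1 - j) v.
Proof. by rewrite /field_of finset.setC0. Qed.

Lemma mode_field a n v : mode a n v = field_of X a (-1 - n) finset.set0 v.
Proof. by rewrite field_mode; congr (mode _ _ _); lia. Qed.

Lemma field_linl j J v : linear (fun a => field_of X a j J v).
Proof. exact: modes_linearl. Qed.
Lemma field_linr a j J : linear (field_of X a j J).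
Proof. exact: modes_linearr. Qed.

Lemma vac_value_mode (vl : vacuum_locality X) a : mode a (-1) vac = a.
Proof. by rewrite -[RHS](vac_value vl) field_mode; congr (mode _ _ _); lia. Qed.

Section Sources.

Lemma zeta_sign0 (i : 'I_N) : zeta_sign K i finset.set0 = 1.
Proof.
rewrite /zeta_sign (_ : [set k in finset.set0 | _]%SET = finset.set0) ?cards0 //.
by apply/setP => k; rewrite !inE.
Qed.

Lemma zeta_sign_id (i : 'I_N) : zeta_sign K i [set i]%SET = 1.
Proof.
rewrite /zeta_sign (_ : [set k in [set i]%SET | _]%SET = finset.set0) ?cards0 //.
by apply/setP => k; rewrite !inE; case: eqP => // ->; rewrite ltnn.
Qed.

Lemma NW_calculus T' : NW_axioms X T' -> susy_calculus.
Proof.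
move=> ax; have vl := NW_vacuum ax.
have fT a j J v : T' (field_of X a j J v) - field_of X a j J (T' v) =
    (j + 1)%:~R *: field_of X a (j + 1) J v by exact: (NW_T ax).
have TE v : T' v = T v.
  have := fT v 0 finset.set0 vac; rewrite (NW_T_vac ax) (lin0 (field_linr _ _ _)) subr0.
  rewrite (vac_value vl) add0r scale1r => ->.
  by rewrite field_mode; congr (mode _ _ _); lia.
have fS i p a (ha : homog p a) j (J : {set 'I_N}) v : i \notin J ->
    (-1) ^+ #|J| *: S i (field_of X a j J v) - ksign K p *: field_of X a j J (S i v) =
      zeta_sign K i J *: field_of X a j (i |: J)%SET v.
  by move=> iJ; have := NW_S ax i ha j J v; rewrite /comm_odd /der_zeta (negbTE iJ).
split=> //.
- by rewrite -TE (NW_T_vac ax).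
- move=> a n v; rewrite -!TE !mode_field fT.
  have -> : -1 - n + 1 = - n by lia.
  have -> : -1 - (n - 1) = - n by lia.
  by rewrite rmorphN scaleNr.
have Svac i a j : S i (field_of X a j finset.set0 vac) = field_of X a j (i |: finset.set0)%SET vac.
  apply: (lin_eq (f := fun a => S i (field_of X a j finset.set0 vac))
     (g := fun a => field_of X a j (i |: finset.set0)%SET vac)) a => [c u v|c u v|p a ha].
  - by rewrite (field_linl _ _ _) (susyS_linear X).
  - exact: field_linl.
  have := fS i p a ha j finset.set0 vac; rewrite inE => /(_ isT).
  rewrite cards0 expr0 scale1r (vac_S vl) (lin0 (field_linr _ _ _)) scaler0 subr0.
  by rewrite zeta_sign0 scale1r.
move=> i v; rewrite -!TE -{1}(vac_value vl v) Svac.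
have := fT v 0 (i |: finset.set0)%SET vac; rewrite (NW_T_vac ax) (lin0 (field_linr _ _ _)) subr0.
move=> ->; rewrite add0r scale1r -Svac; congr (S i _).
have := fT v 0 finset.set0 vac; rewrite (NW_T_vac ax) (lin0 (field_linr _ _ _)) subr0.
by rewrite (vac_value vl) add0r scale1r => ->.
Qed.

Lemma NK_calculus : (0 < N)%N -> NK_axioms X -> susy_calculus.
Proof.
move=> N0 ax; have vl := NK_vacuum ax.
have fS i p a (ha : homog p a) j (J : {set 'I_N}) v : i \notin J ->
    (-1) ^+ #|J| *: S i (field_of X a j J v) - ksign K p *: field_of X a j J (S i v) =
      zeta_sign K i J *: field_of X a j (i |: J)%SET v.
  move=> iJ; have := NK_S ax i ha j J v.
  by rewrite /comm_odd /der_zeta /mul_zeta (negbTE iJ) subr0.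
(* The coefficients of 1 and of zeta^i in the commutator with S^i together give the commutator
   with the square of S^i, which is the derivative in z. *)
have S2 i a j v : S i (S i (field_of X a j finset.set0 v)) =
    (j + 1)%:~R *: field_of X a (j + 1) finset.set0 v
      + field_of X a j finset.set0 (S i (S i v)).
  apply: (lin_eq (f := fun a => S i (S i (field_of X a j finset.set0 v)))
     (g := fun a => (j + 1)%:~R *: field_of X a (j + 1) finset.set0 v
      + field_of X a j finset.set0 (S i (S i v)))) a => [c u w|c u w|p a ha].
  - by rewrite (field_linl _ _ _) !(susyS_linear X).
  - rewrite !(linD (field_linl _ _ _)) !(linZ (field_linl _ _ _)); lmod K.
  have e1 w := fS i p a ha j finset.set0 w; have e2 := NK_S ax i ha j [set i]%SET v.
  move: e2; rewrite /comm_odd /der_zeta /mul_zeta /der_z !inE eqxx cards1 finset.setDv.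
  rewrite zeta_sign_id scale1r sub0r expr1 scaleN1r.
  have {}e1 w : S i (field_of X a j finset.set0 w) =
      field_of X a j [set i]%SET w + ksign K p *: field_of X a j finset.set0 (S i w).
    have := e1 w; rewrite inE => /(_ isT); rewrite cards0 zeta_sign0 expr0 !scale1r finset.setU0 => <-.
    by rewrite subrK.
  move=> e2; rewrite e1 (linD (susyS_linear X i)) (linZ (susyS_linear X i)) e1.
  have -> : (j + 1)%:~R *: field_of X a (j + 1) finset.set0 v =
      S i (field_of X a j [set i]%SET v) + ksign K p *: field_of X a j [set i]%SET (S i v).
    by apply: oppr_inj; rewrite -e2 opprD.
  have kk : ksign K p * ksign K p = 1 by rewrite /ksign -expr2 sqrr_sign.
  by rewrite scalerDr scalerA kk scale1r; lmod K.
have TS2 i v : T v = S i (S i v).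
  have := S2 i v 0 vac; rewrite (vac_value vl) !(vac_S vl) (lin0 (susyS_linear X i)).
  rewrite (lin0 (field_linr _ _ _)) addr0 add0r scale1r => ->.
  by rewrite field_mode; congr (mode _ _ _); lia.
split=> //.
- by rewrite (TS2 (Ordinal N0)) (vac_S vl) (lin0 (susyS_linear X _)).
- move=> a n v; rewrite !(TS2 (Ordinal N0)) !mode_field S2 addrK.
  have -> : -1 - n + 1 = - n by lia.
  have -> : -1 - (n - 1) = - n by lia.
  by rewrite rmorphN scaleNr.
- by move=> i v; rewrite !(TS2 i).
Qed.

End Sources.

Hypothesis calc : susy_calculus.
Let vl := calc_vac calc.
Local Notation lT := transl_linear.

Lemma vac_mode a : mode a (-1) vac = a. Proof. exact: vac_value_mode. Qed.

Lemma mode_vac_ge0 a n : 0 <= n -> mode a n vac = 0.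
Proof. by move=> n0; rewrite mode_field; apply: (vac_regular vl); lia. Qed.

Lemma transl_mode a n v :
  T (mode a n v) = mode a n (T v) - n%:~R *: mode a (n - 1) v.
Proof. by rewrite -(calc_T calc) addrC subrK. Qed.

Definition Tdiv (k : nat) (a : V) : V := k`!%:R^-1 *: iter k T a.

Lemma Tdiv_linear k : linear (Tdiv k).
Proof.
move=> c u v; rewrite /Tdiv.
have -> : iter k T (c *: u + v) = c *: iter k T u + iter k T v.
  by elim: k => //= k ->; rewrite lT.
by lmod K.
Qed.

Lemma TdivS k a : T (Tdiv k a) = k.+1%:R *: Tdiv k.+1 a.
Proof.
rewrite /Tdiv (linZ lT) scalerA factS natrM invfM mulrA mulfV ?mul1r //.
by rewrite pnatr_eq0.
Qed.

Lemma Tdiv0 a : Tdiv 0 a = a. Proof. by rewrite /Tdiv invr1 scale1r. Qed.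
Lemma Tdiv1 a : Tdiv 1 a = T a. Proof. by rewrite /Tdiv invr1 scale1r. Qed.

Lemma Tdiv_par k p a : homog p a -> homog p (Tdiv k a).
Proof.
by move=> ha; apply: homogZ; elim: k => //= k; exact: transl_par.
Qed.

Lemma Tdiv_vac k : (0 < k)%N -> Tdiv k vac = 0.
Proof.
case: k => // k _; rewrite /Tdiv (_ : iter _ _ _ = 0) ?scaler0 //.
by elim: k => /= [|k ->]; [exact: (calc_T_vac calc)|exact: (lin0 lT)].
Qed.

(** For a translation covariant field, the coefficients of its value on the vacuum satisfy the
    recursion of exp(zT). *)
Lemma covariant_vac (g : int -> V) a : g (-1) = a ->
  (forall n, T (g n) = - (n%:~R *: g (n - 1))) -> forall k : nat, g (-1 - k%:Z) = Tdiv k a.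
Proof.
move=> ga gT; elim=> [|k IH]; first by rewrite subr0 Tdiv0.
have k0 : k.+1%:R != 0 :> K by rewrite pnatr_eq0.
apply: (scalerI k0); rewrite -TdivS -IH gT.
have -> : -1 - k%:Z = - k.+1%:Z by lia.
have -> : -1 - k.+1%:Z = - k.+1%:Z - 1 by lia.
by rewrite rmorphN scaleNr opprK.
Qed.

Lemma mode_vac a k : mode a (-1 - k%:Z) vac = Tdiv k a.
Proof.
apply: (covariant_vac (g := fun n => mode a n vac)); first exact: vac_mode.
by move=> n; rewrite transl_mode (calc_T_vac calc) (lin0 (mode_linr _ _)) sub0r.
Qed.

(** ** Locality and uniqueness *)

Lemma iter_mul_zw n (h : series2 N V) j J k L v :
  iter n (@mul_zw K N V) h j J k L v =
  iter n (@nab K V) (fun m l => h (-1 - m) J (-1 - l) L v) (-1 - j) (-1 - k).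
Proof.
elim: n j k => [|n IH] j k /=; first by congr (h _ _ _ _ _); lia.
rewrite -[LHS]/(iter n (@mul_zw K N V) h (j - 1) J k L v
  - iter n (@mul_zw K N V) h j J (k - 1) L v) !IH.
have -> : -1 - (j - 1) = -1 - j + 1 by lia.
by have -> : -1 - (k - 1) = -1 - k + 1 by lia.
Qed.

Lemma field_loc p q a b (J : {set 'I_N}) : homog p a -> homog q b ->
  loc (ksign K ((p (+) odd #|J|) && q)) (fun m => field_of X a (-1 - m) J) (mode b).
Proof.
move=> ha hb; have [n hn] := locality vl ha hb; exists n => v m k.
have := hn (-1 - m) J (-1 - k) finset.set0 v; rewrite iter_mul_zw.
have -> : -1 - (-1 - m) = m by lia.
have -> : -1 - (-1 - k) = k by lia.
move=> <-; apply: iter_nab_ext => m' k'; rewrite /bracket /comm2 -!mode_field.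
rewrite cards0 /= !andbF addbF !ksign_cases !scale1r scalerA; congr (_ - _ *: _).
by case: p q (odd _) {ha hb hn} => [] [] [] /=; ring.
Qed.

Lemma mode_loc p q a b : homog p a -> homog q b -> loc (ksign K (p && q)) (mode a) (mode b).
Proof.
move=> ha hb; have [n hn] := field_loc finset.set0 ha hb.
exists n => v m k; rewrite -[RHS](hn v m k) cards0 addbF.
by apply: iter_nab_ext => m' k'; rewrite /bracket -!mode_field.
Qed.

(** Goddard's uniqueness theorem.  If a field local with respect to all fields Y(b, w) kills
    the vacuum, it kills each b, which is the value of Y(b, w)|0> at w = 0. *)
Lemma goddard (F : int -> V -> V) (e : bool -> K) : (forall m, linear (F m)) ->
  (forall q b, homog q b -> loc (e q) F (mode b)) -> (forall m, F m vac = 0) ->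
  forall m v, F m v = 0.
Proof.
move=> lF locF F0 m.
apply: (lin_eq (f := F m) (g := fun=> 0)) => // [c u v|q b hb]; first by rewrite scaler0 addr0.
have [n hn] := locF q b hb.
have [] := @iter_nab_edge K V n (bracket (e q) F (mode b) vac) (m - n%:Z) _ (m - n%:Z) (lexx _).
  move=> m' k _ k0; rewrite /bracket F0 (lin0 (mode_linr _ _)) scaler0 subr0.
  by rewrite mode_vac_ge0 // (lin0 (lF _)).
rewrite hn subrK => + _; rewrite /bracket F0 (lin0 (mode_linr _ _)) scaler0 subr0.
by rewrite vac_mode.
Qed.

Lemma vac_field n v : mode vac n v = if n == -1 then v else 0.
Proof.
pose F n v : V := mode vac n v - (n == -1)%:R *: v.
have -> : mode vac n v = F n v + (n == -1)%:R *: v by rewrite subrK.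
suff -> : F n v = 0 by rewrite add0r; case: eqP => _; rewrite ?scale1r ?scale0r.
apply: (goddard (e := fun q => 1)).
- by move=> m c u w; rewrite /F (linD (mode_linr _ _)) (linZ (mode_linr _ _)); lmod K.
- move=> q b hb; apply: locB; first exact: mode_linr.
    by have := mode_loc (vac_even X) hb; rewrite /ksign expr0.
  exists 0%N => w m k /=; rewrite /bracket (linZ (mode_linr _ _)).
  by rewrite scale1r subrr.
- move=> m; rewrite /F; have [m0|m0] := leP 0 m.
    by rewrite mode_vac_ge0 // (_ : (m == -1) = false) ?scale0r ?subr0 //; lia.
  have [l ->] : exists l : nat, m = -1 - l%:Z by exists (absz (-1 - m)%R); lia.
  rewrite mode_vac; have [->|k0] := posnP l.
    by rewrite Tdiv0 subr0 eqxx scale1r subrr.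
  rewrite Tdiv_vac // (_ : (_ == -1) = false) ?scale0r ?subrr //; lia.
Qed.

(** ** The odd derivations *)

Lemma S_field_vac i a j (J : {set 'I_N}) : i \notin J ->
  (-1) ^+ #|J| *: S i (field_of X a j J vac) =
    zeta_sign K i J *: field_of X a j (i |: J)%SET vac.
Proof.
move=> iJ; apply: (lin_eq (f := fun a => (-1) ^+ #|J| *: S i (field_of X a j J vac))
  (g := fun a => zeta_sign K i J *: field_of X a j (i |: J)%SET vac)) a => [c u w|c u w|p a ha].
- by rewrite (field_linl _ _ _) (susyS_linear X); lmod K.
- by rewrite (field_linl _ _ _); lmod K.
have := calc_S calc ha j vac iJ.
by rewrite (vac_S vl) (lin0 (field_linr _ _ _)) scaler0 subr0.
Qed.

Lemma zeta_sign_sq (i : 'I_N) (J : {set 'I_N}) : zeta_sign K i J * zeta_sign K i J = 1.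
Proof. by rewrite /zeta_sign -expr2 sqrr_sign. Qed.

Lemma S_value i a : S i a = field_of X a 0 [set i]%SET vac.
Proof.
have := @S_field_vac i a 0 finset.set0; rewrite inE => /(_ isT).
by rewrite cards0 expr0 zeta_sign0 !scale1r finset.setU0 (vac_value vl).
Qed.

Lemma S_anticomm i k a : i != k -> S i (S k a) = - S k (S i a).
Proof.
move=> ik.
have e (i' k' : 'I_N) : i' != k' -> S i' (S k' a) =
    - (zeta_sign K i' [set k']%SET *: field_of X a 0 [set i'; k']%SET vac).
  move=> ik'; rewrite (S_value k'); have := @S_field_vac i' a 0 [set k']%SET.
  rewrite inE => /(_ ik'); rewrite cards1 expr1 scaleN1r => <-.
  by rewrite opprK.
have cnt (i' k' : 'I_N) : [set x in [set k']%SET | (x < i')%N]%SET =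
    if (k' < i')%N then [set k']%SET else finset.set0.
  by apply/setP => x; case: ifP => h; rewrite !inE; case: (x =P k') => [->|_] //=; rewrite h.
have sgn : zeta_sign K k [set i]%SET = - zeta_sign K i [set k]%SET.
  rewrite /zeta_sign !cnt; case: (ltngtP i k) => h.
  - by rewrite cards0 cards1 expr0 expr1.
  - by rewrite cards0 cards1 expr0 expr1 opprK.
  - by move: ik; rewrite (val_inj h) eqxx.
by rewrite (e i k ik) (e k i) 1?eq_sym // (finset.setUC [set k]%SET) sgn scaleNr !opprK.
Qed.

(** The identity Y(S^i a, Z) = d/dzeta^i Y(a, Z), in the components without zeta^i.  Both sides
    are local fields, and they agree on the vacuum because S^i anticommutes with the S^k. *)
Lemma field_S i a j (J : {set 'I_N}) v : i \notin J ->
  field_of X (S i a) j J v = zeta_sign K i J *: field_of X a j (i |: J)%SET v.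
Proof.
move=> iJ.
have on_vac b k (L : {set 'I_N}) : i \notin L ->
    field_of X (S i b) k L vac = (-1) ^+ #|L| *: S i (field_of X b k L vac).
  elim: {L}#|L| {-2}L (erefl #|L|) => [|n IH] L cL iL.
    move/eqP: cL; rewrite cards_eq0 => /eqP ->; rewrite cards0 expr0 scale1r !field_mode.
    have [k0|k0] := ltP k 0.
      by rewrite !mode_vac_ge0 ?(lin0 (susyS_linear X i)) //; lia.
    have [l ->] : exists l : nat, k = l%:Z by exists (absz k); lia.
    rewrite !mode_vac /Tdiv (linZ (susyS_linear X i)); congr (_ *: _).
    by elim: l => //= m ->; rewrite (calc_TS calc).
  have [k0 k0L] : exists k0, k0 \in L by apply/set0Pn; rewrite -card_gt0 cL.
  have k0L' : k0 \notin L :\ k0 by rewrite !inE eqxx.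
  have cL' : #|L :\ k0| = n by apply/eqP; rewrite -eqSS -cL (cardsD1 k0 L) k0L.
  have ik0 : i != k0 by apply: contraNneq iL => ->.
  have iL' : i \notin L :\ k0 by rewrite !inE negb_and iL orbT.
  have e c : field_of X c k L vac =
      (zeta_sign K k0 (L :\ k0) * (-1) ^+ n) *: S k0 (field_of X c k (L :\ k0) vac).
    have := S_field_vac c k k0L'; rewrite finset.setD1K // cL' => h.
    by rewrite -scalerA h scalerA zeta_sign_sq scale1r.
  rewrite !e (IH _ cL' iL') cL' !(linZ (susyS_linear X _)) (S_anticomm _ ik0).
  rewrite cL exprS !scalerA scalerN -scaleNr; congr (_ *: _); ring.
pose F m v : V := field_of X (S i a) (-1 - m) J v
   - zeta_sign K i J *: field_of X a (-1 - m) (i |: J)%SET v.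
suff F0 m w : F m w = 0.
  have := F0 (-1 - j) v; rewrite /F (_ : -1 - (-1 - j) = j); last by lia.
  by move/subr0_eq.
rewrite {}/F; move: a m w; suff h p a m w : homog p a ->
  field_of X (S i a) (-1 - m) J w - zeta_sign K i J *: field_of X a (-1 - m) (i |: J)%SET w = 0.
  move=> a m w; apply: (lin_eq (f := fun a => field_of X (S i a) (-1 - m) J w
     - zeta_sign K i J *: field_of X a (-1 - m) (i |: J)%SET w) (g := fun=> 0)) => [c u v'|c u v'|p b].
  - rewrite (susyS_linear X) !(linD (field_linl _ _ _)) !(linZ (field_linl _ _ _)); lmod K.
  - by rewrite scaler0 addr0.
  - exact: h.
move=> ha; move: m w; apply: (goddard (e := fun q => ksign K ((~~ p (+) odd #|J|) && q))).
- by move=> m c u w; rewrite !(linD (field_linr _ _ _)) !(linZ (field_linr _ _ _)); lmod K.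
- move=> q b hb; apply: locB; first exact: mode_linr.
    exact: field_loc (susyS_odd X i ha) hb.
  apply: locZ; first exact: mode_linr.
  have := field_loc (i |: J)%SET ha hb.
  by rewrite cardsU1 iJ /= addbN addNb.
- by move=> m; rewrite on_vac // S_field_vac // subrr.
Qed.

(** By field_S, the missing elements of J can be supplied one at a time, at the cost of replacing
    a by S^i a. *)
Lemma modes_reduce a (J : {set 'I_N}) : exists a', forall n v, Y a n J v = mode a' n v.
Proof.
have [n cJ] := ubnP #|~: J|; elim: n J a cJ => // n IH J a cJ.
have [J0|[i iJ]] := set_0Vmem (~: J).
  by exists a => m v; rewrite /mode -[J]finset.setCK J0 finset.setC0.
have iJ' : i \notin ~: (i |: J) by rewrite !inE eqxx.
have cJ' : (#|~: (i |: J)| < n)%N.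
  rewrite -ltnS (leq_trans _ cJ) // ltnS; apply: proper_card.
  rewrite properE finset.setCS finset.subsetUr /=; apply/subsetPn; exists i => //.
have e : (i |: ~: (i |: J) = ~: J)%SET.
  apply/setP => x; rewrite !inE negb_or; case: eqP => //= ->.
  by move: iJ; rewrite inE => ->.
have [a' ha'] := IH (i |: J)%SET (zeta_sign K i (~: (i |: J)) *: S i a) cJ'.
exists a' => m v; rewrite -ha' (linZ (modes_linearl X _ _ _)).
have := field_S a (-1 - m) v iJ'; rewrite /field_of finset.setCK e finset.setCK.
have -> : -1 - (-1 - m) = m by lia.
by move=> ->; rewrite scalerA zeta_sign_sq scale1r.
Qed.

(** ** The commutator formula *)

Lemma nprod_linear e j F G k : (forall m, linear (F m)) -> (forall m, linear (G m)) ->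
  linear (nprod e j F G k : V -> V).
Proof.
move=> lF lG c u v; rewrite /nprod.
have -> := @iter_nab_ext K V j (bracket e F G (c *: u + v))
   (fun m k => c *: bracket e F G u m k - (-1) *: bracket e F G v m k).
  rewrite iter_nabB !iter_nabZ; lmod K.
move=> m l; rewrite /bracket !(linD (lF _)) !(linZ (lF _)) !(linD (lG _)) !(linZ (lG _)).
rewrite !(linD (lF _)) !(linZ (lF _)); lmod K.
Qed.

Lemma nprod_transl p q a b : homog p a -> homog q b -> forall j k v,
  T (nprod (ksign K (p && q)) j (mode a) (mode b) k v) =
  nprod (ksign K (p && q)) j (mode a) (mode b) k (T v)
    - k%:~R *: nprod (ksign K (p && q)) j (mode a) (mode b) (k - 1) v.
Proof.
move=> ha hb j k v; rewrite /nprod; set e := ksign K _.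
have h : forall m k, T (iter j (@nab K V) (bracket e (mode a) (mode b) v) m k) =
  iter j (@nab K V) (bracket e (mode a) (mode b) (T v)) m k
   - m%:~R *: iter j (@nab K V) (bracket e (mode a) (mode b) v) (m - 1) k
   - k%:~R *: iter j (@nab K V) (bracket e (mode a) (mode b) v) m (k - 1).
  elim: j => [|j IH] m l /=.
    rewrite /bracket (linD lT) (linN lT) (linZ lT) !transl_mode.
    rewrite !(linD (mode_linr _ _)) !(linN (mode_linr _ _)) !(linZ (mode_linr _ _)); lmod K.
  rewrite !nabE (linD lT) (linN lT) !IH !subrK !rmorphD !addrK /=.
  rewrite -[1%:~R]/1; lmod K.
by rewrite h mulr0z scale0r subr0.
Qed.

(** The fields appearing in the commutator of Y(a, z) and Y(b, w) are those of the vectors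
    a_(j) b: they are local by Dong's lemma, and agree with them on the vacuum. *)
Lemma nprod_mode p q a b : homog p a -> homog q b -> forall (j : nat) k v,
  nprod (ksign K (p && q)) j (mode a) (mode b) k v = mode (mode a j%:Z b) k v.
Proof.
move=> ha hb j; set e := ksign K _.
pose F k v : V := nprod e j (mode a) (mode b) k v - mode (mode a j%:Z b) k v.
suff F0 k v : F k v = 0 by move=> k v; exact/subr0_eq/F0.
move: k v; apply: (goddard (e := fun r => ksign K ((p (+) q) && r))).
- move=> m c u v; rewrite /F (nprod_linear _ _ _ (mode_linr a) (mode_linr b)).
  by rewrite (linD (mode_linr _ _)) (linZ (mode_linr _ _)); lmod K.
- move=> r d hd; apply: locB; first exact: mode_linr.
    have := dong (mode_linr a) (mode_linr b) (mode_linr d)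
      (mode_loc ha hb) (mode_loc ha hd) (mode_loc hb hd) j.
    suff -> : ksign K (p && r) * ksign K (q && r) = ksign K ((p (+) q) && r) by [].
    by rewrite !ksign_cases; case: p q r {ha hb hd e F} => [] [] []; rewrite /= ?mulr1 ?mul1r ?mulrNN ?mulr1.
  exact: mode_loc (mode_par _ ha hb) hd.
move=> k; rewrite /F; apply/eqP; rewrite subr_eq0; apply/eqP.
have edge : forall m l, 0 <= m -> 0 <= l -> bracket e (mode a) (mode b) vac m l = 0.
  move=> m l m0 l0; rewrite /bracket !mode_vac_ge0 //.
  by rewrite !(lin0 (mode_linr _ _)) scaler0 subr0.
have [e1 e0] := iter_nab_edge j edge (lexx 0).
have [k0|k0] := leP 0 k; first by rewrite mode_vac_ge0 // /nprod e0.
have [l ->] : exists l : nat, k = -1 - l%:Z by exists (absz (-1 - k)%R); lia.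
rewrite mode_vac; apply: (covariant_vac (g := fun k => nprod e j (mode a) (mode b) k vac)).
  rewrite /nprod e1 add0r /bracket vac_mode [mode a j%:Z vac]mode_vac_ge0 //.
  by rewrite (lin0 (mode_linr _ _)) scaler0 subr0.
move=> n; rewrite nprod_transl // (calc_T_vac calc).
by rewrite (lin0 (nprod_linear _ _ _ (mode_linr a) (mode_linr b))) sub0r.
Qed.

(** The binomial coefficients of the usual commutator formula are not recorded: estimates for
    filtrations only involve the span. *)
Lemma commutator p q a b : homog p a -> homog q b -> forall m k v,
  span [set u | exists j : nat, u = mode (mode a j%:Z b) (m + k - j%:Z) v]
    (mode a m (mode b k v) - ksign K (p && q) *: mode b k (mode a m v)).
Proof.
move=> ha hb m k v; have [n hn] := mode_loc ha hb.
have := nab_expand (hn v) m k; apply: (span_map (f := idfun)) => // _ [j ->].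
by apply: span_in; exists j; rewrite -(nprod_mode ha hb).
Qed.

End Calculus.

(** * The Li filtration *)

Section Filtration.
Variables (K : numFieldType) (N : nat) (V : superspace K) (X : susy_data N V).
Local Notation Y := (modes X).
Local Notation vac := (vac X).
Local Notation S := (susyS X).
Local Notation T := (transl X).
Local Notation E := (Li X).
Local Notation mode := (mode X).
Local Notation Tdiv := (Tdiv X).
Hypothesis calc : susy_calculus X.
Let vl := calc_vac calc.
Local Notation lT := (transl_linear X).

Lemma Li0 n : E n 0. Proof. exact: span0. Qed.
Lemma LiD n u v : E n u -> E n v -> E n (u + v). Proof. exact: spanD. Qed.
Lemma LiZ n c v : E n v -> E n (c *: v). Proof. exact: spanZ. Qed.
Lemma LiN n v : E n v -> E n (- v). Proof. exact: spanN. Qed.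
Lemma LiB n u v : E n u -> E n v -> E n (u - v).
Proof. by move=> hu hv; apply: LiD => //; exact: LiN. Qed.

Lemma LiW n m v : (n <= m)%N -> E m v -> E n v.
Proof.
move=> nm; apply: (span_map (f := idfun)) => // _ [w [b [w0 mw ->]]].
by apply: span_in; exists w, b; split=> //; exact: leq_trans mw.
Qed.

Lemma LiT v : E 0 v.
Proof.
apply: span_in; exists [:: (vac, 0%N, [set: 'I_N]%SET)], v; split => //=.
by rewrite -[RHS]/(mode vac _ v) vac_field.
Qed.

Lemma Li_modes a k J s b : E s b -> E (k + s) (Y a (-1 - k%:Z) J b).
Proof.
apply: span_map; first exact: modes_linearr.
move=> _ [w [c [w0 sw ->]]]; apply: span_in.
by exists ((a, k, J) :: w), c; split; rewrite //= big_cons leq_add2l.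
Qed.

Lemma Li_mode a k s b : E s b -> E (k + s) (mode a (-1 - k%:Z) b).
Proof. exact: Li_modes. Qed.

Lemma Li_span n (A : set V) : A `<=` E n -> span A `<=` E n.
Proof.
by move=> AE v; apply: (span_map (f := idfun)) => // u /AE.
Qed.

(** Induction along the Li filtration; the letters can be taken homogeneous and with J = [N]
    because every mode a_(n|J) is a mode a'_(n|N). *)
Lemma Li_ind (P : nat -> V -> Prop) :
  (forall n, P n 0) -> (forall n u v, P n u -> P n v -> P n (u + v)) ->
  (forall n c v, P n v -> P n (c *: v)) ->
  (forall v, P 0%N v) -> (forall n m v, (n <= m)%N -> P m v -> P n v) ->
  (forall p a k s b, homog p a -> P s b -> P (k + s)%N (mode a (-1 - k%:Z) b)) ->
  forall n v, E n v -> P n v.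
Proof.
move=> P0 PD PZ PT PW Pmode n.
apply: (span_ind (P := P n)) => [|u v|c v|]; [exact: P0|exact: PD|exact: PZ|].
move=> _ [w [b [_ nw ->]]]; apply: (PW _ _ _ nw).
elim: w {nw} => [|[[a k] J] w IH]; first by rewrite big_nil; exact: PT.
rewrite big_cons /=; have [a' ->] := modes_reduce calc a J.
rewrite (par_sum a') (linD (mode_linl X _ _)).
by apply: PD; apply: Pmode IH; exact: homog_par.
Qed.

Lemma mode_homogL n m (P : V -> Prop) v :
  (forall a, P a -> forall p, P (par p a)) ->
  (forall p a, homog p a -> P a -> E m (mode a n v)) -> forall a, P a -> E m (mode a n v).
Proof.
move=> Ppar h a Pa; rewrite (par_sum a) (linD (mode_linl X _ _)).
by apply: LiD; apply: h; [exact: homog_par|exact: Ppar|exact: homog_par|exact: Ppar].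
Qed.

Lemma Li_transl n v : E n v -> E n.+1 (T v).
Proof.
suff h : E n v -> E n v /\ E n.+1 (T v) by move/h => [].
apply: (Li_ind (P := fun n v => E n v /\ E n.+1 (T v))).
- by move=> m; rewrite (lin0 lT); split; exact: Li0.
- by move=> m u w [h1 h2] [h3 h4]; rewrite (linD lT); split; exact: LiD.
- by move=> m c u [h1 h2]; rewrite (linZ lT); split; exact: LiZ.
- move=> u; split; first exact: LiT.
  by have := Li_mode u 1 (LiT vac); rewrite addn0.
- by move=> m m' u mm' [h1 h2]; split; [exact: LiW h1|exact: LiW h2].
- move=> p a k s b _ [h1 h2]; split; first exact: Li_mode.
  rewrite (transl_mode calc); apply: LiB; first by rewrite -addnS; exact: Li_mode.
  apply: LiZ; rewrite -addSn (_ : -1 - k%:Z - 1 = -1 - k.+1%:Z); last by lia.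
  exact: Li_mode.
Qed.

Lemma Li_Tdiv n k v : E n v -> E (n + k) (Tdiv k v).
Proof.
move=> nv; apply: LiZ; elim: k => [|k IH]; first by rewrite addn0.
by rewrite addnS; exact: Li_transl.
Qed.

Lemma Li_S i n v : E n v -> E n (S i v).
Proof.
suff h : E n v -> E n v /\ E n (S i v) by move/h => [].
have lS := susyS_linear X i.
apply: (Li_ind (P := fun n v => E n v /\ E n (S i v))).
- by move=> m; rewrite (lin0 lS); split; exact: Li0.
- by move=> m u w [h1 h2] [h3 h4]; rewrite (linD lS); split; exact: LiD.
- by move=> m c u [h1 h2]; rewrite (linZ lS); split; exact: LiZ.
- by move=> u; split; exact: LiT.
- by move=> m m' u mm' [h1 h2]; split; [exact: LiW h1|exact: LiW h2].
- move=> p a k s b ha [h1 h2]; split; first exact: Li_mode.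
  have := calc_S calc ha k (J := finset.set0) b (i := i); rewrite inE => /(_ isT).
  rewrite cards0 expr0 scale1r field_mode => /(canRL (subrK _)) ->.
  rewrite field_mode; apply: LiD; apply: LiZ; last exact: Li_mode.
  exact: Li_modes.
Qed.

(** Moving b_(j) past a letter a_(-1-k) creates the terms (b_(i) a)_(j-1-k-i).  Each of them is either
    a letter of sufficient degree, or a nonnegative mode acting on the rest of the word, to which
    the induction applies. *)
Lemma Li_mode_ge0 n v : E n v -> forall b (j : nat), E (n - j) (mode b j%:Z v).
Proof.
suff h : E n v -> E n v /\ forall p b (j : nat), homog p b -> E (n - j) (mode b j%:Z v).
  move/h => [_ {}h] b j.
  by apply: (@mode_homogL _ _ (fun=> True)) => // p a ha _; exact: (h p).
apply: (Li_ind (P := fun n v => E n v /\ forall p b (j : nat), homog p b -> E (n - j) (mode b j%:Z v))).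
- by move=> m; split; [exact: Li0|move=> p b j _; rewrite (lin0 (mode_linr X _ _)); exact: Li0].
- move=> m u w [h1 h2] [h3 h4]; split; first exact: LiD.
  by move=> p b j hb; rewrite (linD (mode_linr X _ _)); apply: LiD; [exact: h2 hb|exact: h4 hb].
- move=> m c u [h1 h2]; split; first exact: LiZ.
  by move=> p b j hb; rewrite (linZ (mode_linr X _ _)); apply: LiZ; exact: h2 hb.
- by move=> u; split => [|p b j _]; [exact: LiT|rewrite sub0n; exact: LiT].
- move=> m m' u mm' [h1 h2]; split; first exact: LiW h1.
  by move=> p b j hb; apply: LiW (h2 p b j hb); rewrite leq_sub2r.
- move=> p a k s b' ha [h1 h2]; split; first exact: Li_mode.
  move=> q b j hb; have := commutator calc hb ha j (-1 - k%:Z) b'.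
  set c := mode b j _; set d := _ *: _ => h.
  have -> : c = (c - d) + d by rewrite subrK.
  apply: LiD; last first.
    by apply: LiZ; apply: LiW (Li_mode a k (h2 q b j hb)); lia.
  move: h; apply: Li_span => _ [i ->].
  have hi : homog (q (+) p) (mode b i%:Z a) by exact: mode_par.
  have [d0|d0] := leP 0 (j%:Z + (-1 - k%:Z) - i%:Z).
    have -> : j%:Z + (-1 - k%:Z) - i%:Z = (j - k - i).-1%:Z by lia.
    by apply: LiW (h2 _ _ _ hi); lia.
  have -> : j%:Z + (-1 - k%:Z) - i%:Z = -1 - (k + i - j)%N%:Z by lia.
  by apply: LiW (Li_mode _ _ h1); lia.
Qed.

Lemma ksign_sq p : ksign K p * ksign K p = 1.
Proof. by rewrite ksign_cases; case: p; rewrite ?mulrNN mulr1. Qed.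

(** Skew-symmetry, up to the translates of the nonnegative modes of b on a: apply the
    commutator of b_(-1) and a_(n) to the vacuum. *)
Lemma skew_ge0 p q a b (n : nat) : homog p a -> homog q b ->
  span [set u | exists2 i : nat, (n <= i)%N & u = Tdiv (i - n) (mode b i%:Z a)] (mode a n%:Z b).
Proof.
move=> ha hb; have := commutator calc hb ha (-1) n%:Z vac.
rewrite (vac_mode calc) (mode_vac_ge0 calc) // (lin0 (mode_linr X _ _)) sub0r => /spanN.
rewrite opprK => /(spanZ (ksign K (q && p))).
rewrite scalerA ksign_sq scale1r.
apply: (span_map (f := idfun)) => // _ [i ->].
have [ni|ni] := leqP n i.
  apply: span_in; exists i => //.
  rewrite (_ : -1 + n%:Z - i%:Z = -1 - (i - n)%N%:Z); last by lia.
  exact: mode_vac.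
by rewrite (mode_vac_ge0 calc) //; [exact: span0|lia].
Qed.

Lemma skew_lt0 p q a b (k : nat) : homog p a -> homog q b ->
  span [set u | exists i : nat, u = Tdiv (1 + k + i) (mode b i%:Z a)]
    (mode b (-1) (Tdiv k a) - ksign K (q && p) *: mode a (-1 - k%:Z) b).
Proof.
move=> ha hb; have := commutator calc hb ha (-1) (-1 - k%:Z) vac.
rewrite (vac_mode calc) (mode_vac calc).
apply: (span_map (f := idfun)) => // _ [i ->]; apply: span_in; exists i.
rewrite (_ : -1 + (-1 - k%:Z) - i%:Z = -1 - (1 + k + i)%N%:Z); last by lia.
exact: mode_vac.
Qed.

(** Skew-symmetry expresses the modes of a on b by those of b on a, to which Li_mode_ge0
    applies. *)
Lemma Li_mulT r a b : E r a ->
  (forall n : nat, E (r - n) (mode a n%:Z b)) /\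
  (forall k : nat, E (r + k) (mode a (-1 - k%:Z) b)).
Proof.
suff h p q c d : homog p c -> homog q d -> E r c ->
    (forall n : nat, E (r - n) (mode c n%:Z d)) /\
    (forall k : nat, E (r + k) (mode c (-1 - k%:Z) d)).
  have Ppar c : E r c -> forall p, E r (par p c) by move=> rc p; exact: Li_par.
  move=> ra; split=> n; apply: (mode_homogL Ppar _ ra) => p c hc rc;
    have [h1 h2] := h p _ c _ hc (homog_par false b) rc;
    have [h3 h4] := h p _ c _ hc (homog_par true b) rc;
    by rewrite (par_sum b) (linD (mode_linr X _ _)); exact: LiD.
move=> hc hd rc; split=> n.
  have := skew_ge0 n hc hd; apply: Li_span => _ [i ni ->].
  by apply: LiW (Li_Tdiv _ (Li_mode_ge0 rc d i)); lia.
have -> : mode c (-1 - n%:Z) d = ksign K (q && p) *: (mode d (-1) (Tdiv n c) -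
    (mode d (-1) (Tdiv n c) - ksign K (q && p) *: mode c (-1 - n%:Z) d)).
  by rewrite subKr scalerA ksign_sq scale1r.
apply/LiZ/LiB; first by have := Li_mode d 0 (Li_Tdiv n rc).
have := skew_lt0 n hc hd; apply: Li_span => _ [i ->].
by apply: LiW (Li_Tdiv _ (Li_mode_ge0 rc d i)); lia.
Qed.

(** Induction on the letters of b: the commutator of a_(n) with a letter c_(-1-k) involves modes of
    the vectors a_(i) c, whose degrees are bounded by Li_mulT. *)
Lemma Li_mul r s a b : E r a -> E s b ->
  (forall n : nat, E (r + s - n) (mode a n%:Z b)) /\
  (forall k : nat, E (r + s + k) (mode a (-1 - k%:Z) b)).
Proof.
pose P s b := forall p r a, homog p a -> E r a ->
  (forall n : nat, E (r + s - n) (mode a n%:Z b)) /\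
  (forall k : nat, E (r + s + k) (mode a (-1 - k%:Z) b)).
suff h : E s b -> E s b /\ P s b.
  move=> ra /h[_ {}h].
  have Ppar c : E r c -> forall p, E r (par p c) by move=> rc p; exact: Li_par.
  split=> n; apply: (mode_homogL Ppar _ ra) => p c hc rc;
    by have [h1 h2] := h p r c hc rc; auto.
apply: (Li_ind (P := fun s b => E s b /\ P s b)).
- move=> m; split; first exact: Li0.
  by move=> p r' a' _ _; split=> n; rewrite (lin0 (mode_linr X _ _)); exact: Li0.
- move=> m u w [h1 h2] [h3 h4]; split; first exact: LiD.
  move=> p r' a' ha ra; have [k1 k2] := h2 p r' a' ha ra; have [k3 k4] := h4 p r' a' ha ra.
  by split=> n; rewrite (linD (mode_linr X _ _)); exact: LiD.
- move=> m c u [h1 h2]; split; first exact: LiZ.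
  move=> p r' a' ha ra; have [k1 k2] := h2 p r' a' ha ra.
  by split=> n; rewrite (linZ (mode_linr X _ _)); exact: LiZ.
- move=> b'; split; first exact: LiT.
  by move=> p r' a' ha ra; rewrite addn0; exact: Li_mulT.
- move=> m m' u mm' [h1 h2]; split; first exact: LiW h1.
  move=> p r' a' ha ra; have [k1 k2] := h2 p r' a' ha ra.
  by split=> n; [apply: LiW (k1 n)|apply: LiW (k2 n)]; lia.
- move=> q c k t b' hc [h1 h2]; split; first exact: Li_mode.
  move=> p r' a' ha ra; have [k1 k2] := h2 p r' a' ha ra.
  have rest (n : int) u : (forall i : nat, (n - 1 - k%:Z - i%:Z < 0 ->
        (u <= (r' - i) + t + absz (k%:Z + i%:Z - n)%R)%N) /\
        (0 <= n - 1 - k%:Z - i%:Z -> (u <= (r' - i) + t - absz (n - 1 - k%:Z - i%:Z)%R)%N)) ->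
      E u (mode a' n (mode c (-1 - k%:Z) b') - ksign K (p && q) *:
           mode c (-1 - k%:Z) (mode a' n b')).
    move=> hu; have := commutator calc ha hc n (-1 - k%:Z) b'.
    apply: Li_span => _ [i ->]; have [u1 u2] := hu i.
    have ri : E (r' - i) (mode a' i%:Z c) by have [] := Li_mulT c ra.
    have [j1 j2] := h2 _ _ _ (mode_par X i%:Z ha hc) ri.
    have [d0|d0] := leP 0 (n - 1 - k%:Z - i%:Z).
      apply: LiW (u2 d0) _.
      rewrite (_ : n + (-1 - k%:Z) - i%:Z = (absz (n - 1 - k%:Z - i%:Z)%R)%:Z); last by lia.
      exact: j1.
    apply: LiW (u1 d0) _.
    rewrite (_ : n + (-1 - k%:Z) - i%:Z = -1 - (absz (k%:Z + i%:Z - n)%R)%:Z); last by lia.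
    exact: j2.
  have main n u : E u (mode c (-1 - k%:Z) (mode a' n b')) ->
      E u (mode a' n (mode c (-1 - k%:Z) b') - ksign K (p && q) *:
           mode c (-1 - k%:Z) (mode a' n b')) -> E u (mode a' n (mode c (-1 - k%:Z) b')).
    by move=> e1 e2; have := LiD e2 (LiZ (ksign K (p && q)) e1); rewrite subrK.
  split=> n; apply: main.
  + by apply: LiW (Li_mode c k (k1 n)); lia.
  + by apply: rest => i; lia.
  + by apply: LiW (Li_mode c k (k2 n)); lia.
  + by apply: rest => i; lia.
Qed.

Lemma Li_mul1 r s a b : E r a -> E s b -> E (r + s) (mode a (-1) b).
Proof. by move=> ra sb; have [_ /(_ 0%N)] := Li_mul ra sb; rewrite addn0. Qed.

(** The corrections T^(1+k+i) (b_(i) a) in skew-symmetry disappear in the graded algebra: b_(i)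
    lowers the degree by at most i, while T raises it by one. *)
Lemma Li_skew p q r s a b k : homog p a -> homog q b -> E r a -> E s b ->
  E (r + s + k).+1 (mode b (-1) (Tdiv k a) - ksign K (q && p) *: mode a (-1 - k%:Z) b).
Proof.
move=> ha hb ra sb; have := skew_lt0 k ha hb; apply: Li_span => _ [i ->].
have [h _] := Li_mul sb ra.
by apply: LiW (Li_Tdiv _ (h i)); lia.
Qed.

Lemma Li_commutator p q r s t a b c : homog p a -> homog q b -> E r a -> E s b -> E t c ->
  E (r + s + t).+1
    (mode a (-1) (mode b (-1) c) - ksign K (p && q) *: mode b (-1) (mode a (-1) c)).
Proof.
move=> ha hb ra sb tc; have := commutator calc ha hb (-1) (-1) c.
apply: Li_span => _ [i ->]; have [ri _] := Li_mul ra sb.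
have [_ h] := Li_mul (ri i) tc.
rewrite (_ : -1 + -1 - i%:Z = -1 - i.+1%:Z); last by lia.
by apply: LiW (h i.+1); lia.
Qed.

(** Up to the same sign, both vectors agree with b_(-1) (T^k a / k!). *)
Lemma Li_Tdiv_mode r s a b k : E r a -> E s b ->
  E (r + s + k).+1 (mode (Tdiv k a) (-1) b - mode a (-1 - k%:Z) b).
Proof.
suff h p q c d : homog p c -> homog q d -> E r c -> E s d ->
    E (r + s + k).+1 (mode (Tdiv k c) (-1) d - mode c (-1 - k%:Z) d).
  move=> ra sb.
  have e p q := h p q _ _ (homog_par p a) (homog_par q b) (Li_par p ra) (Li_par q sb).
  have -> : mode (Tdiv k a) (-1) b - mode a (-1 - k%:Z) b =
    \sum_(p <- [:: false; true]) \sum_(q <- [:: false; true])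
     (mode (Tdiv k (par p a)) (-1) (par q b) - mode (par p a) (-1 - k%:Z) (par q b)).
    rewrite !big_cons !big_nil {1 2}(par_sum a) {1 2}(par_sum b) (linD (Tdiv_linear X k)).
    rewrite !(linD (mode_linl X _ _)) !(linD (mode_linr X _ _)); lmod K.
  by rewrite !big_cons !big_nil; do ![exact: e|exact: Li0|apply: LiD].
move=> hc hd rc sd.
have e1 := Li_skew k hc hd rc sd.
have := Li_skew 0 (Tdiv_par X k hc) hd (Li_Tdiv k rc) sd.
rewrite Tdiv0 subr0 addn0 addnAC => e2.
have := LiZ (ksign K (q && p)) (LiB e1 e2); have := ksign_sq (q && p).
move: (ksign K _) (mode d _ _) => e z ee; set x := mode (Tdiv k c) _ _; set y := mode c _ _.
suff -> : e *: (z - e *: y - (z - e *: x)) = x - y by [].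
transitivity ((e * e) *: x - (e * e) *: y); first by lmod K.
by rewrite ee !scale1r.
Qed.

Lemma Li_transl_mul r s a b : E r a -> E s b ->
  E (r + s).+2 (T (mode a (-1) b) - mode (T a) (-1) b - mode a (-1) (T b)).
Proof.
move=> ra sb; have := Li_Tdiv_mode 1 ra sb; rewrite addn1 Tdiv1 => /LiN.
rewrite (transl_mode calc); set x := mode (T a) _ _; set y := mode a (-1) _.
rewrite (_ : -1 - 1%N%:Z = -1 - 1) // opprB.
by set z := mode a _ _ => h; rewrite (_ : _ - _ - _ = z - x) //; lmod K.
Qed.

(** The operators a_(-1) preserve C_2(V), since the commutator of a_(-1) and c_(-j) only involves
    modes of index at most -1 - j. *)
Lemma C2_Li1 v : C2 X v <-> E 1 v.
Proof.
split.
  apply: Li_span => _ [a [b [j [J [j2 ->]]]]].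
  have -> : - j%:Z = -1 - (j.-1)%:Z by lia.
  by apply: LiW (Li_modes a j.-1 J (LiT b)); lia.
move=> v1; pose P n v := (0 < n)%N -> C2 X v.
suff : P 1%N v by exact.
have C2_mode0 : forall p a b, homog p a -> C2 X b -> C2 X (mode a (-1) b).
  move=> p a b ha; apply: span_map; first exact: mode_linr.
  move=> _ [c [d [j [J [j2 ->]]]]].
  have [c' ->] := modes_reduce calc c J; rewrite (par_sum c') (linD (mode_linl X _ _)).
  rewrite (linD (mode_linr X _ _)).
  suff h q c0 : homog q c0 -> C2 X (mode a (-1) (mode c0 (- j%:Z) d)).
    by apply: spanD; apply: h; exact: homog_par.
  move=> hc; have hC := commutator calc ha hc (-1) (- j%:Z) d.
  rewrite -[mode a _ _](subrK (ksign K (p && q) *: mode c0 (- j%:Z) (mode a (-1) d))).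
  apply: spanD; last by apply/spanZ/span_in; exists c0, (mode a (-1) d), j, [set: 'I_N]%SET.
  move: hC; apply: (span_map (f := idfun)) => // _ [i ->]; apply: span_in.
  exists (mode a i%:Z c0), d, (1 + j + i)%N, [set: 'I_N]%SET; split; first by lia.
  by rewrite (_ : -1 - j%:Z - i%:Z = - (1 + j + i)%N%:Z) //; lia.
apply: Li_ind v1 => {v}.
- by move=> n _; exact: span0.
- by move=> n u v hu hv n0; apply: spanD; [exact: hu|exact: hv].
- by move=> n c v hv n0; apply: spanZ; exact: hv.
- by [].
- by move=> n m v nm hv n0; apply: hv; exact: leq_trans nm.
- move=> p a [|k] s b ha hb; first by rewrite subr0 add0n => /hb; exact: C2_mode0 ha.
  by move=> _; apply: span_in; exists a, b, k.+2, [set: 'I_N]%SET.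
Qed.

End Filtration.

(** * The graded superalgebra of the Li filtration *)

Lemma theP (T : Type) (d : T) (P : T -> Prop) : (exists x, P x) -> P (the d P).
Proof. by move=> h; rewrite /the; case: pselect => // h'; case: (cid h'). Qed.

Section Graded.
Variables (K : numFieldType) (N : nat) (V : superspace K) (X : susy_data N V).
Local Notation vac := (vac X).
Local Notation S := (susyS X).
Local Notation T := (transl X).
Local Notation E := (Li X).
Local Notation mode := (mode X).
Local Notation Tdiv := (Tdiv X).
Local Notation cl := (gr_cl X).
Local Notation qc := (qcl (greqv_scong X)).
Local Notation "x ** y" := (smul x y) (at level 40, left associativity).
Hypothesis calc : susy_calculus X.

Lemma qc_eq f g : qc f = qc g <-> forall n, E n.+1 (gs f n - gs g n).
Proof. exact: qclP. Qed.

Lemma gr_clE n a (h : E n a) : cl n a = qc (gsdelta h).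
Proof.
rewrite /gr_cl; case: pselect => // h'.
by apply/qc_eq => m /=; case: eqP => _; rewrite subrr; exact: Li0.
Qed.

Lemma gr_clP n a b : E n a -> E n b -> (cl n a = cl n b <-> E n.+1 (a - b)).
Proof.
move=> ha hb; rewrite (gr_clE ha) (gr_clE hb) qc_eq; split=> [/(_ n) /=|h m /=].
  by rewrite eqxx.
by case: eqP => [->|_] //; rewrite subrr; exact: Li0.
Qed.

Lemma gr_clD n a b : E n a -> E n b -> cl n (a + b) = cl n a + cl n b.
Proof.
move=> ha hb; rewrite (gr_clE ha) (gr_clE hb) (gr_clE (LiD ha hb)).
transitivity (qc (gsadd (gsdelta ha) (gsdelta hb))); last by symmetry; exact: qaddE.
by apply/qc_eq => m /=; case: eqP => _; rewrite ?addr0 subrr; exact: Li0.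
Qed.

Lemma gr_clZ n c a : E n a -> cl n (c *: a) = c *: cl n a.
Proof.
move=> ha; rewrite (gr_clE ha) (gr_clE (LiZ c ha)).
transitivity (qc (gsscale c (gsdelta ha))); last by symmetry; exact: qscaleE.
by apply/qc_eq => m /=; case: eqP => _; rewrite ?scaler0 subrr; exact: Li0.
Qed.

Lemma gr_cl0 n : cl n 0 = 0.
Proof. by rewrite -(scale0r (0 : V)) gr_clZ ?scale0r //; exact: Li0. Qed.

Lemma gr_cl_eq0 n a : E n.+1 a -> cl n a = 0.
Proof.
move=> ha; rewrite -(gr_cl0 n); apply/gr_clP; [exact: LiW ha|exact: Li0|].
by rewrite subr0.
Qed.

Lemma gr_cl_sum n (I : Type) (r : seq I) (F : I -> V) : (forall i, E n (F i)) ->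
  cl n (\sum_(i <- r) F i) = \sum_(i <- r) cl n (F i).
Proof.
move=> hF; elim: r => [|i r IH]; first by rewrite !big_nil gr_cl0.
rewrite !big_cons gr_clD // ?IH //.
by elim/big_ind: _ => //; [exact: Li0|exact: LiD].
Qed.

Lemma gr_cl_par n b a : E n a -> par b (cl n a) = cl n (par b a).
Proof.
move=> ha; rewrite (gr_clE ha) (gr_clE (Li_par b ha)).
transitivity (qc (gspar b (gsdelta ha))); first exact: qparE.
apply/qc_eq => m /=; case: eqP => _; rewrite ?(lin0 (@par_linear _ V b)) subrr; exact: Li0.
Qed.

Lemma gr_cl_homog n p a : E n a -> homog p a -> homog p (cl n a).
Proof. by move=> ha hp; rewrite /homog gr_cl_par // hp. Qed.

Lemma gr_ind (P : gr_space X -> Prop) : P 0 -> (forall x y, P x -> P y -> P (x + y)) ->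
  (forall p n a, homog p a -> E n a -> P (cl n a)) -> forall x, P x.
Proof.
move=> P0 PD Pcl x; rewrite -[x](qrepK (hE := greqv_scong X)).
have Pcl' n a : E n a -> P (cl n a).
  move=> ha; rewrite (par_sum a) gr_clD; [|exact: Li_par..].
  by apply: PD; apply: Pcl (homog_par _ _) (Li_par _ ha).
have [m] := gs_fin (qrep x : grseq X).
elim: m (qrep x : grseq X) => [|m IH] f fm.
  suff -> : qc f = 0 by [].
  by apply/qc_eq => n /=; rewrite fm // subrr; exact: Li0.
have fmE := gs_in f m.
have -> : qc f = qc (gsadd f (gsopp (gsdelta fmE))) + cl m (gs f m).
  rewrite (gr_clE fmE); transitivity (qc (gsadd (gsadd f (gsopp (gsdelta fmE))) (gsdelta fmE))).
    by apply/qc_eq => n /=; rewrite subrK subrr; exact: Li0.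
  by symmetry; exact: qaddE.
apply: PD; last exact: Pcl'.
apply: IH => n mn /=; case: eqP => [->|nm]; first by rewrite subrr.
by rewrite subr0 fm // ltn_neqAle mn andbT; apply/eqP => mn'; apply: nm.
Qed.

(** ** The product *)

Lemma gsmul_in (f g : grseq X) n :
  E n (\sum_(i < n.+1) mode (gs f i) (-1) (gs g (n - i)%N)).
Proof.
elim/big_ind: _ => [|u v|i _]; [exact: Li0|exact: LiD|].
have := Li_mul1 calc (gs_in f i) (gs_in g (n - i)).
by rewrite subnKC // -ltnS.
Qed.

Lemma gsmul_fin (f g : grseq X) : exists m, forall n, (m <= n)%N ->
  \sum_(i < n.+1) mode (gs f i) (-1) (gs g (n - i)%N) = 0.
Proof.
have [m hm] := gs_fin f; have [m' hm'] := gs_fin g.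
exists (m + m')%N => n mn; apply: big1 => i _.
have [mi|im] := leqP m i; first by rewrite hm // (lin0 (mode_linl X _ _)).
by rewrite hm' ?(lin0 (mode_linr X _ _)) //; lia.
Qed.

Definition gsmul (f g : grseq X) : grseq X := GrSeq (gsmul_in f g) (gsmul_fin f g).

Lemma gsmul_qc f f' g g' : qc f = qc f' -> qc g = qc g' -> qc (gsmul f g) = qc (gsmul f' g').
Proof.
move=> /qc_eq ff /qc_eq gg; apply/qc_eq => n /=; rewrite -sumrB.
elim/big_ind: _ => [|u v|i _]; [exact: Li0|exact: LiD|].
have i_n : (i + (n - i) = n)%N by rewrite subnKC // -ltnS.
have -> : mode (gs f i) (-1) (gs g (n - i)) - mode (gs f' i) (-1) (gs g' (n - i)) =
   mode (gs f i - gs f' i) (-1) (gs g (n - i)) + mode (gs f' i) (-1) (gs g (n - i) - gs g' (n - i)).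
  rewrite (linD (mode_linl X _ _)) (linN (mode_linl X _ _)).
  by rewrite (linD (mode_linr X _ _)) (linN (mode_linr X _ _)); lmod K.
apply: LiD.
  by have := Li_mul1 calc (ff i) (gs_in g (n - i)); rewrite addSn i_n.
by have := Li_mul1 calc (gs_in f' i) (gg (n - i)%N); rewrite addnS i_n.
Qed.

Lemma gr_mulP : gr_mul_spec (@gr_mul K N V X).
Proof.
apply: theP; pose m (x y : gr_space X) : gr_space X := qc (gsmul (qrep x) (qrep y)).
have mE f g : m (qc f) (qc g) = qc (gsmul f g) by apply: gsmul_qc; exact: qrepK.
have eq0 f g : (forall n, gs f n = gs g n) -> qc f = qc g.
  by move=> fg; apply/qc_eq => n; rewrite fg subrr; exact: Li0.
have lE c f g : c *: qc f + qc g = qc (gsadd (gsscale c f) g).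
  by rewrite [c *: _](qscaleE (greqv_scong X)); exact: qaddE.
have rK (x : gr_space X) : x = qc (qrep x) by rewrite qrepK.
exists m; split.
- move=> y c x x'; rewrite (rK x) (rK x') (rK y) lE !mE lE; apply: eq0 => n /=.
  rewrite scaler_sumr -big_split; apply: eq_bigr => i _ /=.
  by rewrite (linD (mode_linl X _ _)) (linZ (mode_linl X _ _)).
- move=> x c y y'; rewrite (rK x) (rK y) (rK y') lE !mE lE; apply: eq0 => n /=.
  rewrite scaler_sumr -big_split; apply: eq_bigr => i _ /=.
  by rewrite (linD (mode_linr X _ _)) (linZ (mode_linr X _ _)).
- move=> r s a b ra sb; have ab := Li_mul1 calc ra sb; split => //.
  rewrite (gr_clE ra) (gr_clE sb) (gr_clE ab) mE; apply: eq0 => n /=.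
  case: eqP => [->|nrs].
    have rlt : (r < (r + s).+1)%N by rewrite ltnS leq_addr.
    rewrite (bigD1 (Ordinal rlt)) //= eqxx addKn eqxx big1 ?addr0 // => i ir.
    rewrite ifN ?(lin0 (mode_linl X _ _)) //.
  apply: big1 => i _; case: eqP => [ir|_]; last exact: (lin0 (mode_linl X _ _)).
  case: eqP => [nis|_]; last exact: (lin0 (mode_linr X _ _)).
  by case: nrs; rewrite -nis -ir subnKC // -ltnS.
Qed.

Lemma gr_linl (y : gr X) : linear (fun x : gr X => x ** y).
Proof. by have [h _ _] := gr_mulP; exact: h. Qed.
Lemma gr_linr (x : gr X) : linear (@smul K (gr X) x).
Proof. by have [_ h _] := gr_mulP; exact: h. Qed.

Lemma gr_clM r s a b : E r a -> E s b ->
  (cl r a : gr X) ** cl s b = cl (r + s) (mode a (-1) b).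
Proof. by move=> ra sb; have [_ _ h] := gr_mulP; exact: (h r s a b ra sb).2. Qed.

Lemma gr_clMC p q r s a b : homog p a -> homog q b -> E r a -> E s b ->
  (cl r a : gr X) ** cl s b = ksign K (p && q) *: ((cl s b : gr X) ** cl r a).
Proof.
move=> ha hb ra sb; rewrite !gr_clM // addnC -gr_clZ; last exact: Li_mul1.
rewrite andbC; apply/gr_clP; first by rewrite addnC; exact: Li_mul1.
  by apply: LiZ; exact: Li_mul1.
have := Li_skew calc 0 ha hb ra sb; rewrite Tdiv0 subr0 addn0 addnC.
move/(LiZ (- ksign K (q && p))); set x := mode b _ _; set y := mode a _ _.
suff -> : - ksign K (q && p) *: (x - ksign K (q && p) *: y) = y - ksign K (q && p) *: x by [].
transitivity ((ksign K (q && p) * ksign K (q && p)) *: y - ksign K (q && p) *: x); first by lmod K.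
by rewrite ksign_sq scale1r.
Qed.

Lemma gr_clMCA p q r s t a b c : homog p a -> homog q b -> E r a -> E s b -> E t c ->
  (cl r a : gr X) ** ((cl s b : gr X) ** cl t c) =
  ksign K (p && q) *: ((cl s b : gr X) ** ((cl r a : gr X) ** cl t c)).
Proof.
move=> ha hb ra sb tc.
have bc := Li_mul1 calc sb tc; have ac := Li_mul1 calc ra tc.
rewrite !gr_clM // (addnCA s) -gr_clZ; last by rewrite addnCA; exact: Li_mul1.
apply/gr_clP; [exact: Li_mul1|by apply: LiZ; rewrite addnCA; exact: Li_mul1|].
by rewrite addnA; exact: Li_commutator.
Qed.

(** Associativity follows from commutativity and from the exchange of two left
    multiplications: up to signs, a(bc) = a(cb) = c(ab) = (ab)c. *)
Lemma gr_comsalg : is_comsalg (gr X).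
Proof.
have L0 y : (0 : gr X) ** y = 0 by exact: (lin0 (gr_linl y)).
have R0 (x : gr X) : x ** 0 = 0 by exact: (lin0 (gr_linr x)).
have DL (x x' y : gr X) : (x + x') ** y = x ** y + x' ** y by exact: (linD (gr_linl y)).
have DR (x y y' : gr X) : x ** (y + y') = x ** y + x ** y' by exact: (linD (gr_linr x)).
have ZR c (x y : gr X) : x ** (c *: y) = c *: (x ** y) by exact: (linZ (gr_linr x)).
split; cbn [oadd oscale opar ops_of].
- by move=> s s' t t' -> ->.
- apply: gr_ind => [t u|x y hx hy t u|p r a ha ra]; first by rewrite !L0.
    by rewrite !DL hx hy.
  apply: gr_ind => [u|x y hx hy u|q s b hb sb]; first by rewrite L0 R0 L0.
    by rewrite !DL !DR DL hx hy.
  apply: gr_ind => [|x y hx hy|o t c hc tc]; first by rewrite !R0.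
    by rewrite !DR hx hy.
  have ab := Li_mul1 calc ra sb.
  rewrite (gr_clMC hb hc) // ZR (gr_clMCA ha hc) //.
  rewrite (gr_clM ra sb) (gr_clMC hc (mode_par X (-1) ha hb)) // !scalerA.
  rewrite [X in X *: _](_ : _ = 1) ?scale1r // !ksign_cases.
  by case: (p) (q) (o) => [] [] [] /=; ring.
- apply: gr_ind => [|x y hx hy|q s b hb sb]; first by rewrite R0.
    by rewrite DR hx hy.
  by rewrite [sone _]/(cl 0 vac) gr_clM //; [rewrite (vac_field calc)|exact: LiT].
- exact: DL.
- exact: DR.
- by move=> c s t; exact: (linZ (gr_linl t)).
- by move=> c s t; exact: ZR.
- by rewrite [sone _]/(cl 0 vac) gr_cl_par ?(vac_even X) //; exact: LiT.
- have P0 b : par b (0 : gr X) = 0 by exact: (lin0 (@par_linear _ (gr X) b)).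
  have PD b (x y : gr X) : par b (x + y) = par b x + par b y.
    exact: (linD (@par_linear _ (gr X) b)).
  move=> b c; apply: gr_ind => [t|x y hx hy t|p r a ha ra]; first by rewrite P0 L0 P0.
    by rewrite !PD DL PD hx hy.
  apply: gr_ind => [|x y hx hy|q s d hd sd]; first by rewrite P0 R0 P0.
    by rewrite !PD DR PD hx hy.
  rewrite (par_homog _ (gr_cl_homog ra ha)) (par_homog _ (gr_cl_homog sd hd)).
  case: eqP => [->|_]; last by rewrite L0 P0.
  case: eqP => [->|_]; last by rewrite R0 P0.
  rewrite gr_clM //; apply: gr_cl_homog; [exact: Li_mul1|exact: mode_par].
have P0 b : par b (0 : gr X) = 0 by exact: (lin0 (@par_linear _ (gr X) b)).
have PD b (x y : gr X) : par b (x + y) = par b x + par b y.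
  exact: (linD (@par_linear _ (gr X) b)).
move=> b c; apply: gr_ind => [t|x y hx hy t|p r a ha ra]; first by rewrite P0 L0 R0 scaler0.
  by rewrite !PD DL DR hx hy scalerDr.
apply: gr_ind => [|x y hx hy|q s d hd sd]; first by rewrite P0 R0 L0 scaler0.
  by rewrite !PD DR DL hx hy scalerDr.
rewrite (par_homog _ (gr_cl_homog ra ha)) (par_homog _ (gr_cl_homog sd hd)).
case: eqP => [->|_]; last by rewrite L0 R0 scaler0.
case: eqP => [->|_]; last by rewrite R0 L0 scaler0.
exact: gr_clMC.
Qed.

(** ** The odd derivations *)

Lemma gr_SP i : linear (@gr_S K N V X i) /\ forall n a, E n a ->
  E n (S i a) /\ @gr_S K N V X i (cl n a) = cl n (S i a).
Proof.
apply: (@theP _ _ (fun D : gr X -> gr X => linear D /\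
    forall n a, Li X n a -> Li X n (susyS X i a) /\ D (gr_cl X n a) = gr_cl X n (susyS X i a))).
have lS := susyS_linear X i.
have Sin (f : grseq X) n : E n (S i (gs f n)) by exact: (Li_S calc i (gs_in f n)).
have Sfin (f : grseq X) : exists m, forall n, (m <= n)%N -> S i (gs f n) = 0.
  by have [m hm] := gs_fin f; exists m => n /hm ->; exact: (lin0 lS).
pose gsS f := GrSeq (Sin f) (Sfin f).
have gsSE f g : qc f = qc g -> qc (gsS f) = qc (gsS g).
  move=> /qc_eq fg; apply/qc_eq => n /=; rewrite -(linN lS) -(linD lS).
  exact: Li_S.
pose D (x : gr X) : gr X := qc (gsS (qrep (x : gr_space X))).
have DE f : D (qc f) = qc (gsS f) by apply: gsSE; exact: qrepK.
exists D; split.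
- move=> c x y; rewrite -[x](qrepK (hE := greqv_scong X)) -[y](qrepK (hE := greqv_scong X)).
  rewrite [c *: qc _](qscaleE (greqv_scong X)) [_ + qc _](qaddE (greqv_scong X)) !DE.
  rewrite [c *: qc _](qscaleE (greqv_scong X)) [RHS](qaddE (greqv_scong X)).
  by apply/qc_eq => n /=; rewrite lS subrr; exact: Li0.
- move=> n a na; have Sna := Li_S calc i na; split => //.
  rewrite (gr_clE na) (gr_clE Sna) DE; apply/qc_eq => m /=.
  by case: eqP => _; rewrite ?(lin0 lS) subrr; exact: Li0.
Qed.

Lemma gr_S_linear i : linear (@gr_S K N V X i). Proof. by have [] := gr_SP i. Qed.
Lemma gr_S_cl i n a : E n a -> @gr_S K N V X i (cl n a) = cl n (S i a).
Proof. by have [_ h] := gr_SP i => na; have [] := h n a na. Qed.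

Lemma gr_S_par i b (x : gr X) : @gr_S K N V X i (par b x) = par (~~ b) (@gr_S K N V X i x).
Proof.
have lP := @par_linear _ (gr X); have lS := gr_S_linear i.
move: x; apply: gr_ind => [|x y hx hy|p n a ha na].
- by rewrite (lin0 (lP _)) (lin0 lS) (lin0 (lP _)).
- by rewrite (linD (lP _)) !(linD lS) (linD (lP _)) hx hy.
have hS := susyS_odd X i ha; have nS := Li_S calc i na.
rewrite (par_homog _ (gr_cl_homog na ha)) gr_S_cl // (par_homog _ (gr_cl_homog nS hS)).
rewrite (inj_eq negb_inj); case: eqP => _; first exact: gr_S_cl.
exact: (lin0 lS).
Qed.

(** The commutator of S^i and a_(-1|N) is a_(-1|J), J being the complement of i, which is also
    (S^i a)_(-1|N); hence the rule holds exactly, before passing to symbols. *)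
Lemma gr_S_derivation i b (x y : gr X) : homog b x ->
  @gr_S K N V X i (x ** y) = @gr_S K N V X i x ** y + ksign K b *: (x ** @gr_S K N V X i y).
Proof.
have lS := gr_S_linear i; have lP := @par_linear _ (gr X).
suff h : forall x y, @gr_S K N V X i (par b x ** y) =
    @gr_S K N V X i (par b x) ** y + ksign K b *: (par b x ** @gr_S K N V X i y).
  by move=> hx; have := h x y; rewrite hx.
apply: gr_ind => [z|x1 x2 hx1 hx2 z|p r a ha ra].
- by rewrite (lin0 (lP _)) !(lin0 (gr_linl _)) (lin0 lS) (lin0 (gr_linl _)) scaler0 addr0.
- rewrite (linD (lP _)) !(linD (gr_linl _)) !(linD lS) !(linD (gr_linl _)) hx1 hx2.
  lmod K.
apply: gr_ind => [|y1 y2 hy1 hy2|q s c hc sc].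
- by rewrite (lin0 lS) !(lin0 (gr_linr _)) (lin0 lS) scaler0 addr0.
- rewrite (linD lS) !(linD (gr_linr _)) !(linD lS) hy1 hy2; lmod K.
rewrite (par_homog _ (gr_cl_homog ra ha)); case: eqP => [->|_]; last first.
  by rewrite (lin0 lS) !(lin0 (gr_linl _)) (lin0 lS) scaler0 addr0.
have rS := Li_S calc i ra; have sS := Li_S calc i sc; have ac := Li_mul1 calc ra sc.
rewrite gr_clM // !gr_S_cl // !gr_clM // -gr_clZ; last exact: Li_mul1.
rewrite -gr_clD; [|exact: Li_mul1|by apply: LiZ; exact: Li_mul1].
congr (cl _ _); have i0 : i \notin finset.set0 by rewrite inE.
have := calc_S calc ha 0 c i0; rewrite -(field_S calc a 0 c i0).
by rewrite !field_mode subr0 cards0 expr0 scale1r => <-; rewrite subrK.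
Qed.

(** ** Divided powers of the translation operator *)

(** Leibniz' rule for the divided powers, by induction: T is a derivation modulo the next step of
    the filtration, and the coefficients j and i + 1 - j coming from its two terms add up to
    i + 1. *)
Lemma Tdiv_mul i a b :
  E i.+1 (Tdiv i (mode a (-1) b) -
    \sum_(j < i.+1) mode (Tdiv j a) (-1) (Tdiv (i - j) b)).
Proof.
elim: i => [|i IH].
  by rewrite big_ord1 subnn !Tdiv0 subrr; exact: Li0.
have i0 : i.+1%:R != 0 :> K by rewrite pnatr_eq0.
suff h : E i.+2 (i.+1%:R *: (Tdiv i.+1 (mode a (-1) b) -
    \sum_(j < i.+2) mode (Tdiv j a) (-1) (Tdiv (i.+1 - j) b))).
  by have := LiZ i.+1%:R^-1 h; rewrite scalerA mulVf // scale1r.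
have lT := transl_linear X.
pose F j l := mode (Tdiv j a) (-1) (Tdiv l b).
have step j l : (j + l = i)%N ->
    E i.+2 (T (F j l) - j.+1%:R *: F j.+1 l - l.+1%:R *: F j l.+1).
  move=> jl; have := Li_transl_mul calc (Li_Tdiv calc j (LiT calc a)) (Li_Tdiv calc l (LiT calc b)).
  rewrite !TdivS (linZ (mode_linl X _ _)) (linZ (mode_linr X _ _)).
  by rewrite !add0n jl.
have := Li_transl calc IH; rewrite (linD lT) (linN lT) TdivS => h.
have {}IH := LiD h (_ : E i.+2 (\sum_(j < i.+1)
   (T (F j (i - j)%N) - j.+1%:R *: F j.+1 (i - j)%N - (i - j).+1%:R *: F j (i - j).+1))).
have {}IH : E i.+2 (i.+1%:R *: Tdiv i.+1 (mode a (-1) b) -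
  (\sum_(j < i.+1) j.+1%:R *: F j.+1 (i - j)%N + \sum_(j < i.+1) (i - j).+1%:R *: F j (i - j).+1)).
  have := IH _; rewrite !sumrB.
  have -> : T (\sum_(j < i.+1) mode (Tdiv j a) (-1) (Tdiv (i - j) b)) = \sum_(j < i.+1) T (F j (i - j)%N).
    by apply: (big_morph T (linD lT) (lin0 lT)).
  set A := \sum_(j < i.+1) T _; set B := \sum_(j < i.+1) _; set C := \sum_(j < i.+1) _.
  have -> : i.+1%:R *: Tdiv i.+1 (mode a (-1) b) - A + (A - B - C) =
     i.+1%:R *: Tdiv i.+1 (mode a (-1) b) - (B + C) by lmod K.
  apply; rewrite -!sumrB; elim/big_ind: _ => [|u v|j _]; [exact: Li0|exact: LiD|].
  by apply: step; rewrite subnKC // -ltnS.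
rewrite scalerBr scaler_sumr.
suff -> : \sum_(j < i.+2) i.+1%:R *: mode (Tdiv j a) (-1) (Tdiv (i.+1 - j) b) =
  \sum_(j < i.+1) j.+1%:R *: F j.+1 (i - j)%N + \sum_(j < i.+1) (i - j).+1%:R *: F j (i - j).+1 by [].
transitivity (\sum_(j < i.+2) (j%:R *: F j (i.+1 - j)%N + (i.+1 - j)%:R *: F j (i.+1 - j)%N)).
  apply: eq_bigr => j _; rewrite -scalerDl -natrD subnKC // -ltnS //.
rewrite big_split /=; congr (_ + _).
  by rewrite big_ord_recl scale0r add0r; apply: eq_bigr => j _; rewrite /= /bump add1n subSS.
rewrite big_ord_recr /= subnn scale0r addr0; apply: eq_bigr => j _.
by rewrite /= subSn // -ltnS.
Qed.

End Graded.

(** * Universal properties *)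

Section PresentationLift.
Variables (K : fieldType) (X : Type) (r : aterm K X -> aterm K X -> Prop).
Variables (A : salg K) (g : X -> A).
Hypothesis cA : is_comsalg A.

Fixpoint aeval (t : aterm K X) : A :=
  match t with
  | AGen x => g x
  | AZero => 0
  | AAdd s t => aeval s + aeval t
  | AOpp s => - aeval s
  | AScale c s => c *: aeval s
  | APar b s => par b (aeval s)
  | AOne => sone A
  | AMul s t => smul (aeval s) (aeval t)
  end.

Hypothesis hr : forall s t, r s t -> aeval s = aeval t.

Lemma aeval_eqv s t : aeqv r s t -> aeval s = aeval t.
Proof.
move/(_ (fun s t => aeval s = aeval t)); apply; split=> //.
- have PL := @par_linear _ A.
  split => /= [//|s' t' -> //|s' t' u -> //|s1 s2 t1 t2 -> -> //|s1 s2 -> //|c s1 s2 -> //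
    |b s1 s2 -> //|u v w|u v|u|u|c d u|u|c u v|c d u|b u v|b c u|b c u|u].
  + by rewrite addrA.
  + by rewrite addrC.
  + by rewrite add0r.
  + by rewrite addNr.
  + by rewrite scalerA.
  + by rewrite scale1r.
  + by rewrite scalerDr.
  + by rewrite scalerDl.
  + by rewrite (linD (PL b)).
  + by rewrite (linZ (PL b)).
  + by rewrite par_par; case: ifP.
  + exact: par_sum.
- split => /= [s1 s2 t1 t2 -> -> //|u v w|u|u v w|u v w|c u v|c u v||b c u v|b c u v].
  + exact: (ca_mulA cA).
  + exact: (ca_mul1 cA).
  + exact: (ca_mulDl cA).
  + exact: (ca_mulDr cA).
  + exact: (ca_mulZl cA).
  + exact: (ca_mulZr cA).
  + exact: (ca_par1 cA).
  + exact: (ca_parM cA).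
  + exact: (ca_mulC cA).
Qed.

Definition pres_lift (p : pres r) : A := aeval (qrep p).

Lemma pres_liftE t : pres_lift (acl r t) = aeval t.
Proof. exact: aeval_eqv (qrep_cl (aeqv_scong r) t). Qed.

Lemma pres_lift_morph : salg_morph pres_lift.
Proof.
have rK (p : pres r) : p = acl r (qrep p) by rewrite /acl qrepK.
have addE s t : acl r s + acl r t = acl r (AAdd s t) by exact: qaddE.
have scE c s : c *: acl r s = acl r (AScale c s) by exact: qscaleE.
have parE b s : par b (acl r s) = acl r (APar b s) by exact: qparE.
split.
- by move=> c x y; rewrite (rK x) (rK y) scE addE !pres_liftE.
- by move=> b x; rewrite (rK x) parE !pres_liftE.
- by rewrite [sone _]/(acl r AOne) pres_liftE.
- by move=> x y; rewrite (rK x) (rK y) acl_mul !pres_liftE.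
Qed.

Lemma pres_ind (P : pres r -> Prop) : (forall x, P (acl r (AGen x))) -> P 0 ->
  (forall x y, P x -> P y -> P (x + y)) -> (forall c x, P x -> P (c *: x)) ->
  (forall b x, P x -> P (par b x)) -> P (sone _) ->
  (forall x y, P x -> P y -> P (smul x y)) -> forall x, P x.
Proof.
move=> Pg P0 PD PZ Pp P1 PM x; rewrite (_ : x = acl r (qrep x)); last by rewrite /acl qrepK.
have addE s t : acl r s + acl r t = acl r (AAdd s t) by exact: qaddE.
have scE c s : c *: acl r s = acl r (AScale c s) by exact: qscaleE.
have parE b s : par b (acl r s) = acl r (APar b s) by exact: qparE.
elim: (qrep x : aterm K X) => [y||s hs t ht|s hs|c s hs|b s hs||s hs t ht] //.
- by rewrite -addE; exact: PD.
- have -> : acl r (AOpp s) = (-1) *: acl r s.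
    rewrite scaleN1r; symmetry; exact: qoppE.
  exact: PZ.
- by rewrite -scE; exact: PZ.
- by rewrite -parE; exact: Pp.
- by rewrite -acl_mul; exact: PM.
Qed.

End PresentationLift.

Section DeRhamLift.
Variables (K : numFieldType) (B A : salg K) (phi : B -> A) (D : A -> A).
Hypothesis cA : is_comsalg A.
Hypothesis mphi : salg_morph phi.
Hypothesis lD : linear D.
Hypothesis Dpar : forall b x, D (par b x) = par (~~ b) (D x).
Hypothesis Dder : forall b x y, homog b x ->
  D (smul x y) = smul (D x) y + ksign K b *: smul x (D y).

Let lphi := sm_linear mphi.

(** The B-linear map from Pi Omega to A extending Pi (d x) |-> D (phi x), read on Omega.  As
    x (Pi m) = (-1)^p(x) Pi (x m), the action of x on Omega becomes the multiplication by
    phi x_0 - phi x_1, and parities are exchanged. *)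
Fixpoint meval (m : mterm B) : A :=
  match m with
  | MD x => D (phi x)
  | MZero => 0
  | MAdd m n => meval m + meval n
  | MOpp m => - meval m
  | MScale c m => c *: meval m
  | MPar b m => par (~~ b) (meval m)
  | MAct x m => smul (phi (par false x) - phi (par true x)) (meval m)
  end.

Lemma meval_eqv m n : keqv m n -> meval m = meval n.
Proof.
have PL := @par_linear _ A; have PB := @par_linear _ B.
move/(_ (fun m n => meval m = meval n)); apply; split.
- split => /= [//|s' t' -> //|s' t' u -> //|s1 s2 t1 t2 -> -> //|s1 s2 -> //|c s1 s2 -> //
    |b s1 s2 -> //|u v w|u v|u|u|c d u|u|c u v|c d u|b u v|b c u|b c u|u].
  + by rewrite addrA.
  + by rewrite addrC.
  + by rewrite add0r.
  + by rewrite addNr.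
  + by rewrite scalerA.
  + by rewrite scale1r.
  + by rewrite scalerDr.
  + by rewrite scalerDl.
  + by rewrite (linD (PL _)).
  + by rewrite (linZ (PL _)).
  + by rewrite par_par (inj_eq negb_inj); case: ifP.
  + by rewrite addrC; exact: par_sum.
- split => /= [x s t -> //|x s t|x y s|x c s|x c s|s|x y s|b c x s].
  + by rewrite (salgDr cA).
  + by rewrite -(salgDl cA) !(linD (PB _)) !(linD lphi); congr smul; lmod K.
  + by rewrite (salgZr cA).
  + by rewrite -(salgZl cA) !(linZ (PB _)) !(linZ lphi) scalerBr.
  + rewrite !(sm_par mphi) (sm_one mphi) !(par_homog _ (salg1_homog cA)) /=.
    by rewrite subr0 salg1M.
  + rewrite (salgMA cA); congr smul.
    rewrite !(sm_par mphi) (sm_mul mphi).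
    set u := phi x; set v := phi y.
    have e (b : bool) : par b (smul u v) =
        smul (par false u) (par b v) + smul (par true u) (par (~~ b) v).
      have H p q : par b (smul (par p u) (par q v)) =
          if b == p (+) q then smul (par p u) (par q v) else 0.
        by rewrite (par_homog _ (salgM_homog cA (homog_par p u) (homog_par q v))).
      rewrite {1}(par_sum u) {1}(par_sum v) !(salgDl cA) !(salgDr cA) !(linD (PL _)) !H.
      by case: b {H} => /=; rewrite ?addr0 ?add0r.
    rewrite !e /= !(salgDl cA) !(salgDr cA) !(salgNl cA) !(salgNr cA); lmod K.
  + rewrite !par_par.
    have P0 b' : phi (if b' then par b x else 0) = if b' then phi (par b x) else 0.
      by case: b'; rewrite // (lin0 lphi).
    rewrite !P0 (sm_par mphi).
    have hm : homog (~~ c) (par (~~ c) (meval s)) by exact: homog_par.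
    have hx : homog b (par b (phi x)) by exact: homog_par.
    have h := salgM_homog cA hx hm; rewrite addbN in h.
    case: b {P0} hx h => hx h /=; rewrite ?subr0 ?sub0r // (salgNl cA) (linN (PL _)).
    by rewrite h.
- move=> _ _ [c x y|b x|b c x y hx hy] /=.
  + by rewrite lphi lD.
  + by rewrite (sm_par mphi) Dpar.
  + have hfx : homog b (phi x) by rewrite /homog -(sm_par mphi) hx.
    have hfy : homog c (phi y) by rewrite /homog -(sm_par mphi) hy.
    have sgn b' z : homog b' z -> phi (par false z) - phi (par true z) = ksign K b' *: phi z.
      move=> hz; rewrite !(par_homog _ hz) ksign_cases.
      by case: b' hz => _ /=; rewrite (lin0 lphi) ?sub0r ?subr0 ?scaleN1r ?scale1r.
    rewrite (sgn _ _ hx) (sgn _ _ hy) (sm_mul mphi) (Dder _ hfx) !(salgZl cA).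
    have hDx : homog (~~ b) (D (phi x)) by rewrite /homog -Dpar hfx.
    rewrite (salgC cA hfy hDx) !scalerA addrC; congr (_ + _).
    rewrite [X in _ = X *: _](_ : _ = 1) ?scale1r // !ksign_cases.
    by case: (b) (c) => [] [] /=; ring.
Qed.

Definition kahler_lift (m : kahler B) : A := meval (qrep m).

Lemma kahler_liftE t : kahler_lift (qcl (keqv_scong B) t) = meval t.
Proof. exact: meval_eqv (qrep_cl (keqv_scong B) t). Qed.

Definition deRham_gen (x : B + Pi (kahler B)) : A :=
  match x with inl x => phi x | inr m => kahler_lift m end.

Definition deRham_lift : deRham B -> A := pres_lift deRham_gen.

Lemma deRham_gen_rel s t : sym_rel s t -> aeval deRham_gen s = aeval deRham_gen t.
Proof.
pose qk (u : mterm B) : kahler B := qcl (keqv_scong B) u.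
have rK (m : kahler B) : m = qk (qrep m) by rewrite /qk qrepK.
have addE s' t' : qk s' + qk t' = qk (MAdd s' t') by exact: qaddE.
have oppE s' : - qk s' = qk (MOpp s') by exact: qoppE.
have scE c s' : c *: qk s' = qk (MScale c s') by exact: qscaleE.
have parE b s' : par b (qk s') = qk (MPar b s') by exact: qparE.
case=> {s t} [c x y|b x||x y|m n|b m|x m] /=.
- exact: lphi.
- exact: (sm_par mphi).
- exact: (sm_one mphi).
- exact: (sm_mul mphi).
- by rewrite (rK m) (rK n) [_ + _]addE !kahler_liftE.
- rewrite -[LHS]/(kahler_lift (@par K (kahler B) (~~ b) m)).
  by rewrite (rK m) parE !kahler_liftE /= negbK.
- have actE y s' : sact y (qk s') = qk (MAct y s').
    apply/qclP => E' hE'; case: (hE') => _ h2 _; apply: (sl_act h2).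
    by have /(_ E' hE') := qrep_cl (keqv_scong B) s'.
  rewrite -[LHS]/(kahler_lift (sact (par false x) (m : kahler B) - sact (par true x) (m : kahler B))).
  rewrite (rK m) !actE oppE [_ + _]addE !kahler_liftE /=.
  have PB := @par_linear _ B.
  rewrite !par_par /= (lin0 lphi) subr0 sub0r (salgNl cA) opprK -(salgDl cA) -(linD lphi).
  by rewrite -par_sum.
Qed.

Lemma deRham_lift_morph : salg_morph deRham_lift.
Proof. exact: (pres_lift_morph cA deRham_gen_rel). Qed.

Lemma deRham_lift_in x : deRham_lift (deRham_in x) = phi x.
Proof. exact: (pres_liftE cA deRham_gen_rel). Qed.

Lemma deRham_lift_d x : deRham_lift (deRham_d x) = D (phi x).
Proof.
by rewrite [LHS](pres_liftE cA deRham_gen_rel) /= /kd kahler_liftE.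
Qed.

End DeRhamLift.

(** * The morphism from the superjet algebra *)

Lemma surjective_comsalg (K : numFieldType) (A B : salg K) (f : A -> B) :
  salg_morph f -> (forall y, exists x, f x = y) -> is_comsalg A -> is_comsalg B.
Proof.
move=> [lf fp f1 fM] /choice[g fg] cA; have rw y : y = f (g y) by [].
have fD := linD lf; have fZ := linZ lf.
split; cbn [oadd oscale opar ops_of].
- by move=> s s' t t' -> ->.
- by move=> s t u; rewrite (rw s) (rw t) (rw u) -!fM (salgMA cA).
- by move=> s; rewrite (rw s) -f1 -fM (salg1M cA).
- by move=> s t u; rewrite (rw s) (rw t) (rw u) -!fM -!fD -fM (salgDl cA).
- by move=> s t u; rewrite (rw s) (rw t) (rw u) -!fM -!fD -fM (salgDr cA).
- by move=> c s t; rewrite (rw s) (rw t) -!fM -!fZ -fM (salgZl cA).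
- by move=> c s t; rewrite (rw s) (rw t) -!fM -!fZ -fM (salgZr cA).
- by rewrite -f1 -fp; congr f; exact: (ca_par1 cA).
- move=> b c s t; rewrite (rw s) (rw t) -!fp -!fM -fp; congr f; exact: (ca_parM cA).
- move=> b c s t; rewrite (rw s) (rw t) -!fp -!fM -fZ; congr f; exact: (ca_mulC cA).
Qed.

Lemma salg_morph_comp (K : fieldType) (A B C : salg K) (f : A -> B) (g : B -> C) :
  salg_morph f -> salg_morph g -> salg_morph (g \o f).
Proof.
move=> [lf fp f1 fM] [lg gp g1 gM]; split=> [c x y|b x||x y] /=.
- by rewrite lf lg.
- by rewrite fp gp.
- by rewrite f1 g1.
- by rewrite fM gM.
Qed.

Section Jets.
Variables (K : fieldType) (A : salg K).

Lemma jet_eq (x y : aterm K (A * nat)) : jet_rel x y -> acl (@jet_rel K A) x = acl (@jet_rel K A) y.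
Proof. by move=> h; apply/qclP => E [_ _]; apply. Qed.

Lemma jets_addE s t :
  acl (@jet_rel K A) s + acl (@jet_rel K A) t = acl (@jet_rel K A) (AAdd s t).
Proof. exact: qaddE. Qed.

Lemma jetD (x y : A) i : jet (x + y) i = jet x i + jet y i.
Proof. by rewrite jets_addE; apply: jet_eq; exact: jet_add. Qed.

Lemma jet0 i : jet (0 : A) i = 0.
Proof. by apply: (addrI (jet 0 i)); rewrite -jetD !addr0. Qed.

Lemma jetC c i : jet (c *: sone A) i = if i is 0 then c *: sone (jets A) else 0.
Proof.
case: i => [|i]; last by apply: jet_eq; exact: jet_const.
have scE s : c *: acl (@jet_rel K A) s = acl (@jet_rel K A) (AScale c s) by exact: qscaleE.
rewrite [LHS](jet_eq (jet_scale c (sone A))) -scE; congr (_ *: _).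
by apply: jet_eq; exact: jet_one.
Qed.

Lemma jetM (x y : A) i : jet (smul x y) i = \sum_(j < i.+1) smul (jet x j) (jet y (i - j)).
Proof.
rewrite [LHS](jet_eq (jet_mul x y i)).
have -> : forall t : seq 'I_i.+1, acl (@jet_rel K A)
   (\big[@AAdd K _/AZero]_(j <- t) AMul (AGen (x, nat_of_ord j)) (AGen (y, (i - j)%N))) =
   \sum_(j <- t) smul (jet x j) (jet y (i - j)); last by [].
by elim=> [|j t IH]; rewrite ?big_nil // !big_cons -jets_addE IH acl_mul.
Qed.

Lemma deRham_in_morph : salg_morph (@deRham_in K A).
Proof.
pose r := @sym_rel K A (Pi (kahler A)).
have addE s t : acl r s + acl r t = acl r (AAdd s t) by exact: qaddE.
have scE c s : c *: acl r s = acl r (AScale c s) by exact: qscaleE.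
have parE b s : par b (acl r s) = acl r (APar b s) by exact: qparE.
have eqE s t : r s t -> acl r s = acl r t by move=> h; apply/qclP => E [_ _]; apply.
split.
- by move=> c x y; rewrite /deRham_in scE addE; apply: eqE; exact: sym_baselin.
- by move=> b x; rewrite /deRham_in parE; apply: eqE; exact: sym_basepar.
- by apply: eqE; exact: sym_baseone.
- by move=> x y; rewrite /deRham_in acl_mul; apply: eqE; exact: sym_basemul.
Qed.

Fixpoint deRham_emb (k : nat) : A -> deRham_iter k A :=
  match k with
  | 0 => id
  | k'.+1 => fun x => deRham_in (deRham_emb k' x)
  end.
End Jets.

Lemma deRham_emb_morph (K : fieldType) (A : salg K) k : salg_morph (@deRham_emb K A k).
Proof.
elim: k => [|k IH]; first by split.
exact: salg_morph_comp IH (@deRham_in_morph K (deRham_iter k A)).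
Qed.

Lemma deRham_iter_comsalg (K : fieldType) (A : salg K) k :
  is_comsalg A -> is_comsalg (deRham_iter k A).
Proof. by case: k => // k _; exact: pres_comsalg. Qed.

Section SingularSupport.
Variables (K : numFieldType) (N : nat) (V : superspace K) (X : susy_data N V).
Local Notation vac := (vac X).
Local Notation E := (Li X).
Local Notation mode := (mode X).
Local Notation Tdiv := (Tdiv X).
Local Notation cl := (gr_cl X).
Local Notation RVc := (RV_cl X).
Local Notation "x ** y" := (smul x y) (at level 40, left associativity).
Hypothesis calc : susy_calculus X.

Lemma RV_eq a b : RVc a = RVc b <-> E 1 (a - b).
Proof. by rewrite -(C2_Li1 calc); exact: qclP. Qed.

Lemma RV_repK (x : RV X) : RVc (qrep x) = x.
Proof. exact: qrepK. Qed.

Lemma RV_rep a : E 1 (qrep (RVc a) - a).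
Proof. by apply/RV_eq; exact: RV_repK. Qed.

Lemma RV_linear : linear (RVc : V -> RV X).
Proof.
move=> c a b; rewrite [c *: RVc a](qscaleE (modC2_scong X)).
by rewrite [RHS](qaddE (modC2_scong X)).
Qed.

Lemma RV_par b a : par b (RVc a : RV X) = RVc (par b a).
Proof. exact: qparE. Qed.

Lemma RV_mul a b : (RVc a : RV X) ** RVc b = RVc (mode a (-1) b).
Proof.
apply/RV_eq; have ha := RV_rep a; have hb := RV_rep b.
set a' := qrep _ in ha *; set b' := qrep _ in hb *.
have -> : modes X a' (-1) [set: 'I_N]%SET b' - mode a (-1) b =
    mode (a' - a) (-1) b' + mode a (-1) (b' - b).
  rewrite (linD (mode_linl X _ _)) (linN (mode_linl X _ _)).
  by rewrite (linD (mode_linr X _ _)) (linN (mode_linr X _ _)) -/(mode a' _ _); lmod K.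
apply: LiD; first by have := Li_mul1 calc ha (LiT calc b').
by have := Li_mul1 calc (LiT calc a) hb.
Qed.

(** ** Existence of the morphism *)

Definition jet_value (x : RV X * nat) : gr X := cl x.2 (Tdiv x.2 (qrep x.1)).

Lemma Li_Tdiv0 i a : E i (Tdiv i a).
Proof. exact: (Li_Tdiv calc i (LiT calc a)). Qed.

Lemma jet_valueE a i : jet_value (RVc a, i) = cl i (Tdiv i a).
Proof.
apply/gr_clP; [exact: Li_Tdiv0|exact: Li_Tdiv0|].
rewrite -(linN (Tdiv_linear X i)) -(linD (Tdiv_linear X i)).
by have := Li_Tdiv calc i (RV_rep a); rewrite add1n.
Qed.

Lemma jet_value_rel s t : jet_rel s t -> aeval jet_value s = aeval jet_value t.
Proof.
have lT i := Tdiv_linear X i.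
case=> {s t} [|c x|c i i0|x y i|x y i|b x i]; cbn [aeval].
- by rewrite jet_valueE Tdiv0.
- rewrite -(RV_repK x) -(linZ RV_linear) !jet_valueE.
  by rewrite (linZ (lT 0%N)) gr_clZ //; exact: Li_Tdiv0.
- rewrite [sone _]/(RVc vac) -(linZ RV_linear) jet_valueE (linZ (lT i)).
  by rewrite Tdiv_vac // scaler0 gr_cl0.
- rewrite -(RV_repK x) -(RV_repK y) -(linD RV_linear) !jet_valueE.
  by rewrite (linD (lT i)) gr_clD //; exact: Li_Tdiv0.
- have -> : forall F : 'I_i.+1 -> aterm K (RV X * nat),
      aeval jet_value (\big[@AAdd K _/AZero]_(j < i.+1) F j) = \sum_(j < i.+1) aeval jet_value (F j).
    by move=> F; apply: (big_morph (aeval jet_value)).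
  rewrite -(RV_repK x) -(RV_repK y) RV_mul jet_valueE; cbn [aeval].
  set a := qrep x; set b := qrep y.
  under eq_bigr => j _ do rewrite !jet_valueE (gr_clM calc (Li_Tdiv0 _ _) (Li_Tdiv0 _ _)).
  have jE (j : 'I_i.+1) : (j + (i - j) = i)%N by rewrite subnKC // -ltnS.
  under eq_bigr => j _ do rewrite jE.
  have hin (j : 'I_i.+1) : E i (mode (Tdiv j a) (-1) (Tdiv (i - j) b)).
    by rewrite -[X in E X _](jE j); exact: (Li_mul1 calc (Li_Tdiv0 _ _) (Li_Tdiv0 _ _)).
  rewrite -gr_cl_sum //; apply/gr_clP; first exact: Li_Tdiv0.
    by elim/big_ind: _ => // [|u v]; [exact: Li0|exact: LiD].
  exact: Tdiv_mul.
- rewrite -(RV_repK x) RV_par !jet_valueE gr_cl_par; last exact: Li_Tdiv0.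
  congr (cl _ _); apply: (lin_eq (f := fun v => Tdiv i (par b v)) (g := fun v => par b (Tdiv i v))).
  + by move=> c u v; rewrite (@par_linear _ V b) (lT i).
  + by move=> c u v; rewrite (lT i) (@par_linear _ V b).
  move=> p v hv; rewrite (par_homog _ hv) (par_homog _ (Tdiv_par X i hv)).
  by case: eqP => // _; exact: (lin0 (lT i)).
Qed.

Lemma Phi_spec_morph k (phi : deRham_iter k (jets (RV X)) -> gr X) : Phi_spec phi -> salg_morph phi.
Proof. by case: k phi => [|k] phi; case. Qed.

Lemma Phi_spec_emb k (phi : deRham_iter k (jets (RV X)) -> gr X) : Phi_spec phi ->
  Phi_spec (k := 0) (phi \o @deRham_emb K (jets (RV X)) k).
Proof. by elim: k phi => [|k IH] phi //= [_ /IH + _]. Qed.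

(** On jets the relations are Leibniz' rule for T^i / i!; the k-th de Rham extension uses the odd
    derivation of the graded algebra induced by S^k. *)
Lemma Phi_exists k : (k <= N)%N -> exists phi : deRham_iter k (jets (RV X)) -> gr X, Phi_spec phi.
Proof.
have cgr := gr_comsalg calc.
elim: k => [_|k IH kN].
  exists (pres_lift jet_value); split; first exact: pres_lift_morph cgr jet_value_rel.
  by move=> a i; rewrite (pres_liftE cgr jet_value_rel) /= jet_valueE.
have [phi hphi] := IH (ltnW kN); pose D := @gr_S K N V X (Ordinal kN).
have mphi := Phi_spec_morph hphi.
have lD : linear D := gr_S_linear calc _.
have Dp b x : D (par b x) = par (~~ b) (D x) := gr_S_par calc _ b x.
have Dd b (x y : gr X) (hx : homog b x) : D (x ** y) = D x ** y + ksign K b *: (x ** D y)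
  := gr_S_derivation calc _ y hx.
exists (deRham_lift phi D); split.
- exact: deRham_lift_morph.
- suff -> : (fun x => deRham_lift phi D (deRham_in x)) = phi by [].
  by apply/funext => x; rewrite deRham_lift_in.
- move=> i ik x; rewrite deRham_lift_in // deRham_lift_d //.
  by congr (gr_S _ _); apply: val_inj.
Qed.

(** The jets of R_V already generate the graded algebra: the symbol of a_(-1-k) b is the
    product of those of T^k a / k! and b. *)
Lemma Phi_spec_surj (phi : jets (RV X) -> gr X) : Phi_spec (k := 0) phi ->
  forall y, exists x, phi x = y.
Proof.
move=> [mphi phiE]; have lphi := sm_linear mphi; apply: gr_ind.
- by exists 0; exact: (lin0 lphi).
- by move=> _ _ [x <-] [y <-]; exists (x + y); exact: (linD lphi).
move=> _ n a _ na.
suff h : E n a -> E n a /\ exists x, phi x = cl n a by have [] := h na.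
apply: (Li_ind calc (P := fun n a => E n a /\ exists x, phi x = cl n a)).
- by move=> m; split; [exact: Li0|exists 0; rewrite gr_cl0; exact: (lin0 lphi)].
- move=> m u v [hu [x xu]] [hv [y yv]]; split; first exact: LiD.
  by exists (x + y); rewrite (linD lphi) xu yv gr_clD.
- move=> m c u [hu [x xu]]; split; first exact: LiZ.
  by exists (c *: x); rewrite (linZ lphi) xu gr_clZ.
- move=> v; split; first exact: LiT.
  by exists (jet (A := RV X) (RVc v) 0); rewrite phiE -[_ *: _]/(Tdiv 0 v) Tdiv0.
- move=> m m' v mm' [hv [x xv]]; split; first exact: LiW hv.
  move: mm'; rewrite leq_eqVlt => /orP[/eqP ->|mm']; first by exists x.
  by exists 0; rewrite (lin0 lphi) gr_cl_eq0 //; exact: LiW hv.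
- move=> p b k s c hb [hc [x xc]]; split; first exact: Li_mode.
  exists (jet (A := RV X) (RVc b) k ** x); rewrite (sm_mul mphi) xc phiE -[_ *: _]/(Tdiv k b).
  rewrite gr_clM //; last exact: Li_Tdiv0.
  apply/gr_clP; [exact: (Li_mul1 calc (Li_Tdiv0 _ _))|exact: Li_mode|].
  by rewrite addnC; exact: (Li_Tdiv_mode calc k (LiT calc b) hc).
Qed.

Lemma Phi_correct : Phi_spec (@Phi K N V X) /\ forall y, exists x, @Phi K N V X x = y.
Proof.
apply: (@theP _ _ (fun phi : superjet N (RV X) -> gr X => Phi_spec phi /\ forall y, exists x, phi x = y)).
have [phi hphi] := Phi_exists (leqnn N); exists phi; split => // y.
have [x <-] := Phi_spec_surj (Phi_spec_emb hphi) y.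
by exists (deRham_emb N x).
Qed.

Lemma Phi_morph : salg_morph (@Phi K N V X).
Proof. exact: Phi_spec_morph Phi_correct.1. Qed.

Lemma Ann_grP f : @Ann_gr K N V X f <-> Phi f = 0.
Proof.
have cgr := gr_comsalg calc; split => [/(_ (sone _))|h m]; first by rewrite (salgM1 cgr).
by rewrite h; exact: (salg0l cgr).
Qed.

(** ** The degree zero part *)

Definition gr_RV (x : gr X) : RV X := RVc (gs (qrep (x : gr_space X) : grseq X) 0).

Lemma gr_RV_qc f : gr_RV (qcl (greqv_scong X) f) = RVc (gs f 0).
Proof. by apply/RV_eq; exact: (qrep_cl (greqv_scong X) f 0%N). Qed.

Lemma gr_RV_cl n a : E n a -> gr_RV (cl n a) = if n is 0 then RVc a else 0.
Proof.
by move=> na; rewrite (gr_clE na) gr_RV_qc /=; case: n na.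
Qed.

Lemma gr_RV_morph : salg_morph gr_RV.
Proof.
have rK (x : gr X) : x = qcl (greqv_scong X) (qrep (x : gr_space X)) by rewrite qrepK.
have lin : linear gr_RV.
  move=> c x y; rewrite (rK x) (rK y) [c *: qcl _ _](qscaleE (greqv_scong X)).
  by rewrite [_ + qcl _ _](qaddE (greqv_scong X)) !gr_RV_qc /= RV_linear.
split=> //.
- by move=> b x; rewrite (rK x) [par b _](qparE (greqv_scong X)) !gr_RV_qc RV_par.
- by rewrite [sone _]/(cl 0 vac) gr_RV_cl //; exact: LiT.
have cgr := gr_comsalg calc.
have RV0l x : (0 : RV X) ** x = 0.
  rewrite -(RV_repK x) -(lin0 RV_linear) RV_mul; congr RVc; exact: (lin0 (mode_linl X _ _)).
have RV0r (x : RV X) : x ** 0 = 0.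
  rewrite -(RV_repK x) -(lin0 RV_linear) RV_mul; congr RVc; exact: (lin0 (mode_linr X _ _)).
have RVDl (x y z : RV X) : (x + y) ** z = x ** z + y ** z.
  rewrite -(RV_repK x) -(RV_repK y) -(RV_repK z) -(linD RV_linear) !RV_mul.
  by rewrite (linD (mode_linl X _ _)) (linD RV_linear).
have RVDr (x y z : RV X) : x ** (y + z) = x ** y + x ** z.
  rewrite -(RV_repK x) -(RV_repK y) -(RV_repK z) -(linD RV_linear) !RV_mul.
  by rewrite (linD (mode_linr X _ _)) (linD RV_linear).
apply: gr_ind => [y|x x' hx hx' y|p r a ha ra].
- by rewrite (salg0l cgr) (lin0 lin) RV0l.
- by rewrite (salgDl cgr) !(linD lin) hx hx' RVDl.
apply: gr_ind => [|y y' hy hy'|q s b hb sb].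
- by rewrite (salg0r cgr) (lin0 lin) RV0r.
- by rewrite (salgDr cgr) !(linD lin) hy hy' RVDr.
rewrite gr_clM // !gr_RV_cl //; last exact: Li_mul1.
by case: r s {ra sb} => [|r] [|s]; rewrite ?RV0l ?RV0r // RV_mul.
Qed.

Lemma gr_RV_surj (y : RV X) : exists x, gr_RV x = y.
Proof. by exists (cl 0 (qrep y)); rewrite gr_RV_cl ?RV_repK //; exact: LiT. Qed.

Lemma RV_comsalg : is_comsalg (RV X).
Proof. exact: surjective_comsalg gr_RV_morph gr_RV_surj (gr_comsalg calc). Qed.

Lemma RV_fg_module : fg_RV_module X.
Proof.
exists [:: sone (RV X)] => x; exists (fun=> x).
by rewrite big_seq1 (salgM1 RV_comsalg).
Qed.

(** ** Generators of R_V *)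

(** A strong generating set G of V gives the generators of R_V represented by the vectors a'
    with a'_(n|N) = a_(n|J), for a in G: words with a letter of index at most -2 vanish in R_V. *)
Lemma RV_generated : finitely_strongly_generated X ->
  exists L : seq (RV X), span (words_in L) = setT.
Proof.
move=> [G genG].
have /choice[red redP] : forall aJ : V * {set 'I_N}, exists a', forall n v,
    modes X aJ.1 n aJ.2 v = mode a' n v by move=> [a J]; exact: modes_reduce.
pose L : seq (RV X) := [seq RVc (red aJ) | aJ <- allpairs pair G (enum {set 'I_N})].
exists L; apply/seteqP; split => // x _; rewrite -(RV_repK x).
have : setT (qrep x : V) by [].
rewrite -genG; apply: (span_map RV_linear) => _ [w hw ->].
elim: w hw => [|[[a p] J] w IH] hw; first by apply: span_in; exists [::].
have /= [aG p0] := hw _ (mem_head _ _).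
have {IH} := IH (fun t tw => hw t (mem_behead (s := (a, p, J) :: w) tw)).
cbn [foldr]; set u := foldr _ _ _ => hu /=.
case: p p0 hw => [|[|p]] // _ hw.
  rewrite (redP (a, J)) -RV_mul; move: hu.
  apply: (span_map (salg_linr RV_comsalg _)) => _ [t tL ->].
  apply: span_in; exists (RVc (red (a, J)) :: t) => // y; rewrite inE => /orP[/eqP ->|/tL //].
  by apply/mapP; exists (a, J) => //; apply/allpairsP; exists (a, J); split => //=; rewrite mem_enum.
suff -> : RVc (modes X a (- p.+2%:Z) J u) = 0 by exact: span0.
rewrite -(lin0 RV_linear); apply/RV_eq; rewrite subr0.
have -> : - p.+2%:Z = -1 - p.+1%:Z by lia.
by apply: LiW (Li_modes a p.+1 J (LiT calc u)); lia.
Qed.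

End SingularSupport.

(** * Dimension of the singular support *)

Lemma finite_dim_algebraic (K : numFieldType) (A : salg K) (x : A) : finite_dim A ->
  exists2 f : {poly K}, f != 0 & seval x f = 0.
Proof.
move=> [s sA]; have [i|c [i0 ci0] cx] :=
    @span_dependent K A s (size s).+1 (fun i => spow x i) (ltnSn _).
  by rewrite sA.
exists (\poly_(i < (size s).+1) c (inord i)).
  apply: contraNneq ci0 => f0; have := congr1 (fun f : {poly K} => f`_i0) f0.
  by rewrite coef_poly ltn_ord inord_val coef0 => ->.
rewrite (@seval_wide K A x _ (size s).+1) ?size_poly // -[RHS]cx.
by apply: eq_bigr => i _; rewrite coef_poly ltn_ord inord_val.
Qed.

Lemma preimage_Spec (K : fieldType) (A B : salg K) (f : A -> B) (p : set B) :
  salg_morph f -> Spec p -> Spec (f @^-1` p).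
Proof.
move=> [lf fp f1 fM] [ip p1 pp]; split; [split| |] => /=.
- by rewrite (lin0 lf); exact: (ideal0 ip).
- by move=> x y; rewrite (linD lf); exact: (idealD ip).
- by move=> x y; rewrite fM; exact: (idealMl ip).
- by move=> x y; rewrite fM; exact: (idealMr ip).
- by rewrite f1.
- by move=> x y; rewrite fM; exact: pp.
Qed.

Section ScalarQuotient.
Variables (K : numFieldType) (A : salg K).
Hypothesis cA : is_comsalg A.

Definition scalar_mod (p : set A) (x : A) : Prop := exists l : K, p (x - l *: sone A).

Lemma scalar_modD p x y : ideal p -> scalar_mod p x -> scalar_mod p y -> scalar_mod p (x + y).
Proof.
move=> ip [l hl] [m hm]; exists (l + m).
have -> : x + y - (l + m) *: sone A = (x - l *: sone A) + (y - m *: sone A) by lmod K.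
exact: idealD.
Qed.

Lemma scalar_modZ p c x : ideal p -> scalar_mod p x -> scalar_mod p (c *: x).
Proof.
move=> ip [l hl]; exists (c * l).
have -> : c *: x - (c * l) *: sone A = c *: (x - l *: sone A) by lmod K.
exact: (idealZ cA).
Qed.

Lemma scalar_modM p x y : ideal p -> scalar_mod p x -> scalar_mod p y -> scalar_mod p (smul x y).
Proof.
move=> ip [l hl] [m hm]; exists (l * m).
have -> : smul x y - (l * m) *: sone A =
    smul (x - l *: sone A) y + l *: (y - m *: sone A).
  by rewrite (salgDl cA) (salgNl cA) (salgZl cA) (salg1M cA); lmod K.
by apply: (idealD ip); [exact: (idealMr ip)|exact: (idealZ cA)].
Qed.

Lemma scalar_mod_in p x : p x -> scalar_mod p x.
Proof. by exists 0; rewrite scale0r subr0. Qed.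

Lemma scalar_mod_par p b x : Spec p -> scalar_mod p x -> scalar_mod p (par b x).
Proof.
move=> pS [l hl]; have [ip _ _] := pS; have PL := @par_linear _ A.
have podd v : homog true v -> p v by exact: prime_odd.
case: b; first exact/scalar_mod_in/podd/homog_par.
exists l; have := (ideal_par_sum cA (x - l *: sone A) ip podd).1 hl.
by rewrite (linD (PL _)) (linN (PL _)) (linZ (PL _)) (salg1_homog cA).
Qed.

(** If the base field is the residue field of all points of a space of primes, its irreducible
    closed subsets are points: the intersection of the primes of such a subset is one of its
    points, contained in all the others. *)
Lemma scalar_zero_dimensional (X : set (set A)) (I0 : set A) :
  X = [set p | Spec p /\ I0 `<=` p] ->
  (forall p, X p -> forall x, scalar_mod p x) -> zero_dimensional X.
Proof.
move=> XE Xs; suff pt Z : irreducible_closed X Z -> forall p q, Z p -> Z q -> p `<=` q.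
  move=> Z0 Z1 hZ0 hZ1 Z01; apply/seteqP; split => // p Z1p.
  have [_ [q Z0q] _] := hZ0; suff -> : p = q by [].
  by apply/seteqP; split; apply: (pt Z1) => //; exact: Z01.
move=> [[I ZE] [p0 Zp0] irr].
pose P : set A := [set x | forall p, Z p -> p x].
have ZX p : Z p -> X p by rewrite ZE => -[].
have ZS p : Z p -> Spec p by move/ZX; rewrite XE => -[].
have XP : X P.
  rewrite XE; split; last by move=> x I0x p /ZX; rewrite XE => -[_]; apply.
  split.
  - split=> [p /ZS[ip _ _]|x y hx hy p Zp|x y hy p Zp|x y hx p Zp].
    + exact: (ideal0 ip).
    + by have [ip _ _] := ZS _ Zp; apply: (idealD ip); [exact: hx|exact: hy].
    + by have [ip _ _] := ZS _ Zp; apply: (idealMl ip); exact: hy.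
    + by have [ip _ _] := ZS _ Zp; apply: (idealMr ip); exact: hx.
  - by move=> h; have [_ p1 _] := ZS _ Zp0; apply: p1; exact: h.
  move=> x y hxy.
  have cl u : zariski_closed X [set p | X p /\ [set u] `<=` p] by exists [set u].
  have [p Zp|Zx|Zy] := irr _ _ (cl x) (cl y).
  - have [_ _ pp] := ZS _ Zp; have [px|py] := pp _ _ (hxy p Zp); [left|right];
      by split; [exact: ZX|move=> _ ->].
  - by left=> p /Zx[_]; apply.
  - by right=> p /Zy[_]; apply.
move=> p q Zp Zq x px; have [l hl] := Xs P XP x.
have [ip p1 _] := ZS _ Zp; have pl : p (l *: sone A).
  by rewrite -[l *: _](subKr x); apply: (idealB cA) => //; exact: hl.
have l0 : l = 0.
  apply: contrapT => /eqP l0; apply: p1.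
  by rewrite -[sone A]scale1r -(mulVf l0) -scalerA; exact: (idealZ cA).
by have := hl q Zq; rewrite l0 scale0r subr0.
Qed.

(** A closed set V(I) is irreducible when I is a prime p, since p itself is a point of it. *)
Lemma zero_dimensional_no_chains (X : set (set A)) (p q : set A) :
  zero_dimensional X -> X p -> X q -> p `<=` q -> q `<=` p.
Proof.
move=> zd Xp Xq pq; pose Z r := [set r' | X r' /\ r `<=` r'].
have irr r : X r -> irreducible_closed X (Z r).
  move=> Xr; split; [by exists r|by exists r; split|].
  move=> _ _ [I1 ->] [I2 ->] /(_ r (conj Xr (@subset_refl _ r))).
  case=> -[_ h]; [left|right] => r' [Xr' rr']; split => //; exact: subset_trans rr'.
have ZE : Z q = Z p.
  apply: zd; [exact: irr|exact: irr|] => r [Xr qr]; split => //; exact: subset_trans qr.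
have : Z p p by split.
by rewrite -ZE => -[].
Qed.

End ScalarQuotient.

Section JetsOfFiniteDimensional.
Variables (K : numClosedFieldType) (A : salg K).
Hypothesis cA : is_comsalg A.
Hypothesis fdA : finite_dim A.
Variable p : set (jets A).
Hypothesis pS : Spec p.
Let cJ : is_comsalg (jets A) := pres_comsalg (@jet_rel K A).

Definition jet_core : set A := [set x | forall k, p (jet x k)].

(** If the k-th jet of x and the l-th jet of y are the first ones outside of p, the (k + l)-th jet of
    x y is congruent to their product modulo p. *)
Lemma jet_core_prime (x y : A) : jet_core (smul x y) -> jet_core x \/ jet_core y.
Proof.
have [ip _ pp] := pS.
move=> hxy; apply: contrapT => /not_orP[/existsNP nx /existsNP ny].
have first (z : A) : (exists k, ~ p (jet z k)) ->
    exists2 k, ~ p (jet z k) & forall j, (j < k)%N -> p (jet z j).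
  move=> [k0 hk0]; have ex : exists k, `[< ~ p (jet z k) >] by exists k0; exact/asboolP.
  exists (ex_minn ex); case: ex_minnP => k /asboolP hk kmin //.
  move=> j jk; apply: contrapT => hj; have := kmin j (asboolT hj).
  by rewrite leqNgt jk.
have [k xk kmin] := first x nx; have [l yl lmin] := first y ny.
have klt : (k < (k + l).+1)%N by rewrite ltnS leq_addr.
have := hxy (k + l)%N; rewrite jetM (bigD1 (Ordinal klt)) //= addKn.
set rest := \sum_(_ < _ | _) _ => h.
have hrest : p rest.
  rewrite /rest; elim/big_ind: _ => [|u v|j jk]; [exact: (ideal0 ip)|exact: (idealD ip)|].
  have [jlt|] := ltnP j k; first by apply: (idealMr ip); exact: kmin.
  rewrite leq_eqVlt => /orP[/eqP kj|kj].
    by case/negP: jk; apply/eqP/val_inj.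
  by apply: (idealMl ip); apply: lmin; have := ltn_ord j; lia.
have : p (smul (jet x k) (jet y l)).
  by rewrite -[smul _ _](addrK rest); exact: (idealB cJ).
by case/pp.
Qed.

(** An even x is a root of a polynomial.  One of the linear factors lies in the prime jet_core, so
    that x has the same jets as a constant modulo p. *)
Lemma jet_core_shift (x : A) : homog false x -> exists l : K, jet_core (x - l *: sone A).
Proof.
move=> hx; have [ip p1 pp] := pS; have [f f0 fx] := finite_dim_algebraic x fdA.
have [r fE] := closed_field_poly_normal f.
have : jet_core (seval x f) by rewrite fx => k; rewrite jet0; exact: (ideal0 ip).
rewrite fE (linZ (seval_linear x)).
elim: r {fE} => [|l r IH].
  rewrite big_nil -[1]/(1%:P) sevalC scalerA mulr1 => /(_ 0%N); rewrite jetC => h.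
  case: p1; rewrite -[sone _]scale1r -(mulVf (_ : lead_coef f != 0)) ?lead_coef_eq0 //.
  by rewrite -scalerA; exact: (idealZ cJ).
rewrite big_cons sevalM // sevalXC // -salgZr // => /jet_core_prime[h|/IH //].
by exists l.
Qed.

Lemma jet_scalar_mod (x : A) i : scalar_mod p (jet x i).
Proof.
have [ip _ _] := pS.
rewrite (par_sum x) jetD; apply: scalar_modD => //.
  have [l hl] := jet_core_shift (homog_par false x).
  rewrite -[par false x](subrK (l *: sone A)) jetD; apply: scalar_modD => //.
    exact/scalar_mod_in/hl.
  rewrite jetC; case: i => [|i]; last by apply: scalar_mod_in; exact: (ideal0 ip).
  by exists l; rewrite subrr; exact: (ideal0 ip).
apply: scalar_mod_in; have : jet_core (smul (par true x) (par true x)).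
  rewrite (salg_odd_sq cA (homog_par true x)) => k; rewrite jet0; exact: (ideal0 ip).
by case/jet_core_prime.
Qed.

Lemma jets_scalar_mod (g : jets A) : scalar_mod p g.
Proof.
have [ip _ _] := pS; move: g; apply: pres_ind.
- by move=> [x i]; exact: jet_scalar_mod.
- by apply: scalar_mod_in; exact: (ideal0 ip).
- by move=> x y; exact: scalar_modD.
- by move=> c x; exact: (scalar_modZ cJ).
- by move=> b x; exact: (scalar_mod_par cJ).
- by exists 1; rewrite scale1r subrr; exact: (ideal0 ip).
- by move=> x y; exact: (scalar_modM cJ).
Qed.

End JetsOfFiniteDimensional.

Section Equivalence.
Variables (K : numClosedFieldType) (N : nat) (V : superspace K) (X : susy_data N V).
Hypothesis calc : susy_calculus X.
Let cO : is_comsalg (superjet N (RV X)) :=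
  deRham_iter_comsalg N (pres_comsalg (@jet_rel K (RV X))).

Lemma cofinite_zero_dimensional : C2_cofinite X -> zero_dimensional (@SS K N V X).
Proof.
move=> fd; apply: (scalar_zero_dimensional cO (I0 := @Ann_gr K N V X)) => // p [pS Annp] f.
have me := @deRham_emb_morph K (jets (RV X)) N.
have [hPhi _] := Phi_correct calc.
have [g hg] := Phi_spec_surj calc (Phi_spec_emb hPhi) (Phi f).
have [ip _ _] := pS.
rewrite -[f](subrK (deRham_emb N g)); apply: scalar_modD => //.
  apply/scalar_mod_in/Annp/(Ann_grP calc).
  have lP := sm_linear (Phi_morph calc).
  by rewrite (linD lP) (linN lP) -hg subrr.
have [l hl] := jets_scalar_mod (RV_comsalg calc) fd (preimage_Spec me pS) g.
exists l; move: hl; rewrite /preimage /= (linD (sm_linear me)) (linN (sm_linear me)).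
by rewrite (linZ (sm_linear me)) (sm_one me).
Qed.

Lemma zero_dimensional_cofinite : uncountable K -> finitely_strongly_generated X ->
  zero_dimensional (@SS K N V X) -> C2_cofinite X.
Proof.
move=> unc /(RV_generated calc)[L genL] zd.
apply: (zero_dim_finite_dim (RV_comsalg calc) unc _ genL) => p q pS qS pq x qx.
have mpi := salg_morph_comp (Phi_morph calc) (gr_RV_morph calc).
pose pi := @gr_RV K N V X \o @Phi K N V X.
have inSS r : Spec r -> SS (pi @^-1` r).
  move=> rS; split; first exact: preimage_Spec mpi rS.
  move=> f /(Ann_grP calc) f0 /=; rewrite /preimage /pi /= f0.
  by have [ir _ _] := rS; rewrite (lin0 (sm_linear (gr_RV_morph calc))); exact: (ideal0 ir).
have [y yx] := gr_RV_surj calc x; have [_ /(_ y)[f fy]] := Phi_correct calc.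
have pif : pi f = x by rewrite /pi /= fy.
have := zero_dimensional_no_chains zd (inSS p pS) (inSS q qS) (fun g => pq (pi g)).
by move/(_ f); rewrite /preimage /= -/(pi f) pif; apply.
Qed.

End Equivalence.

Theorem theorem2 (R : realType) (N : nat) (V : superspace R[i])
    (X : susy_data N V) (r0 : nat) :
  (0 < N)%N ->
  (exists T : V -> V, NW_axioms X T) \/ NK_axioms X ->
  (0 < r0)%N ->
  is_graded X [set c : R[i] | exists n : nat, c = n%:R / r0%:R] ->
  finitely_strongly_generated X ->
  C2_cofinite X <-> lisse X.
Proof.
move=> N0 ax _ _ gen.
have calc : susy_calculus X.
  by case: ax => [[T axT]|axK]; [exact: NW_calculus axT|exact: NK_calculus N0 axK].
split=> [fd|[_ zd]]; last exact: (zero_dimensional_cofinite calc (@complex_uncountable R)).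
by split; [exact: RV_fg_module|exact: cofinite_zero_dimensional].
Qed.
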